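(* Consider the real vector space of functions $$V=\mathrm{Span}\{h^iI_0(h),\,h^jI_2(h):\ i,j=0,1,2\}$$ on one of the following real intervals: (i) $h>0$ (global center); (ii) $0<h<\frac14$ (truncated pendulum); (iii) $-\frac14<h<0$ or $h>0$ (eight loop). Except in the case $h>0$ of (iii), the vector space $V$ is Chebyshev, that is to say each function $I\in V$, not identically zero, has at most $5=\dim V-1$ zeros in its interval of definition, where zeros are counted with multiplicity. In the case $h>0$ of (iii), the number of zeros of each not identically zero function $I\in V$ is bounded by $6$.
   Context: The Hamiltonians are: (i) global center $H=\frac12y^2+\frac12x^2+\frac14x^4$, $h>0$; (ii) truncated pendulum $H=\frac12y^2+\frac12x^2-\frac14x^4$, $0<h<\frac14$; (iii) eight loop $H=\frac12y^2-\frac12x^2+\frac14x^4$, with $-\frac14<h<0$ (interior annuli) or $h>0$ (exterior annulus). In each case $I_0(h)=\int_{H=h}y\,dx$ and $I_2(h)=\int_{H=h}x^2y\,dx$, where the integral is over the real compact oval of $\{H=h\}$ depending continuously on $h$ in the given interval (in case (ii) the oval around the origin; in case (iii) with $-\frac14<h<0$, one of the two ovals around $(\pm1,0)$). *)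

(* Defs.v *)
From Stdlib Require Export Reals List.
From Coquelicot Require Export Coquelicot.
Open Scope R_scope.

(** * Period annuli *)

Inductive annulus : Set :=
| GlobalCenter
| TruncatedPendulum
| EightInteriorLeft
| EightInteriorRight
| EightExterior.

Definition Ham (A : annulus) (x y : R) : R :=
  match A with
  | GlobalCenter => 1/2 * y^2 + 1/2 * x^2 + 1/4 * x^4
  | TruncatedPendulum => 1/2 * y^2 + 1/2 * x^2 - 1/4 * x^4
  | EightInteriorLeft | EightInteriorRight | EightExterior =>
      1/2 * y^2 - 1/2 * x^2 + 1/4 * x^4
  end.

Definition interval (A : annulus) (h : R) : Prop :=
  match A with
  | GlobalCenter => 0 < h
  | TruncatedPendulum => 0 < h < 1/4
  | EightInteriorLeft | EightInteriorRight => -1/4 < h < 0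
  | EightExterior => 0 < h
  end.

(** The region selects one connected component of the level set.  For the
    pendulum with [0 < h < 1/4] no point of the level set has [x = 1] or
    [x = -1], and the two components with [1 < Rabs x] are not compact; for the
    eight loop with [h < 0] no point of the level set has [x = 0]. *)
Definition region (A : annulus) (x : R) : Prop :=
  match A with
  | GlobalCenter | EightExterior => True
  | TruncatedPendulum => -1 < x < 1
  | EightInteriorLeft => x < 0
  | EightInteriorRight => 0 < x
  end.

Definition oval (A : annulus) (h x y : R) : Prop :=
  Ham A x y = h /\ region A x.

(** * Integrals along ovals *)

(** [(x, y)] is a [T]-periodic regular [C^1] parametrization, one-to-one over a
    period, of the closed curve [C].  When [C] lies in a level set of [H], the
    velocity is a multiple of the Hamiltonian field [(H_y, - H_x)];
    [param_orient] says that the factor is positive, so that all ovals are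
    oriented by the Hamiltonian flow. *)
Record closed_param (H : R -> R -> R) (C : R -> R -> Prop)
    (x y : R -> R) (T : R) : Prop := {
  param_period_pos : 0 < T;
  param_ex_derive : forall t, ex_derive x t /\ ex_derive y t;
  param_C1 : forall t, continuous (Derive x) t /\ continuous (Derive y) t;
  param_periodic : forall t, x (t + T) = x t /\ y (t + T) = y t;
  param_inj : forall s t, 0 <= s < T -> 0 <= t < T ->
    x s = x t -> y s = y t -> s = t;
  param_image : forall p q, C p q <-> exists t, x t = p /\ y t = q;
  param_orient : forall t,
    0 < Derive x t * Derive (fun v => H (x t) v) (y t)
        - Derive y t * Derive (fun u => H u (y t)) (x t)
}.

(** [v] is the integral of the one-form [P(x, y) dx] along the oval. *)
Definition is_oval_integral (A : annulus) (P : R -> R -> R) (h v : R) : Prop :=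
  exists (x y : R -> R) (T : R),
    closed_param (Ham A) (oval A h) x y T /\
    is_RInt (fun t => P (x t) (y t) * Derive x t) 0 T v.

(** * Chebyshev spaces of functions on a subset of the line *)

(** A function on [J] is represented by any extension of it to [R]; a space of
    functions on [J] is a predicate that depends only on the values on [J]. *)

Definition lincomb (n : nat) (c : nat -> R) (b : nat -> R -> R) (h : R) : R :=
  fold_right Rplus 0 (map (fun i => c i * b i h) (seq 0 n)).

Definition has_dim (J : R -> Prop) (V : (R -> R) -> Prop) (n : nat) : Prop :=
  exists b : nat -> R -> R,
    (forall i, (i < n)%nat -> V (b i)) /\
    (forall c : nat -> R, (forall h, J h -> lincomb n c b h = 0) ->
       forall i, (i < n)%nat -> c i = 0) /\
    (forall f, V f -> exists c : nat -> R,
       forall h, J h -> f h = lincomb n c b h).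

Definition zero_of_order_ge (f : R -> R) (x : R) (m : nat) : Prop :=
  forall j, (j < m)%nat -> is_derive_n f j x 0.

(** An entry [(x, m)] of [l] is a zero [x] of multiplicity at least [m]; zeros of
    infinite order are thereby excluded as well. *)
Definition at_most_zeros (J : R -> Prop) (f : R -> R) (N : nat) : Prop :=
  forall l : list (R * nat),
    NoDup (map fst l) ->
    (forall x m, In (x, m) l -> J x /\ zero_of_order_ge f x m) ->
    (list_sum (map snd l) <= N)%nat.

Definition not_identically_zero (J : R -> Prop) (f : R -> R) : Prop :=
  exists h, J h /\ f h <> 0.

Definition chebyshev (J : R -> Prop) (V : (R -> R) -> Prop) (n : nat) : Prop :=
  has_dim J V n /\
  forall f, V f -> not_identically_zero J f -> at_most_zeros J f (n - 1).

(** The span over [R] of [h^i I0(h)] and [h^j I2(h)], [i, j = 0, 1, 2], as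
    functions on [J]; [sum_f_R0 u 2] is [u 0 + u 1 + u 2]. *)
Definition span_I0_I2 (J : R -> Prop) (I0 I2 : R -> R) (f : R -> R) : Prop :=
  exists a b : nat -> R, forall h, J h ->
    f h = sum_f_R0 (fun i => a i * (h ^ i * I0 h)) 2
        + sum_f_R0 (fun j => b j * (h ^ j * I2 h)) 2.

(* Main.v *)
Require Import Defs.
From Stdlib Require Import Lra Lia ZArith Classical Psatz Ranalysis5.

(** Why the theorem is true.

    Let [U] and [V] be the derivatives of [I0] and [I2] with respect to the energy, that is
    the integrals of [dx / y] and [x^2 dx / y]. Integrating [d (x y)] and [d (x^3 y)] along
    the oval gives two relations. After a change of sign, or a translation of the energy
    combined with a linear change of the two integrals, they read
    [3 I0 = 4 h U + V], [5 I2 = (4 h + 1) V + I0] on the half line, and the same with [- V]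
    and [4 h - 1] on the interval from [0] to [1/4]. Two consequences follow. The functions
    [U] and [V] satisfy a linear system of first order, and the derivative of
    [P I0 + Q I2] with [P], [Q] quadratic is again of the form [P U + Q V] with [P], [Q]
    quadratic. The heart of the matter is that a nonzero function of this form has at most
    [5] zeros. At a center all the integrals vanish, so that Rolle's theorem loses nothing
    and [5] is also the bound for the integrals ([center_bound]). The exterior annulus of
    the eight loop ends at the loop, Rolle's theorem loses one zero, and the bound is [6]
    ([primitive_bound]).

    The bound for [F = P U + Q V] is a Sturm argument. Some operator of second order [L], in
    divided form, maps the functions [P U + Q V] to functions of the same kind and acts on
    the six coefficients by a triangular matrix with real eigenvalues. If [g] is a positive
    eigenfunction for [lam], then a Wronskian [Phi] of [F] and [g] is proportional to
    [(F / g)'], with a positive factor, and its own derivative is proportional to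
    [(L - lam) F]. When everything is regular at the center, [Phi] vanishes there, and two
    applications of Rolle's theorem show that [F] has at most one zero more than
    [(L - lam) F]. Killing the six eigenvalues one after the other leaves nothing, whence at
    most [5] zeros ([chain_bound]). The same identities show that the eigenfunctions are
    positive, starting from the one for the lowest eigenvalue, which is visibly so
    ([eigen_positive]). The operator is a Legendre operator on the half line, and a twisted
    one on the interval from [0] to [1/4], with three double eigenvalues
    ([regular_half_line_bound], [regular_quarter_bound]).

    For the exterior annulus [U] has a logarithmic singularity at [h = 0] and [Phi] need not
    vanish. The functions [U] and [V] obey, however, the same system as those of the global
    center, which supply regular positive eigenfunctions. One kills the eigenvalues from the
    largest to the smallest and records at each step the signs at [0] and at infinity of the
    function and of its image; this determines how many zeros are lost. As in the theorem of
    Budan and Fourier, the total is at most the number of sign changes of two sequences. The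
    one at infinity consists of the leading coefficients. The one at [0] consists of the
    values at [0] of the polynomial factor of [U], which are Newton sums of the coefficients
    in the basis of eigenvectors; partial summation does not create sign changes, so that
    there are at most as many as in the sequence of coefficients itself ([changes_newton]).
    Since the eigenvectors have alternating leading coefficients and positive values at
    [0], the two numbers of sign changes add up to at most [5] ([sign_rule],
    [exterior_bound]).

    It remains to compute the integrals from the definition of the oval. A parametrization
    with the prescribed orientation runs along the upper branch between the two turning
    points and returns along the lower one ([oval_integral_value]). The substitution
    [x = sqrt p sin t], or [x^2 = 1 + u sin t] on the ovals around the lateral centers, turns
    the integrals into integrals over a fixed interval, in which the relations, the
    derivatives and the sizes near the ends can be read off. *)

(** * Counting zeros with multiplicity *)

Definition open_interval (J : R -> Prop) : Prop :=
  (forall x, J x -> locally x J) /\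
  (forall x y z, J x -> J z -> x <= y <= z -> J y).

(** Infinite differentiability on [J], as membership in a class closed under
    differentiation. Solutions of linear differential systems come with such a class, and
    products and inverses are then handled by induction on expressions, without any
    formula for higher derivatives. *)
Definition smooth (J : R -> Prop) (f : R -> R) : Prop :=
  exists C : (R -> R) -> Prop, C f /\
    forall g, C g -> exists g', C g' /\ forall x, J x -> is_derive g x (g' x).

Inductive algebra (J : R -> Prop) (B : (R -> R) -> Prop) : (R -> R) -> Prop :=
| alg_base f : B f -> algebra J B f
| alg_const c : algebra J B (fun _ => c)
| alg_id : algebra J B (fun x => x)
| alg_plus f g : algebra J B f -> algebra J B g -> algebra J B (fun x => f x + g x)
| alg_mult f g : algebra J B f -> algebra J B g -> algebra J B (fun x => f x * g x)
| alg_inv f : algebra J B f -> (forall x, J x -> f x <> 0) -> algebra J B (fun x => / f x).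

(** By the product and quotient rules an algebra of functions is closed under
    differentiation as soon as it contains the derivatives of its generators. *)
Lemma algebra_smooth J B :
  (forall f, B f -> exists f', algebra J B f' /\ forall x, J x -> is_derive f x (f' x)) ->
  forall f, algebra J B f -> smooth J f.
Proof.
intros HB f Hf. exists (algebra J B). split; [exact Hf|]. clear f Hf.
intros f Hf. induction Hf as [f Hf|c| |f g Hf [f' [Af Df]] Hg [g' [Ag Dg]]
  |f g Hf [f' [Af Df]] Hg [g' [Ag Dg]]|f Hf [f' [Af Df]] Hn].
- apply HB, Hf.
- exists (fun _ => 0). split; [apply alg_const|]. intros x _. apply @is_derive_const.
- exists (fun _ => 1). split; [apply alg_const|]. intros x _. apply @is_derive_id.
- exists (fun x => f' x + g' x). split; [now apply alg_plus|].
  intros x Hx. apply @is_derive_plus; auto.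
- exists (fun x => f' x * g x + f x * g' x). split.
  + apply alg_plus; apply alg_mult; auto.
  + intros x Hx. apply @is_derive_mult; auto. intros; apply Rmult_comm.
- exists (fun x => ((-1) * f' x) * (/ f x * / f x)). split.
  + apply alg_mult; [apply alg_mult; [apply alg_const|auto]|].
    apply alg_mult; apply alg_inv; auto.
  + intros x Hx. replace ((-1) * f' x * (/ f x * / f x)) with (- f' x / f x ^ 2).
    * apply is_derive_inv; auto.
    * field. auto.
Qed.

Ltac alg_tac := repeat first
  [ assumption | apply alg_const | apply alg_id | apply alg_plus | apply alg_mult | apply alg_inv ].

Section Smooth.
Variable J : R -> Prop.
Hypothesis HJ : open_interval J.

Lemma smooth_ext f g : (forall x, J x -> f x = g x) -> smooth J f -> smooth J g.
Proof.
intros E [C [Cf HC]].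
exists (fun k => exists k0, C k0 /\ forall x, J x -> k0 x = k x). split; [now exists f|].
intros k [k0 [Ck Ek]]. destruct (HC k0 Ck) as [k' [Ck' Dk]].
exists k'. split; [now exists k'|]. intros x Hx.
apply is_derive_ext_loc with k0; [|auto].
generalize (proj1 HJ x Hx). apply filter_imp. exact Ek.
Qed.

Lemma smooth_algebra (B : (R -> R) -> Prop) :
  (forall f, B f -> smooth J f) -> forall f, algebra J B f -> smooth J f.
Proof.
intros HB f Hf.
apply algebra_smooth with (B := fun g => exists C : (R -> R) -> Prop, C g /\
   forall k, C k -> exists k', C k' /\ forall x, J x -> is_derive k x (k' x)).
- intros g [C [Cg HC]]. destruct (HC g Cg) as [g' [Cg' Dg]].
  exists g'. split; [|exact Dg]. apply alg_base. now exists C.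
- induction Hf; [apply alg_base; now apply HB|..]; now constructor.
Qed.

Lemma smooth_const c : smooth J (fun _ => c).
Proof. apply (smooth_algebra (fun _ => False)); [easy|apply alg_const]. Qed.
Lemma smooth_id : smooth J (fun x => x).
Proof. apply (smooth_algebra (fun _ => False)); [easy|apply alg_id]. Qed.
Lemma smooth_plus f g : smooth J f -> smooth J g -> smooth J (fun x => f x + g x).
Proof.
intros Hf Hg. apply (smooth_algebra (smooth J)); [easy|].
apply alg_plus; now apply alg_base.
Qed.
Lemma smooth_mult f g : smooth J f -> smooth J g -> smooth J (fun x => f x * g x).
Proof.
intros Hf Hg. apply (smooth_algebra (smooth J)); [easy|].
apply alg_mult; now apply alg_base.
Qed.
Lemma smooth_inv f : smooth J f -> (forall x, J x -> f x <> 0) -> smooth J (fun x => / f x).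
Proof.
intros Hf Hg. apply (smooth_algebra (smooth J)); [easy|].
apply alg_inv; auto. now apply alg_base.
Qed.

Lemma smooth_opp f : smooth J f -> smooth J (fun x => - f x).
Proof.
intros Hf. apply smooth_ext with (fun x => (-1) * f x); [intros; ring|].
apply smooth_mult; auto using smooth_const.
Qed.
Lemma smooth_minus f g : smooth J f -> smooth J g -> smooth J (fun x => f x - g x).
Proof. intros Hf Hg. apply smooth_plus; auto using smooth_opp. Qed.
Lemma smooth_pow f n : smooth J f -> smooth J (fun x => f x ^ n).
Proof.
intros Hf. induction n as [|n IH]; [apply (smooth_const 1)|]. simpl. now apply smooth_mult.
Qed.

Lemma smooth_ex_derive f x : smooth J f -> J x -> ex_derive f x.
Proof.
intros [C [Cf HC]] Hx. destruct (HC f Cf) as [f' [_ D]]. now exists (f' x); apply D.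
Qed.

Lemma smooth_Derive f : smooth J f -> smooth J (Derive f).
Proof.
intros [C [Cf HC]]. destruct (HC f Cf) as [f' [Cf' D]].
apply smooth_ext with f'; [|now exists C].
intros x Hx. symmetry. apply is_derive_unique. auto.
Qed.

(** The total operator [Derive_n] lets the product rule be used as an equation; on smooth
    functions this is [zero_of_order_ge]. *)
Definition ord (f : R -> R) (a : R) (m : nat) : Prop :=
  forall j, (j < m)%nat -> Derive_n f j a = 0.

Lemma ord_S f a m : ord f a (S m) <-> f a = 0 /\ ord (Derive f) a m.
Proof.
assert (E : forall j, Derive_n (Derive f) j a = Derive_n f (S j) a).
{ intros j. change (Derive f) with (Derive_n f 1). rewrite Derive_n_comp.
  now rewrite Nat.add_1_r. }
split.
- intros H. split; [apply (H 0%nat); lia|]. intros j Hj. rewrite E. apply H; lia.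
- intros [H0 H] [|j] Hj; [exact H0|]. rewrite <- E. apply H; lia.
Qed.

Lemma ord_le f a m n : (m <= n)%nat -> ord f a n -> ord f a m.
Proof. intros L H j Hj. apply H; lia. Qed.

Lemma ord_ext f g a m : J a -> (forall x, J x -> f x = g x) -> ord f a m -> ord g a m.
Proof.
intros Ha E H j Hj. rewrite <- (H j Hj). apply Derive_n_ext_loc.
generalize (proj1 HJ a Ha). apply filter_imp. intros x Hx. symmetry. auto.
Qed.

Lemma ord_plus f g a m : J a -> smooth J f -> smooth J g ->
  ord f a m -> ord g a m -> ord (fun x => f x + g x) a m.
Proof.
intros Ha. revert f g. induction m as [|m IH]; intros f g Sf Sg Of Og.
- intros j Hj; lia.
- apply ord_S in Of. apply ord_S in Og. apply ord_S. split.
  + lra.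
  + apply ord_ext with (fun x => Derive f x + Derive g x); [exact Ha| |].
    * intros x Hx. symmetry. apply Derive_plus; now apply smooth_ex_derive.
    * apply IH; try easy; now apply smooth_Derive.
Qed.

Lemma ord_mult f w a m : J a -> smooth J f -> smooth J w ->
  ord f a m -> ord (fun x => f x * w x) a m.
Proof.
intros Ha. revert f w. induction m as [|m IH]; intros f w Sf Sw Of.
- intros j Hj; lia.
- assert (Of' := Of). apply ord_S in Of. apply ord_S. split.
  + destruct Of as [-> _]. ring.
  + apply ord_ext with (fun x => Derive f x * w x + f x * Derive w x); [exact Ha| |].
    * intros x Hx. symmetry. apply Derive_mult; now apply smooth_ex_derive.
    * assert (Sf' := smooth_Derive _ Sf). assert (Sw' := smooth_Derive _ Sw).
      apply ord_plus; [exact Ha|now apply smooth_mult|now apply smooth_mult| |].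
      -- apply IH; easy.
      -- apply IH; try easy. apply ord_le with (S m); auto.
Qed.

Definition zeros_of (f : R -> R) (l : list (R * nat)) : Prop :=
  NoDup (map fst l) /\ forall x m, In (x, m) l -> J x /\ ord f x m.

(** The bound is an integer, not a natural number, because the counts below are of the form
    one more, minus the gains at the two ends. *)
Definition Zle (f : R -> R) (B : Z) : Prop :=
  forall l, zeros_of f l -> (Z.of_nat (list_sum (map snd l)) <= B)%Z.

Lemma Zle_nonneg f B : Zle f B -> (0 <= B)%Z.
Proof. intros H. apply (H nil). split; [constructor|easy]. Qed.

Lemma Zle_weak f B B' : (B <= B')%Z -> Zle f B -> Zle f B'.
Proof. intros L H l Hl. specialize (H l Hl). lia. Qed.

Lemma Zle_at_most f N : smooth J f -> Zle f (Z.of_nat N) -> at_most_zeros J f N.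
Proof.
intros Sf H l ND Hl. apply Nat2Z.inj_le. apply H. split; [exact ND|].
intros x m Hin. destruct (Hl x m Hin) as [Hx Ho]. split; [exact Hx|].
intros j Hj. specialize (Ho j Hj). destruct j; [exact Ho|].
apply is_derive_unique in Ho. exact Ho.
Qed.

Lemma at_most_ext f g N : (forall x, J x -> f x = g x) ->
  at_most_zeros J f N -> at_most_zeros J g N.
Proof.
intros E H l ND Hl. apply H; [exact ND|]. intros x m Hin.
destruct (Hl x m Hin) as [Hx Ho]. split; [exact Hx|]. intros j Hj.
apply is_derive_n_ext_loc with g; [|now apply Ho].
generalize (proj1 HJ x Hx). apply filter_imp. intros y Hy; symmetry; auto.
Qed.

Lemma Zle_ext f g B : (forall x, J x -> f x = g x) -> Zle f B -> Zle g B.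
Proof.
intros E H l [ND Hl]. apply H. split; [exact ND|]. intros x m Hin.
destruct (Hl x m Hin) as [Hx Ho]. split; [exact Hx|].
apply ord_ext with g; auto. intros; symmetry; auto.
Qed.

Lemma Zle_mult f w B : smooth J f -> smooth J w ->
  Zle (fun x => f x * w x) B -> Zle f B.
Proof.
intros Sf Sw H l [ND Hl]. apply H. split; [exact ND|]. intros x m Hin.
destruct (Hl x m Hin) as [Hx Ho]. split; [exact Hx|]. now apply ord_mult.
Qed.

Lemma Zle_nozero f : (forall x, J x -> f x <> 0) -> Zle f 0.
Proof.
intros H l [_ Hl]. assert (E : list_sum (map snd l) = 0%nat); [|now rewrite E].
induction l as [|[x m] l IH]; [reflexivity|].
simpl. rewrite IH.
- destruct (Hl x m (or_introl eq_refl)) as [Hx Ho]. destruct m; [reflexivity|].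
  destruct (H x Hx). apply (Ho 0%nat). lia.
- intros y k Hin. apply Hl. now right.
Qed.

(** Increasing lists of zeros; the entry [(a, m)] records multiplicity [S m]. *)
Fixpoint sorted_zeros (f : R -> R) (lo : R) (l : list (R * nat)) : Prop :=
  match l with
  | nil => True
  | (a, m) :: l' => lo < a /\ J a /\ ord f a (S m) /\ sorted_zeros f a l'
  end.

Definition total (l : list (R * nat)) : nat := list_sum (map (fun p => S (snd p)) l).

Lemma sorted_zeros_lo f lo lo' l : lo' <= lo -> sorted_zeros f lo l -> sorted_zeros f lo' l.
Proof. destruct l as [|[a m] l]; simpl; [easy|]. intros; intuition lra. Qed.

Lemma sorted_zeros_insert f x m l : forall lo, sorted_zeros f lo l -> lo < x -> J x ->
  ord f x (S m) -> ~ In x (map fst l) ->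
  exists l', sorted_zeros f lo l' /\ total l' = (S m + total l)%nat /\
    forall y, In y (map fst l') -> y = x \/ In y (map fst l).
Proof.
induction l as [|[a k] l IH]; intros lo Hl Hlo Hx Ho Hn.
- exists ((x, m) :: nil). simpl. repeat split; auto. intros y [->|[]]; auto.
- simpl in Hl, Hn. destruct Hl as [H1 [H2 [H3 H4]]].
  destruct (Rtotal_order x a) as [L|[E|G]].
  + exists ((x, m) :: (a, k) :: l). simpl. repeat split; auto.
    intros y [->|[->|Hy]]; auto.
  + subst; tauto.
  + destruct (IH a H4 G Hx Ho) as [l' [S1 [S2 S3]]]; [tauto|].
    exists ((a, k) :: l'). simpl. repeat split; auto.
    * unfold total in *. simpl. rewrite S2. lia.
    * intros y [->|Hy]; auto. destruct (S3 y Hy); auto.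
Qed.

Lemma zeros_sort f l : zeros_of f l -> exists lo l', sorted_zeros f lo l' /\
  total l' = list_sum (map snd l) /\ forall y, In y (map fst l') -> In y (map fst l).
Proof.
induction l as [|[x m] l IH]; intros [ND Hl].
- exists 0, nil. simpl. auto.
- simpl in ND. inversion ND as [|? ? Hn ND']; subst.
  destruct IH as [lo [l' [S1 [S2 S3]]]].
  { split; [exact ND'|]. intros; apply Hl; now right. }
  destruct (Hl x m (or_introl eq_refl)) as [Hx Ho].
  destruct m as [|m].
  + exists lo, l'. simpl. repeat split; auto.
  + destruct (sorted_zeros_insert f x m l' (Rmin lo (x - 1))) as [l2 [T1 [T2 T3]]]; auto.
    * apply sorted_zeros_lo with lo; [apply Rmin_l|exact S1].
    * apply Rle_lt_trans with (x - 1); [apply Rmin_r|lra].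
    * exists (Rmin lo (x - 1)), l2. simpl. repeat split; auto.
      -- lia.
      -- intros y Hy. destruct (T3 y Hy); auto.
Qed.

(** The derivative is [w f1] with [w > 0], so that [f1] carries its zeros, multiplicities
    included. *)
Section Rolle.
Variables f f1 w : R -> R.
Hypothesis Sf : smooth J f.
Hypothesis Sf1 : smooth J f1.
Hypothesis Sw : smooth J w.
Hypothesis w_pos : forall x, J x -> 0 < w x.
Hypothesis Df : forall x, J x -> is_derive f x (w x * f1 x).

Lemma MVT_weighted a b : J a -> J b -> a < b ->
  exists c, a < c < b /\ J c /\ f b - f a = w c * f1 c * (b - a).
Proof.
intros Ha Hb L.
destruct (MVT_cor2 f (fun x => w x * f1 x) a b L) as [c [E Hc]].
- intros c Hc. apply is_derive_Reals. apply Df. apply (proj2 HJ) with a b; auto.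
- exists c. repeat split; try lra. apply (proj2 HJ) with a b; auto; lra.
Qed.

Lemma rolle_zero a b : J a -> J b -> a < b -> f a = 0 -> f b = 0 ->
  exists c, a < c < b /\ J c /\ f1 c = 0.
Proof.
intros Ha Hb L Fa Fb. destruct (MVT_weighted a b Ha Hb L) as [c [Hc [Jc E]]].
exists c. repeat split; try easy. rewrite Fa, Fb in E. specialize (w_pos c Jc).
destruct (Rmult_integral (w c * f1 c) (b - a)) as [H|H]; try lra.
destruct (Rmult_integral _ _ H); lra.
Qed.

Lemma rolle_ord a m : J a -> ord f a (S m) -> ord f1 a m.
Proof.
intros Ha Ho. apply ord_S in Ho. destruct Ho as [_ Ho].
apply ord_ext with (fun x => (w x * f1 x) * / w x); [exact Ha| |].
- intros x Hx. specialize (w_pos x Hx). field. lra.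
- apply ord_mult; [exact Ha|now apply smooth_mult| |].
  + apply smooth_inv; auto. intros x Hx. specialize (w_pos x Hx); lra.
  + apply ord_ext with (Derive f); auto. intros x Hx.
    apply is_derive_unique. auto.
Qed.

Lemma rolle_sorted l : forall lo a m, sorted_zeros f lo ((a, m) :: l) ->
  exists L b, zeros_of f1 L /\ (forall x, In x (map fst L) -> a <= x <= b) /\
    J b /\ f b = 0 /\ a <= b /\ S (list_sum (map snd L)) = total ((a, m) :: l).
Proof.
induction l as [|[a2 m2] l IH]; intros lo a m [H1 [Ja [Oa H2]]].
- exists ((a, m) :: nil), a. repeat split; auto; try lra.
  + simpl. constructor; [easy|constructor].
  + destruct H as [E|[]]. now injection E as -> ->.
  + destruct H as [E|[]]. injection E as -> ->. now apply rolle_ord.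
  + destruct H as [E|[]]. simpl in E. lra.
  + destruct H as [E|[]]. simpl in E. lra.
  + apply (Oa 0%nat). lia.
- destruct (IH a a2 m2 H2) as [L [b [[ND HL] [R1 [Jb [Fb [Lab T]]]]]]].
  destruct H2 as [Laa2 [Ja2 [Oa2 H2]]].
  destruct (rolle_zero a a2) as [c [Hc [Jc Fc]]]; auto.
  { apply (Oa 0%nat); lia. } { apply (Oa2 0%nat); lia. }
  exists ((a, m) :: (c, 1%nat) :: L), b. repeat split; auto.
  + simpl. constructor; [|constructor; [|exact ND]].
    * intros [E|Hin]; [lra|]. specialize (R1 _ Hin). lra.
    * intros Hin. specialize (R1 _ Hin). lra.
  + destruct H as [E|[E|Hin]]; [injection E as <- <-; exact Ja|injection E as <- <-; exact Jc|].
    apply (HL x m0 Hin).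
  + destruct H as [E|[E|Hin]]; [injection E as <- <-; now apply rolle_ord| |].
    * injection E as <- <-. intros [|j] Hj; [exact Fc|lia].
    * apply (HL x m0 Hin).
  + simpl in H. destruct H as [E|[E|Hin]]; [lra|lra|]. specialize (R1 _ Hin). lra.
  + simpl in H. destruct H as [E|[E|Hin]]; [lra|lra|]. specialize (R1 _ Hin). lra.
  + lra.
  + unfold total in *. simpl in *. lia.
Qed.

(** What Rolle's theorem would give if [f] vanished at the end of the interval as well. *)
Definition left_gain := forall a, J a -> f a = 0 -> exists c, J c /\ c < a /\ f1 c = 0.
Definition right_gain := forall a, J a -> f a = 0 -> exists c, J c /\ a < c /\ f1 c = 0.

(** Rolle's theorem gives a zero of [f1] between two consecutive zeros of [f], and a gain
    one more beyond an extreme zero of [f]. The last hypothesis is for a function [f]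
    without zeros, about which the gains say nothing. *)
Lemma rolle_count (eL eR : bool) B :
  Zle f1 B -> (eL = true -> left_gain) -> (eR = true -> right_gain) ->
  (eL = true -> eR = true -> exists c, J c /\ f1 c = 0) ->
  Zle f (B + 1 - Z.b2z eL - Z.b2z eR).
Proof.
intros HB HL HR HLR l Hl.
destruct (zeros_sort f l Hl) as [lo [l' [S1 [S2 _]]]]. rewrite <- S2. clear l Hl S2.
destruct l' as [|[a m] l].
- assert (B0 := Zle_nonneg _ _ HB). simpl.
  destruct eL, eR; simpl; try lia.
  destruct HLR as [c [Jc Fc]]; auto.
  assert (1 <= B)%Z; [|lia]. apply (HB ((c, 1%nat) :: nil)). split.
  + simpl. constructor; [easy|constructor].
  + intros x k [E|[]]. injection E as <- <-. split; [exact Jc|].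
    intros [|j] Hj; [exact Fc|lia].
- destruct (rolle_sorted l lo a m S1) as [L [b [[ND ZL] [R1 [Jb [Fb [Lab T]]]]]]].
  destruct S1 as [_ [Ja [Oa _]]].
  assert (Fa : f a = 0) by (apply (Oa 0%nat); lia).
  rewrite <- T. clear T Oa.
  assert (Add : forall c L', J c -> f1 c = 0 -> zeros_of f1 L' -> ~ In c (map fst L') ->
     zeros_of f1 ((c, 1%nat) :: L')).
  { intros c L' Jc Fc [ND' Z'] Hn. split; [simpl; now constructor|].
    intros x k [E|Hin]; [injection E as <- <-; split; [exact Jc|]|now apply Z'].
    intros [|j] Hj; [exact Fc|lia]. }
  assert (ZL' : zeros_of f1 L) by (split; assumption).
  assert (HL' : exists L1, zeros_of f1 L1 /\ (forall x, In x (map fst L1) -> x <= b) /\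
      Z.of_nat (list_sum (map snd L1)) = (Z.of_nat (list_sum (map snd L)) + Z.b2z eL)%Z).
  { destruct eL.
    - destruct (HL eq_refl a Ja Fa) as [c [Jc [Lc Fc]]].
      exists ((c, 1%nat) :: L). split; [|split].
      + apply Add; auto. intros Hin. specialize (R1 _ Hin). lra.
      + simpl. intros x [<-|Hin]; [lra|]. specialize (R1 _ Hin). lra.
      + simpl. lia.
    - exists L. split; [auto|split]; [|simpl; lia].
      intros x Hin. specialize (R1 _ Hin). lra. }
  destruct HL' as [L1 [Z1 [U1 E1]]].
  assert (HR' : exists L2, zeros_of f1 L2 /\
      Z.of_nat (list_sum (map snd L2)) = (Z.of_nat (list_sum (map snd L1)) + Z.b2z eR)%Z).
  { destruct eR.
    - destruct (HR eq_refl b Jb Fb) as [c [Jc [Lc Fc]]].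
      exists ((c, 1%nat) :: L1). split; [|simpl; lia].
      apply Add; auto. intros Hin. specialize (U1 _ Hin). lra.
    - exists L1. split; [auto|simpl; lia]. }
  destruct HR' as [L2 [Z2 E2]].
  specialize (HB L2 Z2). lia.
Qed.

End Rolle.
End Smooth.

Ltac smooth_tac := repeat first
  [ assumption | apply smooth_const | apply smooth_id | apply smooth_plus
  | apply smooth_minus | apply smooth_opp | apply smooth_mult | apply smooth_pow ].

(** * Behaviour at the left end of the interval *)

Lemma IVT_between f a b : (forall t, a <= t <= b -> continuity_pt f t) -> a < b -> f a * f b < 0 ->
  exists c, a < c < b /\ f c = 0.
Proof.
intros Cf L Hs.
assert (H : exists c, a <= c <= b /\ f c = 0).
{ destruct (Rtotal_order (f a) 0) as [N|[Z|P]].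
  - destruct (IVT_interv f a b Cf L N) as [c Hc]; [nra|eauto].
  - rewrite Z in Hs. lra.
  - destruct (IVT_interv (fun t => - f t) a b) as [c [Hc E]]; try nra.
    + intros t Ht. apply continuity_pt_opp. auto.
    + exists c. split; [auto|lra]. }
destruct H as [c [Hc E]]. exists c.
assert (c <> a) by (intros ->; rewrite E in Hs; lra).
assert (c <> b) by (intros ->; rewrite E in Hs; lra). lra.
Qed.

Section Intervals.
Variable J : R -> Prop.
Hypothesis HJ : open_interval J.

Lemma smooth_continuity_pt f x : smooth J f -> J x -> continuity_pt f x.
Proof.
intros Sf Hx. apply derivable_continuous_pt.
exists (Derive f x). apply is_derive_Reals. apply Derive_correct.
now apply smooth_ex_derive with J.
Qed.

Lemma IVT_zero f a b : smooth J f -> J a -> J b -> a < b -> f a * f b < 0 ->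
  exists c, a < c < b /\ J c /\ f c = 0.
Proof.
intros Sf Ha Hb L Hs.
destruct (IVT_between f a b) as [c [Hc E]]; auto.
- intros x Hx. apply smooth_continuity_pt; auto. apply (proj2 HJ) with a b; auto.
- exists c. repeat split; try lra. apply (proj2 HJ) with a b; auto; lra.
Qed.

Lemma first_zero f a b : smooth J f -> J a -> J b -> a < b -> 0 < f a -> f b <= 0 ->
  exists t, a < t <= b /\ f t = 0 /\ forall x, a <= x < t -> 0 < f x.
Proof.
intros Sf Ha Hb L Fa Fb.
assert (Jc : forall x, a <= x <= b -> J x) by (intros x Hx; apply (proj2 HJ) with a b; auto).
pose (E := fun x => a <= x <= b /\ forall z, a <= z <= x -> 0 < f z).
destruct (completeness E) as [t [U1 U2]].
- exists b. intros x [Hx _]. lra.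
- exists a. split; [lra|]. intros z Hz. replace z with a by lra. exact Fa.
- assert (at_ : a <= t) by (apply U1; split; [lra|]; intros z Hz; replace z with a by lra; exact Fa).
  assert (tb : t <= b) by (apply U2; intros x [Hx _]; lra).
  assert (P : forall x, a <= x < t -> 0 < f x).
  { intros x Hx. destruct (classic (exists y, E y /\ x <= y)) as [[y [[Hy1 Hy2] Hxy]]|N].
    - apply Hy2; lra.
    - exfalso. assert (t <= x); [|lra]. apply U2. intros y Ey.
      destruct (Rle_lt_dec y x); auto. exfalso. apply N. exists y. split; [exact Ey|lra]. }
  assert (Ct := smooth_continuity_pt f t Sf (Jc t (conj at_ tb))).
  assert (Ft : f t = 0).
  { destruct (Rtotal_order (f t) 0) as [Neg|[Z|Pos]]; auto; exfalso.
    - destruct (Ct (- f t)) as [d [d0 Hd]]; [lra|].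
      assert (t <> a) by (intros ->; lra).
      pose (x := Rmax a (t - d / 2)).
      assert (a <= x < t) by (unfold x, Rmax; destruct (Rle_dec a (t - d/2)); lra).
      assert (0 < f x) by (apply P; auto).
      specialize (Hd x). unfold dist in Hd; simpl in Hd. unfold R_dist in Hd.
      assert (Rabs (f x - f t) < - f t).
      { apply Hd. split; [split; [exact I|lra]|].
        rewrite Rabs_left by lra. unfold x, Rmax in *. destruct (Rle_dec a (t - d/2)); lra. }
      rewrite Rabs_right in H2 by lra. lra.
    - destruct (Ct (f t)) as [d [d0 Hd]]; [lra|].
      assert (t <> b) by (intros ->; lra).
      pose (x := Rmin b (t + d / 2)).
      assert (t < x <= b) by (unfold x, Rmin; destruct (Rle_dec b (t + d/2)); lra).
      assert (Ex : E x).
      { split; [lra|]. intros z Hz. destruct (Rlt_le_dec z t) as [zt|tz]; [apply P; lra|].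
        destruct (Req_dec z t) as [->|ne]; [exact Pos|].
        specialize (Hd z). unfold dist in Hd; simpl in Hd. unfold R_dist in Hd.
        assert (Rabs (f z - f t) < f t).
        { apply Hd. split; [split; [exact I|lra]|].
          rewrite Rabs_right by lra. unfold x, Rmin in *. destruct (Rle_dec b (t + d/2)); lra. }
        apply Rabs_def2 in H1. lra. }
      specialize (U1 x Ex). lra. }
  exists t. repeat split; auto. assert (t <> a) by (intros ->; lra). lra.
Qed.

Definition vanishes_at0 (f : R -> R) : Prop :=
  forall eps, 0 < eps -> exists d, 0 < d /\ forall x, J x -> x < d -> Rabs (f x) < eps.

Definition bounded_at0 (f : R -> R) : Prop :=
  exists C d, 0 < d /\ 0 <= C /\ forall x, J x -> x < d -> Rabs (f x) <= C.

Lemma vanishes_bounded f : vanishes_at0 f -> bounded_at0 f.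
Proof.
intros H. destruct (H 1) as [d [d0 Hd]]; [lra|]. exists 1, d. repeat split; try lra.
intros x Jx Hx. specialize (Hd x Jx Hx). lra.
Qed.
Lemma vanishes_plus f g : vanishes_at0 f -> vanishes_at0 g -> vanishes_at0 (fun x => f x + g x).
Proof.
intros Hf Hg eps He. destruct (Hf (eps / 2)) as [d1 [d10 Hd1]]; [lra|].
destruct (Hg (eps / 2)) as [d2 [d20 Hd2]]; [lra|].
exists (Rmin d1 d2). split; [now apply Rmin_pos|]. intros x Jx Hx.
assert (x < d1) by (apply Rlt_le_trans with (1 := Hx); apply Rmin_l).
assert (x < d2) by (apply Rlt_le_trans with (1 := Hx); apply Rmin_r).
specialize (Hd1 x Jx H). specialize (Hd2 x Jx H0).
apply Rle_lt_trans with (1 := Rabs_triang _ _). lra.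
Qed.
Lemma vanishes_mult f g : vanishes_at0 f -> bounded_at0 g -> vanishes_at0 (fun x => f x * g x).
Proof.
intros Hf [C [d2 [d20 [C0 Hd2]]]] eps He.
destruct (Hf (eps / (C + 1))) as [d1 [d10 Hd1]]; [apply Rdiv_lt_0_compat; lra|].
exists (Rmin d1 d2). split; [now apply Rmin_pos|]. intros x Jx Hx.
assert (x < d1) by (apply Rlt_le_trans with (1 := Hx); apply Rmin_l).
assert (x < d2) by (apply Rlt_le_trans with (1 := Hx); apply Rmin_r).
specialize (Hd1 x Jx H). specialize (Hd2 x Jx H0). rewrite Rabs_mult.
apply Rle_lt_trans with (Rabs (f x) * (C + 1)).
- apply Rmult_le_compat_l; [apply Rabs_pos|lra].
- replace eps with (eps / (C + 1) * (C + 1)) by (field; lra).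
  apply Rmult_lt_compat_r; lra.
Qed.
Lemma bounded_plus f g : bounded_at0 f -> bounded_at0 g -> bounded_at0 (fun x => f x + g x).
Proof.
intros [C1 [d1 [d10 [C10 Hd1]]]] [C2 [d2 [d20 [C20 Hd2]]]].
exists (C1 + C2), (Rmin d1 d2). split; [now apply Rmin_pos|]. split; [lra|]. intros x Jx Hx.
assert (x < d1) by (apply Rlt_le_trans with (1 := Hx); apply Rmin_l).
assert (x < d2) by (apply Rlt_le_trans with (1 := Hx); apply Rmin_r).
specialize (Hd1 x Jx H). specialize (Hd2 x Jx H0).
apply Rle_trans with (1 := Rabs_triang _ _). lra.
Qed.
Lemma bounded_mult f g : bounded_at0 f -> bounded_at0 g -> bounded_at0 (fun x => f x * g x).
Proof.
intros [C1 [d1 [d10 [C10 Hd1]]]] [C2 [d2 [d20 [C20 Hd2]]]].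
exists (C1 * C2), (Rmin d1 d2). split; [now apply Rmin_pos|]. split; [nra|]. intros x Jx Hx.
assert (x < d1) by (apply Rlt_le_trans with (1 := Hx); apply Rmin_l).
assert (x < d2) by (apply Rlt_le_trans with (1 := Hx); apply Rmin_r).
specialize (Hd1 x Jx H). specialize (Hd2 x Jx H0). rewrite Rabs_mult.
apply Rmult_le_compat; auto using Rabs_pos.
Qed.
Lemma bounded_const c : bounded_at0 (fun _ => c).
Proof. exists (Rabs c), 1. split; [lra|split; [apply Rabs_pos|intros; lra]]. Qed.
Lemma vanishes_ext f g : (forall x, J x -> f x = g x) -> vanishes_at0 f -> vanishes_at0 g.
Proof.
intros E H eps He. destruct (H eps He) as [d [d0 Hd]]. exists d. split; auto.
intros x Jx Hx. rewrite <- E; auto.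
Qed.

Hypothesis J_pos : forall x, J x -> 0 < x.
Hypothesis J_down : forall x y, J x -> 0 < y <= x -> J y.

Lemma vanishes_id : vanishes_at0 (fun x => x).
Proof.
intros eps He. exists eps. split; auto. intros x Jx Hx. specialize (J_pos x Jx).
rewrite Rabs_right; lra.
Qed.

(** A function that tends to [0] at the end and has a zero [a] is either zero halfway or
    not monotone, and its derivative changes sign. *)
Lemma vanishes_left_gain f f1 w :
  smooth J f1 -> (forall x, J x -> 0 < w x) ->
  (forall x, J x -> is_derive f x (w x * f1 x)) -> vanishes_at0 f -> left_gain J f f1.
Proof.
intros Sf1 w0 Df V a Ja Fa.
assert (a0 := J_pos a Ja).
assert (Jm : J (a / 2)) by (apply J_down with a; auto; lra).
destruct (Req_dec (f (a / 2)) 0) as [Z|NZ].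
{ destruct (rolle_zero J HJ f f1 w w0 Df (a / 2) a) as [c [Hc [Jc Fc]]]; auto; [lra|].
  exists c. repeat split; auto; lra. }
destruct (V (Rabs (f (a / 2)))) as [d [d0 Hd]]; [now apply Rabs_pos_lt|].
pose (x := Rmin (a / 4) (d / 2)).
assert (Hx : 0 < x <= a / 4) by (unfold x, Rmin; destruct (Rle_dec (a/4) (d/2)); lra).
assert (Hxd : x < d) by (unfold x, Rmin; destruct (Rle_dec (a/4) (d/2)); lra).
assert (Jx : J x) by (apply J_down with a; auto; lra).
specialize (Hd x Jx Hxd).
destruct (MVT_weighted J HJ f f1 w Df x (a / 2)) as [c1 [H1 [J1 E1]]]; auto; [lra|].
destruct (MVT_weighted J HJ f f1 w Df (a / 2) a) as [c2 [H2 [J2 E2]]]; auto; [lra|].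
destruct (IVT_zero f1 c1 c2) as [c [Hc [Jc Fc]]]; auto; [lra| |exists c; repeat split; auto; lra].
rewrite Fa in E2. assert (W1 := w0 c1 J1). assert (W2 := w0 c2 J2).
destruct (Rlt_le_dec 0 (f (a / 2))) as [P|N].
- rewrite (Rabs_right (f (a/2))) in Hd by lra. apply Rabs_def2 in Hd.
  assert (0 < f1 c1). { apply Rnot_le_lt. intros H.
    assert (0 <= w c1 * (- f1 c1) * (a / 2 - x)) by (repeat apply Rmult_le_pos; lra). lra. }
  assert (f1 c2 < 0). { apply Rnot_le_lt. intros H'.
    assert (0 <= w c2 * f1 c2 * (a - a / 2)) by (repeat apply Rmult_le_pos; lra). lra. }
  nra.
- rewrite (Rabs_left (f (a/2))) in Hd by lra. apply Rabs_def2 in Hd.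
  assert (f1 c1 < 0). { apply Rnot_le_lt. intros H.
    assert (0 <= w c1 * f1 c1 * (a / 2 - x)) by (repeat apply Rmult_le_pos; lra). lra. }
  assert (0 < f1 c2). { apply Rnot_le_lt. intros H'.
    assert (0 <= w c2 * (- f1 c2) * (a - a / 2)) by (repeat apply Rmult_le_pos; lra). lra. }
  nra.
Qed.

(** [F1] is obtained from [F] by a second order operator in divided form: divide by [g],
    differentiate, divide by [al], differentiate, divide by [be]. *)
Section Step.
Variables F g F1 Phi al be : R -> R.
Hypothesis SF : smooth J F.
Hypothesis Sg : smooth J g.
Hypothesis SF1 : smooth J F1.
Hypothesis SPhi : smooth J Phi.
Hypothesis Sal : smooth J al.
Hypothesis Sbe : smooth J be.
Hypothesis al_pos : forall x, J x -> 0 < al x.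
Hypothesis be_pos : forall x, J x -> 0 < be x.
Hypothesis g_pos : forall x, J x -> 0 < g x.
Hypothesis D1 : forall x, J x -> is_derive (fun t => F t * / g t) x (al x * Phi x).
Hypothesis D2 : forall x, J x -> is_derive Phi x (be x * F1 x).

(** Applying Rolle's theorem twice, to [F / g] and to [Phi], costs two zeros; the vanishing
    of [Phi] at the end of the interval gives one of them back. *)
Lemma flux_step B : vanishes_at0 Phi -> Zle J F1 B -> Zle J F (B + 1).
Proof.
intros V Z1.
assert (Sig : smooth J (fun t => / g t)).
{ apply smooth_inv; [exact Sg|]. intros x Hx. specialize (g_pos x Hx). lra. }
apply Zle_mult with (fun t => / g t); auto.
assert (Z2 : Zle J Phi (B + 1 - 1 - 0)).
{ apply (rolle_count J HJ Phi F1 be) with (eL := true) (eR := false); auto; try easy.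
  intros _. apply vanishes_left_gain with be; auto. }
assert (Z3 := rolle_count J HJ (fun t => F t * / g t) Phi al).
apply Zle_weak with ((B + 1 - 1 - 0) + 1 - Z.b2z false - Z.b2z false)%Z; [simpl; lia|].
apply Z3; auto; try easy.
Qed.
End Step.

(** As long as [F > 0] the flux [Phi] increases from [0], hence is nonnegative, hence
    [F / g] increases: [F] cannot come down to its first zero. *)
Lemma flux_positive F g Phi al be mu :
  smooth J (fun t => F t * / g t) -> 0 <= mu ->
  (forall x, J x -> 0 < al x) -> (forall x, J x -> 0 < be x) -> (forall x, J x -> 0 < g x) ->
  (forall x, J x -> is_derive (fun t => F t * / g t) x (al x * Phi x)) ->
  (forall x, J x -> is_derive Phi x (be x * (mu * F x))) ->
  vanishes_at0 Phi -> (exists d, 0 < d /\ forall x, J x -> x < d -> 0 < F x) ->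
  forall x, J x -> 0 < F x.
Proof.
intros Sy Hmu al0 be0 g0 D1 D2 V [d [d0 Hd]] b Jb.
assert (b0 := J_pos b Jb).
apply Rnot_le_lt. intros Fb.
pose (y := fun t => F t * / g t).
assert (sgn : forall x, J x -> 0 < y x -> 0 < F x).
{ intros x Jx Hy. unfold y in Hy. specialize (g0 x Jx).
  replace (F x) with (F x * / g x * g x) by (field; lra). now apply Rmult_lt_0_compat. }
assert (sgn' : forall x, J x -> 0 < F x -> 0 < y x).
{ intros x Jx Hy. unfold y. apply Rmult_lt_0_compat; auto. apply Rinv_0_lt_compat; auto. }
pose (a := Rmin (b / 2) (d / 2)).
assert (Ha : 0 < a <= b / 2) by (unfold a, Rmin; destruct (Rle_dec (b/2) (d/2)); lra).
assert (Had : a < d) by (unfold a, Rmin; destruct (Rle_dec (b/2) (d/2)); lra).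
assert (Ja : J a) by (apply J_down with b; auto; lra).
assert (ya : 0 < y a) by auto.
assert (yb : y b <= 0).
{ apply Rnot_lt_le. intros H. specialize (sgn b Jb H). lra. }
destruct (first_zero y a b) as [t [Ht [yt Pt]]]; auto; [lra|].
assert (Jt : J t) by (apply J_down with b; auto; lra).
assert (Jx : forall x, 0 < x <= t -> J x) by (intros x Hx; apply J_down with t; auto).
assert (Fpos : forall x, 0 < x < t -> 0 < F x).
{ intros x Hx. destruct (Rlt_le_dec x a) as [L|G]; [apply Hd; [apply Jx; lra|lra]|].
  apply sgn; [apply Jx; lra|]. apply Pt; lra. }
assert (mono : forall u v, 0 < u < v -> v < t -> Phi u <= Phi v).
{ intros u v Hu Hv.
  destruct (MVT_cor2 Phi (fun x => be x * (mu * F x)) u v) as [c [E Hc]]; [lra| |].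
  - intros c Hc. apply is_derive_Reals. apply D2. apply Jx; lra.
  - assert (0 <= be c * (mu * F c)).
    { apply Rmult_le_pos; [apply Rlt_le, be0, Jx; lra|].
      apply Rmult_le_pos; [lra|]. apply Rlt_le, Fpos; lra. }
    nra. }
assert (Phi0 : forall u, 0 < u < t -> 0 <= Phi u).
{ intros u Hu. apply Rnot_lt_le. intros N.
  destruct (V (- Phi u)) as [d' [d'0 Hd']]; [lra|].
  pose (x := Rmin (u / 2) (d' / 2)).
  assert (Hx : 0 < x <= u / 2) by (unfold x, Rmin; destruct (Rle_dec (u/2) (d'/2)); lra).
  assert (Hxd : x < d') by (unfold x, Rmin; destruct (Rle_dec (u/2) (d'/2)); lra).
  assert (Hjx : J x) by (apply Jx; lra).
  specialize (Hd' x Hjx Hxd).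
  assert (Phi x <= Phi u) by (apply mono; lra).
  rewrite Rabs_left in Hd' by lra. lra. }
destruct (MVT_cor2 y (fun x => al x * Phi x) a t) as [c [E Hc]]; [lra| |].
- intros c Hc. apply is_derive_Reals. apply D1. apply Jx; lra.
- assert (0 <= al c * Phi c).
  { apply Rmult_le_pos; [apply Rlt_le, al0, Jx; lra|apply Phi0; lra]. }
  rewrite yt in E. nra.
Qed.

End Intervals.

(** * Killing eigenvalues one by one *)

(** Coefficients of the pair of quadratic polynomials
    [P = p0 + p1 h + p2 h^2], [Q = q0 + q1 h + q2 h^2]. *)
Record vec := Vec { p0 : R; q0 : R; p1 : R; q1 : R; p2 : R; q2 : R }.

Definition vzero : vec := Vec 0 0 0 0 0 0.
Definition vlin (a : R) (v : vec) (b : R) (w : vec) : vec :=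
  Vec (a * p0 v + b * p0 w) (a * q0 v + b * q0 w) (a * p1 v + b * p1 w)
      (a * q1 v + b * q1 w) (a * p2 v + b * p2 w) (a * q2 v + b * q2 w).

Definition form (U V : R -> R) (v : vec) (h : R) : R :=
  (p0 v + p1 v * h + p2 v * h ^ 2) * U h + (q0 v + q1 v * h + q2 v * h ^ 2) * V h.

Lemma form_vlin U V a v b w h :
  form U V (vlin a v b w) h = a * form U V v h + b * form U V w h.
Proof. unfold form, vlin; simpl. ring. Qed.

Lemma vec_eq_dec (v w : vec) : v = w \/ v <> w.
Proof. apply classic. Qed.

(** The functions [F v] form a space on which a second order operator acts by the linear
    map [L] of the labels. [Phi v g] is a Wronskian of [F v] and [F g]: it is [(F v / F g)']
    up to a positive factor, and if [F g] is an eigenfunction for [lam] then its own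
    derivative is [F ((L - lam) v)], up to a positive factor once [F g > 0]. *)
Section Chain.
Variable J : R -> Prop.
Hypothesis HJ : open_interval J.
Hypothesis J_pos : forall x, J x -> 0 < x.
Hypothesis J_down : forall x y, J x -> 0 < y <= x -> J y.
Variables (F : vec -> R -> R) (L : vec -> vec) (Phi : vec -> vec -> R -> R) (al be : R -> R).
Definition vshift (lam : R) (v : vec) : vec := vlin 1 (L v) (- lam) v.
Hypothesis F_lin : forall a v b w x, F (vlin a v b w) x = a * F v x + b * F w x.
Hypothesis SF : forall v, smooth J (F v).
Hypothesis SPhi : forall v g, smooth J (Phi v g).
Hypothesis Sal : smooth J al.
Hypothesis Sbe : smooth J be.
Hypothesis al_pos : forall x, J x -> 0 < al x.
Hypothesis be_pos : forall x, J x -> 0 < be x.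
Hypothesis D1 : forall v g x, J x -> F g x <> 0 ->
  is_derive (fun t => F v t * / F g t) x (al x * / F g x ^ 2 * Phi v g x).
Hypothesis D2 : forall v g lam x, J x -> L g = vlin lam g 0 g ->
  is_derive (Phi v g) x (be x * F g x * F (vshift lam v) x).
Hypothesis V : forall v g, vanishes_at0 J (Phi v g).

Lemma smooth_inv_sq g : (forall x, J x -> 0 < F g x) -> smooth J (fun x => / F g x ^ 2).
Proof.
intros Pg. apply smooth_ext with (fun x => / F g x * / F g x); auto.
- intros x Hx. specialize (Pg x Hx). field. lra.
- apply smooth_mult; apply smooth_inv; auto; intros x Hx; specialize (Pg x Hx); lra.
Qed.

Lemma shift_step lam g v B : L g = vlin lam g 0 g -> (forall x, J x -> 0 < F g x) ->
  Zle J (F (vshift lam v)) B -> Zle J (F v) (B + 1).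
Proof.
intros Eg Pg HB.
apply flux_step with (g := F g) (F1 := F (vshift lam v)) (Phi := Phi v g)
  (al := fun x => al x * / F g x ^ 2) (be := fun x => be x * F g x); auto.
- apply smooth_mult; auto using smooth_inv_sq.
- apply smooth_mult; auto.
- intros x Hx. specialize (Pg x Hx). apply Rmult_lt_0_compat; auto.
  apply Rinv_0_lt_compat. nra.
- intros x Hx. apply Rmult_lt_0_compat; auto.
- intros x Hx. apply D1; auto. specialize (Pg x Hx). lra.
Qed.

(** Eigenfunctions for larger eigenvalues grow, relative to a positive one, once they start
    positive. *)
Lemma eigen_positive lam0 g0 lam g :
  L g0 = vlin lam0 g0 0 g0 -> (forall x, J x -> 0 < F g0 x) ->
  L g = vlin lam g 0 g -> lam0 <= lam ->
  (exists d, 0 < d /\ forall x, J x -> x < d -> 0 < F g x) ->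
  forall x, J x -> 0 < F g x.
Proof.
intros E0 P0 Eg Hl Hd.
apply flux_positive with (g := F g0) (Phi := Phi g g0) (mu := lam - lam0)
  (al := fun x => al x * / F g0 x ^ 2) (be := fun x => be x * F g0 x); auto; try lra.
- apply smooth_mult; auto. apply smooth_inv; auto. intros x Hx; specialize (P0 x Hx); lra.
- intros x Hx. specialize (P0 x Hx). apply Rmult_lt_0_compat; auto.
  apply Rinv_0_lt_compat. nra.
- intros x Hx. apply Rmult_lt_0_compat; auto.
- intros x Hx. apply D1; auto. specialize (P0 x Hx). lra.
- intros x Hx. replace ((lam - lam0) * F g x) with (F (vshift lam0 g) x).
  + now apply D2.
  + unfold vshift. rewrite F_lin, Eg, F_lin. ring.
Qed.

Definition simple_positive_eigen (p : R * vec) : Prop :=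
  L (snd p) = vlin (fst p) (snd p) 0 (snd p) /\
  (forall x, J x -> 0 < F (snd p) x) /\
  forall v, vshift (fst p) v = vzero -> exists c, v = vlin c (snd p) 0 (snd p).

(** Killing one eigenvalue costs at most one zero. The last nonzero function obtained is a
    multiple of a positive eigenfunction, which has no zeros. *)
Lemma chain_bound ls : List.Forall simple_positive_eigen ls -> forall v, v <> vzero ->
  fold_left (fun w p => vshift (fst p) w) ls v = vzero ->
  Zle J (F v) (Z.of_nat (length ls) - 1).
Proof.
induction ls as [|[lam g] ls IH]; intros Hls v Hv Ev; [contradiction|].
inversion Hls as [|? ? [Eg [Pg Ug]] Hls']; subst. simpl in Eg, Pg, Ug, Ev.
destruct (vec_eq_dec (vshift lam v) vzero) as [Z|NZ].
- destruct (Ug v Z) as [c ->].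
  assert (c <> 0).
  { intros ->. apply Hv. unfold vlin, vzero. f_equal; ring. }
  apply Zle_weak with 0%Z; [simpl length; lia|]. apply Zle_nozero.
  intros x Hx. rewrite F_lin. specialize (Pg x Hx).
  intros H'. assert (E : c * F g x = 0) by lra. destruct (Rmult_integral _ _ E); lra.
- apply Zle_weak with (Z.of_nat (length ls) - 1 + 1)%Z; [simpl length; lia|].
  apply shift_step with lam g; auto.
Qed.
End Chain.

(** * Chains on the half line *)

Definition half_line (h : R) : Prop := 0 < h.

Lemma half_line_open : open_interval half_line.
Proof.
split.
- intros x Hx. apply (open_gt 0 x Hx).
- unfold half_line. intros; lra.
Qed.

(** The Picard-Fuchs system of the eight loop Hamiltonian. *)
Definition pf_half (U V : R -> R) : Prop := forall h, 0 < h ->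
  is_derive U h (- (4 * h * U h + V h) / (4 * h * (4 * h + 1))) /\
  is_derive V h ((V h - U h) / (4 * h + 1)).

(** [flux U V v = 4 h (4 h + 1) * (form U V v)'] *)
Definition flux (U V : R -> R) (v : vec) (h : R) : R :=
  (4 * h * (4 * h + 1) * (p1 v + 2 * p2 v * h) - 4 * h * (p0 v + p1 v * h + p2 v * h ^ 2)
     - 4 * h * (q0 v + q1 v * h + q2 v * h ^ 2)) * U h +
  (4 * h * (4 * h + 1) * (q1 v + 2 * q2 v * h) - (p0 v + p1 v * h + p2 v * h ^ 2)
     + 4 * h * (q0 v + q1 v * h + q2 v * h ^ 2)) * V h.

(** The derivative of [flux], that is the operator [d/dh 4 h (4 h + 1) d/dh], a Legendre
    operator in [1 + 8 h], acts on the coefficients by a triangular matrix with the diagonal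
    entries [4 k (k + 1) - 3]. *)
Definition legendre (v : vec) : vec :=
  Vec (-3 * p0 v - 4 * q0 v + 4 * p1 v) (5 * q0 v - 2 * p1 v + 4 * q1 v)
      (21 * p1 v - 12 * q1 v + 16 * p2 v) (45 * q1 v - 4 * p2 v + 16 * q2 v)
      (77 * p2 v - 20 * q2 v) (117 * q2 v).

Lemma form_derive U V v h : pf_half U V -> 0 < h ->
  is_derive (form U V v) h (flux U V v h / (4 * h * (4 * h + 1))).
Proof.
intros HUV Hh. destruct (HUV h Hh) as [DU DV]. unfold form.
evar_last.
- apply @is_derive_plus; apply @is_derive_mult;
    [|exact DU|intros; apply Rmult_comm| |exact DV|intros; apply Rmult_comm];
    auto_derive; auto.
- unfold flux. unfold plus, mult; simpl. field. lra.
Qed.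

Lemma flux_derive U V v h : pf_half U V -> 0 < h ->
  is_derive (flux U V v) h (form U V (legendre v) h).
Proof.
intros HUV Hh. destruct (HUV h Hh) as [DU DV]. unfold flux.
evar_last.
- apply @is_derive_plus; apply @is_derive_mult;
    [|exact DU|intros; apply Rmult_comm| |exact DV|intros; apply Rmult_comm];
    auto_derive; auto.
- unfold form, legendre. unfold plus, mult; simpl. field. lra.
Qed.

Lemma pf_smooth U V : pf_half U V -> smooth half_line U /\ smooth half_line V.
Proof.
intros H. pose (B := fun f => f = U \/ f = V).
assert (A : forall f, B f -> smooth half_line f).
{ intros f Hf. apply algebra_smooth with (B := B); [|now apply alg_base]. clear f Hf.
  assert (AU : algebra half_line B U) by (apply alg_base; left; auto).
  assert (AV : algebra half_line B V) by (apply alg_base; right; auto).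
  intros f [->| ->].
  - exists (fun h => ((-1) * ((4 * h) * U h + V h)) * / ((4 * h) * (4 * h + 1))). split.
    + alg_tac. unfold half_line. intros x Hx. apply Rmult_integral_contrapositive; lra.
    + intros x Hx. destruct (H x Hx) as [D _]. evar_last; [exact D|].
      unfold half_line in Hx. field. lra.
  - exists (fun h => (V h + (-1) * U h) * / (4 * h + 1)). split.
    + alg_tac. unfold half_line. intros x Hx. lra.
    + intros x Hx. destruct (H x Hx) as [_ D]. evar_last; [exact D|].
      unfold half_line in Hx. field. lra. }
split; apply A; [left|right]; auto.
Qed.

Lemma smooth_poly2 J (a b c : R) : open_interval J -> smooth J (fun h => a + b * h + c * h ^ 2).
Proof. intros HJ. smooth_tac. Qed.

Lemma form_smooth J U V v : open_interval J -> smooth J U -> smooth J V ->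
  smooth J (form U V v).
Proof.
intros HJ SU SV. unfold form. apply smooth_plus; auto; apply smooth_mult; auto;
  now apply smooth_poly2.
Qed.

(** [4 h (4 h + 1)] times a Wronskian. The two forms may use different solutions of the
    system: near a saddle loop [form U V v] is singular and is compared with eigenfunctions
    [form X Y g] that are regular at [0]. *)
Definition flux_wronskian (U V X Y : R -> R) (v g : vec) (h : R) : R :=
  flux U V v h * form X Y g h - form U V v h * flux X Y g h.

Lemma flux_smooth U V v : pf_half U V -> smooth half_line (flux U V v).
Proof.
intros H. destruct (pf_smooth U V H) as [SU SV]. assert (HJ := half_line_open).
unfold flux. smooth_tac.
Qed.

Lemma flux_wronskian_smooth U V X Y v g : pf_half U V -> pf_half X Y ->
  smooth half_line (flux_wronskian U V X Y v g).
Proof.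
intros H1 H2. assert (HJ := half_line_open).
apply smooth_ext with
  (fun h => flux U V v h * form X Y g h + (-1) * (form U V v h * flux X Y g h)); auto.
{ intros; unfold flux_wronskian; ring. }
destruct (pf_smooth U V H1). destruct (pf_smooth X Y H2).
apply smooth_plus; auto; [|apply smooth_mult; auto using smooth_const];
apply smooth_mult; auto; try apply form_smooth; try apply flux_smooth; auto.
Qed.

Lemma ratio_derive U V X Y v g h : pf_half U V -> pf_half X Y -> 0 < h ->
  form X Y g h <> 0 ->
  is_derive (fun t => form U V v t * / form X Y g t) h
    (/ (4 * h * (4 * h + 1)) * / form X Y g h ^ 2 * flux_wronskian U V X Y v g h).
Proof.
intros H1 H2 Hh Hg.
evar_last.
- apply @is_derive_mult; [now apply form_derive| |intros; apply Rmult_comm].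
  apply is_derive_inv; [now apply form_derive|exact Hg].
- unfold flux_wronskian. unfold plus, mult; simpl. field. repeat split; auto; lra.
Qed.

Lemma flux_wronskian_derive U V X Y v g lam h : pf_half U V -> pf_half X Y -> 0 < h ->
  legendre g = vlin lam g 0 g ->
  is_derive (flux_wronskian U V X Y v g) h
    (1 * form X Y g h * form U V (vshift legendre lam v) h).
Proof.
intros H1 H2 Hh Eg.
evar_last.
- unfold flux_wronskian.
  apply @is_derive_minus; apply @is_derive_mult;
    [now apply flux_derive|now apply form_derive|intros; apply Rmult_comm
    |now apply form_derive|now apply flux_derive|intros; apply Rmult_comm].
- rewrite Eg. unfold vshift. rewrite !form_vlin. unfold plus, mult, minus, opp; simpl.
  unfold plus; simpl. field. lra.
Qed.

(** Eigenvectors of [legendre], with their eigenvalues, normalised so that the form is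
    positive at [0]; their leading coefficients alternate in sign. *)
Definition eig (k : nat) : R * vec :=
  match k with
  | 0%nat => (-3, Vec 1 0 0 0 0 0)
  | 1%nat => (5, Vec (1/2) (-1) 0 0 0 0)
  | 2%nat => (21, Vec (3/16) (-1/8) 1 0 0 0)
  | 3%nat => (45, Vec (5/96) (-1/8) (1/2) (-1) 0 0)
  | 4%nat => (77, Vec (21/1280) (-1/64) (5/16) (-1/8) 1 0)
  | _ => (117, Vec (15/3584) (-59/5376) (11/96) (-1/4) (1/2) (-1))
  end.

Lemma eig_spec k : legendre (snd (eig k)) = vlin (fst (eig k)) (snd (eig k)) 0 (snd (eig k)).
Proof.
destruct k as [|[|[|[|[|k]]]]]; unfold legendre, vlin; simpl; f_equal; field.
Qed.

Lemma eig_unique k v : vshift legendre (fst (eig k)) v = vzero ->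
  exists c, v = vlin c (snd (eig k)) 0 (snd (eig k)).
Proof.
destruct v as [a0 b0 a1 b1 a2 b2].
destruct k as [|[|[|[|[|k]]]]]; unfold vshift, legendre, vlin, vzero; simpl;
  intros E; injection E; intros.
- exists a0. f_equal; lra.
- exists (- b0). f_equal; lra.
- exists a1. f_equal; lra.
- exists (- b1). f_equal; lra.
- exists a2. f_equal; lra.
- exists (- b2). f_equal; lra.
Qed.

Lemma legendre_product v :
  fold_left (fun w p => vshift legendre (fst p) w)
    (map eig (5 :: 4 :: 3 :: 2 :: 1 :: 0 :: nil)%nat) v = vzero.
Proof.
assert (E : forall lam a b c d e f, vshift legendre lam (Vec a b c d e f) =
  Vec ((-3 - lam) * a - 4 * b + 4 * c) ((5 - lam) * b - 2 * c + 4 * d)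
      ((21 - lam) * c - 12 * d + 16 * e) ((45 - lam) * d - 4 * e + 16 * f)
      ((77 - lam) * e - 20 * f) ((117 - lam) * f)).
{ intros. unfold vshift, legendre, vlin; simpl. f_equal; ring. }
destruct v as [a b c d e f]. simpl fold_left. rewrite E.
replace ((117 - 117) * f) with 0 by ring.
generalize ((-3 - 117) * a - 4 * b + 4 * c) as a1, ((5 - 117) * b - 2 * c + 4 * d) as b1,
  ((21 - 117) * c - 12 * d + 16 * e) as c1, ((45 - 117) * d - 4 * e + 16 * f) as d1,
  ((77 - 117) * e - 20 * f) as e1. intros. rewrite E.
replace ((77 - 77) * e1 - 20 * 0) with 0 by ring.
replace ((117 - 77) * 0) with 0 by ring.
generalize ((-3 - 77) * a1 - 4 * b1 + 4 * c1) as a2, ((5 - 77) * b1 - 2 * c1 + 4 * d1) as b2,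
  ((21 - 77) * c1 - 12 * d1 + 16 * e1) as c2, ((45 - 77) * d1 - 4 * e1 + 16 * 0) as d2.
intros. rewrite E.
replace ((45 - 45) * d2 - 4 * 0 + 16 * 0) with 0 by ring.
replace ((77 - 45) * 0 - 20 * 0) with 0 by ring.
replace ((117 - 45) * 0) with 0 by ring.
generalize ((-3 - 45) * a2 - 4 * b2 + 4 * c2) as a3, ((5 - 45) * b2 - 2 * c2 + 4 * d2) as b3,
  ((21 - 45) * c2 - 12 * d2 + 16 * 0) as c3. intros. rewrite !E.
unfold vzero. f_equal; ring.
Qed.

Section RegularHalfLine.
Variables U V : R -> R.
Hypothesis PF : pf_half U V.
Hypothesis U_pos : forall h, 0 < h -> 0 < U h.
Hypothesis U_low : exists c d, 0 < c /\ 0 < d /\ forall h, 0 < h < d -> c <= U h.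
Hypothesis U_bd : bounded_at0 half_line U.
Hypothesis V_0 : vanishes_at0 half_line V.

Lemma bounded_poly2 (a b c : R) : bounded_at0 half_line (fun h => a + b * h + c * h ^ 2).
Proof.
assert (I : bounded_at0 half_line (fun h => h)).
{ apply vanishes_bounded, vanishes_id. intros x Hx; exact Hx. }
apply bounded_plus; [apply bounded_plus|].
- apply bounded_const.
- apply bounded_mult; [apply bounded_const|exact I].
- apply bounded_mult; [apply bounded_const|]. simpl.
  apply bounded_mult; [exact I|]. apply bounded_mult; [exact I|apply bounded_const].
Qed.

(** The factor [h] of [4 h (4 h + 1)] and the vanishing of [V] make the flux of a regular
    solution vanish at [0]. *)
Lemma flux_vanishes v : vanishes_at0 half_line (flux U V v).
Proof.
assert (I : vanishes_at0 half_line (fun h => h)).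
{ apply vanishes_id. intros x Hx; exact Hx. }
assert (BP := bounded_poly2).
apply vanishes_ext with (fun h => h * ((4 * ((4 * h + 1) * (p1 v + 2 * p2 v * h)
  - (p0 v + p1 v * h + p2 v * h ^ 2) - (q0 v + q1 v * h + q2 v * h ^ 2))) * U h) +
  V h * (4 * h * (4 * h + 1) * (q1 v + 2 * q2 v * h) - (p0 v + p1 v * h + p2 v * h ^ 2)
     + 4 * h * (q0 v + q1 v * h + q2 v * h ^ 2))).
{ intros h _. unfold flux. ring. }
apply vanishes_plus; apply vanishes_mult; auto.
- apply bounded_mult; auto.
  assert (E : forall h, 4 * (p1 v - p0 v - q0 v) + 4 * (4 * p1 v + 2 * p2 v - p1 v - q1 v) * h
      + 4 * (8 * p2 v - p2 v - q2 v) * h ^ 2 =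
     4 * ((4 * h + 1) * (p1 v + 2 * p2 v * h)
  - (p0 v + p1 v * h + p2 v * h ^ 2) - (q0 v + q1 v * h + q2 v * h ^ 2))).
  { intros h. ring. }
  destruct (BP (4 * (p1 v - p0 v - q0 v)) (4 * (4 * p1 v + 2 * p2 v - p1 v - q1 v))
     (4 * (8 * p2 v - p2 v - q2 v))) as [C [d [d0 [C0 Hd]]]].
  exists C, d. repeat split; auto. intros x Hx Lx. rewrite <- E. now apply Hd.
- destruct (bounded_plus _ _ _ (bounded_mult _ _ _ (BP 0 4 16) (BP (q1 v) (2 * q2 v) 0))
    (bounded_plus _ _ _ (BP (- p0 v) (- p1 v) (- p2 v))
      (bounded_mult _ _ _ (BP 0 4 0) (BP (q0 v) (q1 v) (q2 v)))))
    as [C [d [d0 [C0 Hd]]]].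
  exists C, d. repeat split; auto. intros x Hx Lx.
  eapply Rle_trans; [|apply (Hd x Hx Lx)]. right. f_equal. ring.
Qed.

Lemma form_bounded v : bounded_at0 half_line (form U V v).
Proof.
assert (BP := bounded_poly2). unfold form.
apply bounded_plus; apply bounded_mult; auto. now apply vanishes_bounded.
Qed.

Lemma flux_wronskian_vanishes v g : vanishes_at0 half_line (flux_wronskian U V U V v g).
Proof.
apply vanishes_ext with
  (fun h => flux U V v h * form U V g h + flux U V g h * ((-1) * form U V v h)).
{ intros h _. unfold flux_wronskian. ring. }
apply vanishes_plus; apply vanishes_mult; auto using flux_vanishes, form_bounded.
apply bounded_mult; auto using bounded_const, form_bounded.
Qed.

Lemma form_low_near0 v : 0 < p0 v ->
  exists c d, 0 < c /\ 0 < d /\ forall h, half_line h -> h < d -> c <= form U V v h.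
Proof.
intros Hp. destruct U_low as [c [d [c0 [d0 Hd]]]].
assert (W : vanishes_at0 half_line (fun h => h * ((p1 v + p2 v * h + 0 * h ^ 2) * U h)
   + V h * (q0 v + q1 v * h + q2 v * h ^ 2))).
{ apply vanishes_plus; apply vanishes_mult; auto using bounded_poly2.
  - apply vanishes_id. intros x Hx; exact Hx.
  - apply bounded_mult; auto using bounded_poly2. }
assert (pc : 0 < p0 v * c) by now apply Rmult_lt_0_compat.
destruct (W (p0 v * c / 2)) as [d' [d'0 Hd']]; [lra|].
exists (p0 v * c / 2), (Rmin d d'). split; [lra|]. split; [now apply Rmin_pos|]. intros h Hh Lh.
assert (h < d) by (apply Rlt_le_trans with (1 := Lh); apply Rmin_l).
assert (h < d') by (apply Rlt_le_trans with (1 := Lh); apply Rmin_r).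
specialize (Hd' h Hh H0). apply Rabs_def2 in Hd'.
assert (c <= U h) by (apply Hd; unfold half_line in Hh; lra).
assert (p0 v * c <= p0 v * U h) by (apply Rmult_le_compat_l; lra).
unfold form. lra.
Qed.

Lemma half_weight_smooth : smooth half_line (fun h => / (4 * h * (4 * h + 1))).
Proof.
apply smooth_inv.
- apply smooth_ext with (fun h => 0 + 4 * h + 16 * h ^ 2); [exact half_line_open| |].
  + intros; ring.
  + apply smooth_poly2, half_line_open.
- intros x Hx. unfold half_line in Hx. apply Rmult_integral_contrapositive; lra.
Qed.

Lemma half_weight_pos h : half_line h -> 0 < / (4 * h * (4 * h + 1)).
Proof.
intros Hh. unfold half_line in Hh. apply Rinv_0_lt_compat. nra.
Qed.

Lemma eig_positive k h : 0 < h -> 0 < form U V (snd (eig k)) h.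
Proof.
destruct (pf_smooth U V PF) as [SU SV].
assert (P0 : forall x, half_line x -> 0 < form U V (snd (eig 0)) x).
{ intros x Hx. unfold form; simpl. specialize (U_pos x Hx). lra. }
apply (eigen_positive half_line half_line_open) with (L := legendre) (lam0 := -3)
  (g0 := snd (eig 0)) (lam := fst (eig k)) (Phi := flux_wronskian U V U V)
  (al := fun h => / (4 * h * (4 * h + 1))) (be := fun _ => 1).
- intros x Hx; exact Hx.
- unfold half_line; intros; lra.
- intros; apply form_vlin.
- intros; apply form_smooth; auto using half_line_open.
- exact half_weight_pos.
- intros; lra.
- intros; now apply ratio_derive.
- intros; now apply flux_wronskian_derive.
- apply flux_wronskian_vanishes.
- apply (eig_spec 0).
- exact P0.
- apply eig_spec.
- destruct k as [|[|[|[|[|k]]]]]; simpl; lra.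
- destruct (form_low_near0 (snd (eig k))) as [c [d [c0 [d0 Hd]]]].
  + destruct k as [|[|[|[|[|k]]]]]; simpl; lra.
  + exists d. split; auto. intros x Hx Lx. specialize (Hd x Hx Lx). lra.
Qed.

(** The eigenvalues are killed from the largest to the smallest; any order would do, since
    all the eigenfunctions are positive. *)
Theorem regular_half_line_bound v : v <> vzero -> Zle half_line (form U V v) 5.
Proof.
intros Hv. destruct (pf_smooth U V PF) as [SU SV].
apply (chain_bound half_line half_line_open) with (L := legendre)
  (Phi := flux_wronskian U V U V) (al := fun h => / (4 * h * (4 * h + 1))) (be := fun _ => 1)
  (ls := map eig (5 :: 4 :: 3 :: 2 :: 1 :: 0 :: nil)%nat).
- intros x Hx; exact Hx.
- unfold half_line; intros; lra.
- intros; apply form_vlin.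
- intros; apply form_smooth; auto using half_line_open.
- intros; now apply flux_wronskian_smooth.
- exact half_weight_smooth.
- apply smooth_const.
- exact half_weight_pos.
- intros; lra.
- intros; now apply ratio_derive.
- intros; now apply flux_wronskian_derive.
- apply flux_wronskian_vanishes.
- apply Forall_forall. intros p Hp. apply in_map_iff in Hp. destruct Hp as [k [<- _]].
  split; [apply eig_spec|]. split; [intros; now apply eig_positive|apply eig_unique].
- exact Hv.
- apply legendre_product.
Qed.

End RegularHalfLine.

(** * Chains on the quarter interval *)

Definition quarter (t : R) : Prop := 0 < t < 1 / 4.

Lemma quarter_open : open_interval quarter.
Proof.
split.
- intros x [H1 H2]. apply filter_and; [apply (open_gt 0 x H1)|apply (open_lt (1/4) x H2)].
- unfold quarter. intros; lra.
Qed.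

(** The system [pf_half] read at [h = - t]. *)
Definition pf_quarter (U V : R -> R) : Prop := forall t, quarter t ->
  is_derive U t ((4 * t * U t - V t) / (4 * t * (1 - 4 * t))) /\
  is_derive V t ((U t - V t) / (1 - 4 * t)).

(** Powers of [1 - 4 t] instead of [t] make the operator below block triangular. *)
Definition sform (U V : R -> R) (v : vec) (t : R) : R :=
  (p0 v + p1 v * (1 - 4 * t) + p2 v * (1 - 4 * t) ^ 2) * U t +
  (q0 v + q1 v * (1 - 4 * t) + q2 v * (1 - 4 * t) ^ 2) * V t.

(** [sflux U V v = t ((1 - 4 t) F' + 9 F)] with [F = sform U V v] *)
Definition sflux (U V : R -> R) (v : vec) (t : R) : R :=
  (t * (1 - 4 * t) * (- 4 * (p1 v + 2 * p2 v * (1 - 4 * t)))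
     + 10 * t * (p0 v + p1 v * (1 - 4 * t) + p2 v * (1 - 4 * t) ^ 2)
     + t * (q0 v + q1 v * (1 - 4 * t) + q2 v * (1 - 4 * t) ^ 2)) * U t +
  (t * (1 - 4 * t) * (- 4 * (q1 v + 2 * q2 v * (1 - 4 * t)))
     - (p0 v + p1 v * (1 - 4 * t) + p2 v * (1 - 4 * t) ^ 2) / 4
     + 8 * t * (q0 v + q1 v * (1 - 4 * t) + q2 v * (1 - 4 * t) ^ 2)) * V t.

(** With [s = 1 - 4 t], the operator is [s^(15/4) d/dt (t s^(1/2) d/dt s^(-9/4))]. The
    twist by the power [9/4] puts the explicit positive function [s^2 (U - V)] at the bottom
    of the spectrum, which is [3/4], [35/4], [99/4], each twice. *)
Definition legendre2 (v : vec) : vec :=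
  Vec (119/4 * p0 v + 5 * q0 v) (-5 * p0 v + 79/4 * q0 v)
      (-20 * p0 v - 4 * q0 v + 47/4 * p1 v + 3 * q1 v)
      (-12 * q0 v - 3 * p1 v + 23/4 * q1 v)
      (-6 * p1 v - 2 * q1 v + 7/4 * p2 v + q2 v)
      (-2 * q1 v - p2 v - 1/4 * q2 v).

Lemma sform_vlin U V a v b w h :
  sform U V (vlin a v b w) h = a * sform U V v h + b * sform U V w h.
Proof. unfold sform, vlin; simpl. ring. Qed.

Lemma sform_derive U V v t : pf_quarter U V -> quarter t ->
  is_derive (sform U V v) t ((sflux U V v t / t - 9 * sform U V v t) / (1 - 4 * t)).
Proof.
intros HUV Hh. destruct (HUV t Hh) as [DU DV]. unfold sform. destruct Hh.
evar_last.
- apply @is_derive_plus; apply @is_derive_mult;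
    [|exact DU|intros; apply Rmult_comm| |exact DV|intros; apply Rmult_comm];
    auto_derive; auto.
- unfold sflux. unfold plus, mult; simpl. field. lra.
Qed.

Lemma sflux_derive U V v t : pf_quarter U V -> quarter t ->
  is_derive (sflux U V v) t ((sform U V (legendre2 v) t - 11 * sflux U V v t) / (1 - 4 * t)).
Proof.
intros HUV Hh. destruct (HUV t Hh) as [DU DV]. unfold sflux. destruct Hh.
evar_last.
- apply @is_derive_plus; apply @is_derive_mult;
    [|exact DU|intros; apply Rmult_comm| |exact DV|intros; apply Rmult_comm];
    auto_derive; auto.
- unfold sform, legendre2. unfold plus, mult; simpl. field. lra.
Qed.

Lemma pf_quarter_smooth U V : pf_quarter U V -> smooth quarter U /\ smooth quarter V.
Proof.
intros H. pose (B := fun f => f = U \/ f = V).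
assert (A : forall f, B f -> smooth quarter f).
{ intros f Hf. apply algebra_smooth with (B := B); [|now apply alg_base]. clear f Hf.
  assert (AU : algebra quarter B U) by (apply alg_base; left; auto).
  assert (AV : algebra quarter B V) by (apply alg_base; right; auto).
  intros f [->| ->].
  - exists (fun h => ((4 * h) * U h + (-1) * V h) * / ((4 * h) * (1 + (-1) * (4 * h)))). split.
    + alg_tac. intros x [Hx Hx']. apply Rmult_integral_contrapositive; lra.
    + intros x Hx. destruct (H x Hx) as [D _]. evar_last; [exact D|]. destruct Hx. field. lra.
  - exists (fun h => (U h + (-1) * V h) * / (1 + (-1) * (4 * h))). split.
    + alg_tac. intros x [Hx Hx']. lra.
    + intros x Hx. destruct (H x Hx) as [_ D]. evar_last; [exact D|]. destruct Hx. field. lra. }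
split; apply A; [left|right]; auto.
Qed.

Lemma sform_smooth U V v : pf_quarter U V -> smooth quarter (sform U V v).
Proof.
intros H. destruct (pf_quarter_smooth U V H) as [SU SV]. assert (HJ := quarter_open).
unfold sform. smooth_tac.
Qed.

Lemma sflux_smooth U V v : pf_quarter U V -> smooth quarter (sflux U V v).
Proof.
intros H. destruct (pf_quarter_smooth U V H) as [SU SV]. assert (HJ := quarter_open).
unfold sflux, Rdiv. smooth_tac.
Qed.

(** The power of [1 - 4 t] comes from the Wronskian of the two forms multiplied by
    [(1 - 4 t)^(-9/4)]. *)
Definition swronskian (U V : R -> R) (v g : vec) (t : R) : R :=
  / (1 - 4 * t) ^ 5 * (sflux U V v t * sform U V g t - sform U V v t * sflux U V g t).

Lemma inv_s_smooth n : smooth quarter (fun t => / (1 - 4 * t) ^ n).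
Proof.
assert (HJ := quarter_open). apply smooth_inv.
- smooth_tac.
- intros x [Hx Hx']. apply pow_nonzero. lra.
Qed.

Lemma swronskian_smooth U V v g : pf_quarter U V -> smooth quarter (swronskian U V v g).
Proof.
intros H. assert (HJ := quarter_open).
assert (S1 := fun v => sform_smooth U V v H). assert (S2 := fun v => sflux_smooth U V v H).
unfold swronskian. apply smooth_mult; auto using inv_s_smooth.
apply smooth_minus; auto; apply smooth_mult; auto.
Qed.

Lemma sratio_derive U V v g t : pf_quarter U V -> quarter t -> sform U V g t <> 0 ->
  is_derive (fun x => sform U V v x * / sform U V g x) t
    ((1 - 4 * t) ^ 4 * / t * / sform U V g t ^ 2 * swronskian U V v g t).
Proof.
intros H1 Hh Hg.
evar_last.
- apply @is_derive_mult; [now apply sform_derive| |intros; apply Rmult_comm].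
  apply is_derive_inv; [now apply sform_derive|exact Hg].
- unfold swronskian. destruct Hh. unfold plus, mult; simpl. field. repeat split; auto; lra.
Qed.

Lemma swronskian_derive U V v g lam t : pf_quarter U V -> quarter t ->
  legendre2 g = vlin lam g 0 g ->
  is_derive (swronskian U V v g) t
    (/ (1 - 4 * t) ^ 6 * sform U V g t * sform U V (vshift legendre2 lam v) t).
Proof.
intros H1 Hh Eg.
evar_last.
- unfold swronskian.
  apply @is_derive_mult; [|apply @is_derive_minus; apply @is_derive_mult;
    [now apply sflux_derive|now apply sform_derive|intros; apply Rmult_comm
    |now apply sform_derive|now apply sflux_derive|intros; apply Rmult_comm]
    |intros; apply Rmult_comm].
  apply is_derive_inv with (l := -4 * (5 * (1 - 4 * t) ^ 4)).
  + auto_derive; auto. ring.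
  + destruct Hh. apply pow_nonzero. lra.
- rewrite Eg. unfold vshift. rewrite !sform_vlin. unfold plus, mult, minus, opp; simpl.
  unfold plus; simpl. destruct Hh. field. lra.
Qed.

(** Each eigenvalue has a Jordan block of size two, hence one eigenvector, and has to be
    killed twice. *)
Definition eig2 (k : nat) : R * vec :=
  match k with
  | 0%nat => (3/4, Vec 0 0 0 0 1 (-1))
  | 1%nat => (35/4, Vec 0 0 (32/9) (-32/9) (-17/9) 1)
  | _ => (99/4, Vec (2048/147) (-2048/147) (-2144/147) (544/49) (137/49) (-1))
  end.

Lemma eig2_spec k : legendre2 (snd (eig2 k)) = vlin (fst (eig2 k)) (snd (eig2 k)) 0 (snd (eig2 k)).
Proof. destruct k as [|[|k]]; unfold legendre2, vlin; simpl; f_equal; field. Qed.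

Lemma eig2_unique k v : vshift legendre2 (fst (eig2 k)) v = vzero ->
  exists c, v = vlin c (snd (eig2 k)) 0 (snd (eig2 k)).
Proof.
destruct v as [a0 b0 a1 b1 a2 b2].
destruct k as [|[|k]]; unfold vshift, legendre2, vlin, vzero; simpl;
  intros E; injection E; intros.
- exists a2. f_equal; lra.
- exists b2. f_equal; lra.
- exists (- b2). f_equal; lra.
Qed.

Lemma legendre2_product v :
  fold_left (fun w p => vshift legendre2 (fst p) w)
    (map eig2 (2 :: 2 :: 1 :: 1 :: 0 :: 0 :: nil)%nat) v = vzero.
Proof.
assert (E : forall lam a b c d e f, vshift legendre2 lam (Vec a b c d e f) =
  Vec ((119/4 - lam) * a + 5 * b) (-5 * a + (79/4 - lam) * b)
      (-20 * a - 4 * b + (47/4 - lam) * c + 3 * d)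
      (-12 * b - 3 * c + (23/4 - lam) * d)
      (-6 * c - 2 * d + (7/4 - lam) * e + f)
      (-2 * d - e + (-1/4 - lam) * f)).
{ intros. unfold vshift, legendre2, vlin; simpl. f_equal; field. }
assert (E2 : forall a b c d e f, exists c' d' e' f', vshift legendre2 (99/4)
   (vshift legendre2 (99/4) (Vec a b c d e f)) = Vec 0 0 c' d' e' f').
{ intros. rewrite !E. do 4 eexists. f_equal; field. }
assert (E1 : forall c d e f, exists e' f', vshift legendre2 (35/4)
   (vshift legendre2 (35/4) (Vec 0 0 c d e f)) = Vec 0 0 0 0 e' f').
{ intros. rewrite !E. do 2 eexists. f_equal; field. }
destruct v as [a b c d e f]. simpl fold_left.
destruct (E2 a b c d e f) as [c2 [d2 [e2 [f2 ->]]]].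
destruct (E1 c2 d2 e2 f2) as [e1 [f1 ->]].
rewrite !E. unfold vzero. f_equal; field.
Qed.

Section RegularQuarter.
Variables U V : R -> R.
Hypothesis PF : pf_quarter U V.
Hypothesis V_lt_U : forall t, quarter t -> V t < U t.
Hypothesis U_low : exists c d, 0 < c /\ 0 < d /\ forall t, quarter t -> t < d -> c <= U t.
Hypothesis U_bd : bounded_at0 quarter U.
Hypothesis V_0 : vanishes_at0 quarter V.

Let quarter_id : vanishes_at0 quarter (fun t => t).
Proof. apply vanishes_id. intros x [Hx _]; exact Hx. Qed.

Lemma quarter_bounded_s : bounded_at0 quarter (fun t => 1 - 4 * t).
Proof.
apply bounded_plus; [apply bounded_const|].
destruct (vanishes_bounded _ _ quarter_id) as [C [d [d0 [C0 Hd]]]].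
exists (4 * C), d. repeat split; try lra. intros x Hx Lx. specialize (Hd x Hx Lx).
rewrite Rabs_Ropp, Rabs_mult. rewrite (Rabs_right 4) by lra. lra.
Qed.

Lemma quarter_bounded_poly a b c :
  bounded_at0 quarter (fun t => a + b * (1 - 4 * t) + c * (1 - 4 * t) ^ 2).
Proof.
assert (S := quarter_bounded_s). apply bounded_plus; [apply bounded_plus|].
- apply bounded_const.
- apply bounded_mult; auto using bounded_const.
- apply bounded_mult; auto using bounded_const. simpl.
  apply bounded_mult; auto. apply bounded_mult; auto using bounded_const.
Qed.

Lemma sform_bounded v : bounded_at0 quarter (sform U V v).
Proof.
unfold sform. apply bounded_plus; apply bounded_mult; auto using quarter_bounded_poly.
now apply vanishes_bounded.
Qed.

Lemma sflux_vanishes v : vanishes_at0 quarter (sflux U V v).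
Proof.
assert (BP := quarter_bounded_poly). assert (BS := quarter_bounded_s).
apply vanishes_ext with (fun t => t * ((((1 - 4 * t) * ((- 4 * p1 v) + (- 8 * p2 v) * (1 - 4 * t)
   + 0 * (1 - 4 * t) ^ 2) + 10 * (p0 v + p1 v * (1 - 4 * t) + p2 v * (1 - 4 * t) ^ 2))
     + (q0 v + q1 v * (1 - 4 * t) + q2 v * (1 - 4 * t) ^ 2)) * U t) +
  V t * ((t * (1 - 4 * t) * ((- 4 * q1 v) + (- 8 * q2 v) * (1 - 4 * t) + 0 * (1 - 4 * t) ^ 2)
     + (-1/4) * (p0 v + p1 v * (1 - 4 * t) + p2 v * (1 - 4 * t) ^ 2))
     + 8 * t * (q0 v + q1 v * (1 - 4 * t) + q2 v * (1 - 4 * t) ^ 2))).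
{ intros t _. unfold sflux. field. }
assert (Bt := vanishes_bounded _ _ quarter_id).
apply vanishes_plus; apply vanishes_mult; auto;
repeat first [assumption|apply BP|apply bounded_plus|apply bounded_mult|apply bounded_const].
Qed.

Lemma swronskian_vanishes v g : vanishes_at0 quarter (swronskian U V v g).
Proof.
assert (Bi : bounded_at0 quarter (fun t => / (1 - 4 * t) ^ 5)).
{ exists (/ (1/2) ^ 5), (1/8). repeat split; try lra.
  intros x [Hx _] Lx. rewrite Rabs_right.
  - apply Rinv_le_contravar; [lra|]. apply pow_incr. lra.
  - apply Rle_ge, Rlt_le, Rinv_0_lt_compat, pow_lt. lra. }
apply vanishes_ext with
  (fun h => sflux U V v h * (sform U V g h * / (1 - 4 * h) ^ 5) +
     sflux U V g h * ((-1) * sform U V v h * / (1 - 4 * h) ^ 5)).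
{ intros h [_ Hh]. unfold swronskian. field. lra. }
apply vanishes_plus; apply vanishes_mult; auto using sflux_vanishes;
repeat first [assumption|apply sform_bounded|apply bounded_mult|apply bounded_const].
Qed.

Lemma sform_positive_near0 v : 0 < p0 v + p1 v + p2 v ->
  exists d, 0 < d /\ forall t, quarter t -> t < d -> 0 < sform U V v t.
Proof.
intros Hp. destruct U_low as [c [d [c0 [d0 Hd]]]].
assert (W : vanishes_at0 quarter (fun t => t * (((-4 * p1 v - 4 * p2 v) + (- 4 * p2 v) * (1 - 4 * t)
     + 0 * (1 - 4 * t) ^ 2) * U t)
   + V t * (q0 v + q1 v * (1 - 4 * t) + q2 v * (1 - 4 * t) ^ 2))).
{ apply vanishes_plus; apply vanishes_mult; auto using quarter_bounded_poly.
  apply bounded_mult; auto using quarter_bounded_poly. }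
destruct (W ((p0 v + p1 v + p2 v) * c)) as [d' [d'0 Hd']]; [now apply Rmult_lt_0_compat|].
exists (Rmin d d'). split; [now apply Rmin_pos|]. intros h Hh Lh.
assert (h < d) by (apply Rlt_le_trans with (1 := Lh); apply Rmin_l).
assert (h < d') by (apply Rlt_le_trans with (1 := Lh); apply Rmin_r).
specialize (Hd' h Hh H0). apply Rabs_def2 in Hd'.
assert (c <= U h) by (apply Hd; auto).
assert ((p0 v + p1 v + p2 v) * c <= (p0 v + p1 v + p2 v) * U h)
  by (apply Rmult_le_compat_l; lra).
unfold sform. lra.
Qed.

Lemma quarter_weight_smooth : smooth quarter (fun t => (1 - 4 * t) ^ 4 * / t).
Proof.
assert (HJ := quarter_open). apply smooth_mult; auto; [smooth_tac|].
apply smooth_inv; [apply smooth_id|]. intros x [Hx _]. lra.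
Qed.

Lemma quarter_weight_pos t : quarter t -> 0 < (1 - 4 * t) ^ 4 * / t.
Proof.
intros [H1 H2]. apply Rmult_lt_0_compat; [apply pow_lt; lra|now apply Rinv_0_lt_compat].
Qed.

Lemma quarter_weight6_pos t : quarter t -> 0 < / (1 - 4 * t) ^ 6.
Proof. intros [H1 H2]. apply Rinv_0_lt_compat, pow_lt. lra. Qed.

Lemma eig2_positive k t : quarter t -> 0 < sform U V (snd (eig2 k)) t.
Proof.
assert (P0 : forall x, quarter x -> 0 < sform U V (snd (eig2 0)) x).
{ intros x Hx. specialize (V_lt_U x Hx). destruct Hx.
  replace (sform U V (snd (eig2 0)) x) with ((1 - 4 * x) ^ 2 * (U x - V x))
    by (unfold sform; simpl; ring).
  apply Rmult_lt_0_compat; [apply pow_lt|]; lra. }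
apply (eigen_positive quarter quarter_open) with (L := legendre2) (lam0 := 3/4)
  (g0 := snd (eig2 0)) (lam := fst (eig2 k)) (Phi := swronskian U V)
  (al := fun t => (1 - 4 * t) ^ 4 * / t) (be := fun t => / (1 - 4 * t) ^ 6).
- intros x [Hx _]; exact Hx.
- unfold quarter; intros; lra.
- intros; apply sform_vlin.
- intros; now apply sform_smooth.
- exact quarter_weight_pos.
- exact quarter_weight6_pos.
- intros; now apply sratio_derive.
- intros; now apply swronskian_derive.
- apply swronskian_vanishes.
- apply (eig2_spec 0).
- exact P0.
- apply eig2_spec.
- destruct k as [|[|k]]; simpl; lra.
- apply sform_positive_near0. destruct k as [|[|k]]; simpl; lra.
Qed.

Theorem regular_quarter_bound v : v <> vzero -> Zle quarter (sform U V v) 5.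
Proof.
intros Hv.
apply (chain_bound quarter quarter_open) with (L := legendre2)
  (Phi := swronskian U V) (al := fun t => (1 - 4 * t) ^ 4 * / t)
  (be := fun t => / (1 - 4 * t) ^ 6) (ls := map eig2 (2 :: 2 :: 1 :: 1 :: 0 :: 0 :: nil)%nat).
- intros x [Hx _]; exact Hx.
- unfold quarter; intros; lra.
- intros; apply sform_vlin.
- intros; now apply sform_smooth.
- intros; now apply swronskian_smooth.
- exact quarter_weight_smooth.
- exact (inv_s_smooth 6).
- exact quarter_weight_pos.
- exact quarter_weight6_pos.
- intros; now apply sratio_derive.
- intros; now apply swronskian_derive.
- apply swronskian_vanishes.
- apply Forall_forall. intros p Hp. apply in_map_iff in Hp. destruct Hp as [k [<- _]].
  split; [apply eig2_spec|]. split; [intros; now apply eig2_positive|apply eig2_unique].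
- exact Hv.
- apply legendre2_product.
Qed.

End RegularQuarter.

Import ListNotations.

(** * Sign changes and Newton sums *)

Definition change (x y : R) : Z := if Rlt_dec (x * y) 0 then 1%Z else 0%Z.

Fixpoint changes (t : R) (l : list R) : Z :=
  match l with
  | [] => 0
  | x :: l' => if Req_dec_T x 0 then changes t l' else (change t x + changes x l')%Z
  end.

Lemma change_bounds x y : (0 <= change x y <= 1)%Z.
Proof. unfold change. destruct (Rlt_dec (x * y) 0); lia. Qed.

Lemma change_sym x y : change x y = change y x.
Proof. unfold change. now rewrite Rmult_comm. Qed.

Lemma change_same x y z : 0 < x * y -> change x z = change y z.
Proof.
intros H. unfold change.
destruct (Rlt_dec (x * z) 0) as [A|A], (Rlt_dec (y * z) 0) as [B|B]; auto; exfalso.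
- assert ((x * z) * (y * z) <= 0) by (apply Rmult_le_0_r; lra).
  assert (0 <= (x * y) * (z * z)) by (apply Rmult_le_pos; [lra|apply Rle_0_sqr]).
  assert (z * z = 0) by nra. nra.
- assert (0 <= (x * y) * (z * z)) by (apply Rmult_le_pos; [lra|apply Rle_0_sqr]).
  assert ((x * z) * (y * z) <= 0) by nra.
  assert (z * z = 0) by nra. nra.
Qed.

Lemma change_triangle x y z : y <> 0 -> (change x z <= change x y + change y z)%Z.
Proof.
intros Hy. unfold change.
destruct (Rlt_dec (x * z) 0), (Rlt_dec (x * y) 0), (Rlt_dec (y * z) 0); try lia; exfalso.
assert (0 <= (x * y) * (y * z)) by (apply Rmult_le_pos; lra).
assert (0 < y * y) by nra. nra.
Qed.

Lemma changes_same l : forall x y, 0 < x * y -> changes x l = changes y l.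
Proof.
induction l as [|z l IH]; intros x y H; simpl; auto.
destruct (Req_dec_T z 0); [now apply IH|]. now rewrite (change_same x y z H).
Qed.

Lemma changes_insert l : forall t y, y <> 0 -> (changes t l <= change t y + changes y l)%Z.
Proof.
induction l as [|x l IH]; intros t y Hy; simpl.
- assert (H := change_bounds t y). lia.
- destruct (Req_dec_T x 0); [now apply IH|].
  assert (H := change_triangle t y x Hy). lia.
Qed.

Definition same_sign (x y : R) : Prop := exists w, 0 < w /\ y = w * x.

Lemma changes_scale l l' : List.Forall2 same_sign l l' -> forall t, changes t l = changes t l'.
Proof.
induction 1 as [|x y l l' [w [w0 ->]] _ IH]; intros t; simpl; auto.
destruct (Req_dec_T x 0) as [->|Hx]; destruct (Req_dec_T (w * _) 0) as [E|E].
- apply IH.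
- exfalso. apply E. ring.
- exfalso. destruct (Rmult_integral _ _ E); lra.
- assert (Sx : 0 < x * (w * x)) by (assert (0 < x * x) by nra; nra).
  rewrite IH, (changes_same _ _ _ Sx). f_equal.
  rewrite !(change_sym t). apply change_same. exact Sx.
Qed.

Definition lsum (l : list R) : R := fold_right Rplus 0 l.

Fixpoint partial_sums (l : list R) : list R :=
  match l with [] => [] | x :: l' => lsum (x :: l') :: partial_sums l' end.

(** Partial summation does not create sign changes: when two consecutive sums have opposite
    signs, the entry by which they differ has the sign of the longer sum. *)
Lemma changes_partial_sums l : forall t, t <> 0 -> (changes t (partial_sums l) <= changes t l)%Z.
Proof.
induction l as [|y l IH]; intros t Ht; [simpl; lia|].
cbn [partial_sums changes]. change (lsum (y :: l)) with (y + lsum l).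
destruct (Req_dec_T (y + lsum l) 0) as [Z|NZ].
- apply Z.le_trans with (changes t l); [now apply IH|].
  destruct (Req_dec_T y 0); [lia|]. now apply changes_insert.
- assert (Head : forall s, s <> 0 -> 0 < s * lsum l ->
     (change t s + changes s (partial_sums l))%Z = changes t (partial_sums l)).
  { intros s Hs Hp. destruct l as [|z l]; [simpl in Hp; lra|].
    cbn [partial_sums changes].
    destruct (Req_dec_T (lsum (z :: l)) 0) as [E|E]; [rewrite E in Hp; lra|].
    assert (0 < s * lsum (z :: l)) by exact Hp.
    rewrite (change_sym t s), (change_same s (lsum (z :: l)) t) by auto.
    rewrite (change_same s (lsum (z :: l)) (lsum (z :: l))) by auto.
    rewrite (change_sym _ t). assert (change (lsum (z :: l)) (lsum (z :: l)) = 0%Z); [|lia].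
    unfold change. destruct (Rlt_dec _ _); auto. nra. }
  destruct (Req_dec_T y 0) as [->|Hy].
  + rewrite Head; auto. nra.
  + destruct (Rlt_le_dec 0 ((y + lsum l) * y)) as [P|N].
    * rewrite (changes_same _ (y + lsum l) y) by auto.
      rewrite (change_sym t (y + lsum l)), (change_same _ y t) by auto. rewrite change_sym.
      specialize (IH y Hy). lia.
    * rewrite Head; auto.
      -- apply Z.le_trans with (changes t l); [now apply IH|]. now apply changes_insert.
      -- assert (0 < y * y) by nra. assert (0 < (y + lsum l) * (y + lsum l)) by nra. nra.
Qed.

(** A list of pairs [(lam, c)] stands for a function with the eigenvalues [lam], each
    contributing [c] to its value at the origin; [newton nu l] is the value at the origin
    that is left once the eigenvalues of [nu] have been killed. *)
Definition nprod (nu : list R) (lam : R) : R := fold_right (fun mu acc => (mu - lam) * acc) 1 nu.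

Fixpoint newton (nu : list R) (l : list (R * R)) : R :=
  match l with [] => 0 | (lam, c) :: l' => nprod nu lam * c + newton nu l' end.

Lemma nprod_app nu mu lam : nprod (nu ++ [mu]) lam = nprod nu lam * (mu - lam).
Proof.
induction nu as [|x nu IH]; simpl; [ring|]. rewrite IH. ring.
Qed.

Fixpoint newton_list (nu : list R) (l : list (R * R)) : list R :=
  match l with
  | [] => []
  | (lam, c) :: l' => newton nu l :: newton_list (nu ++ [lam]) l'
  end.

(** Here only a bounded number of the latest eigenvalues is kept. Lengthening the window by
    one amounts, up to positive factors, to a partial summation, and this is why killing
    eigenvalues does not create sign changes. *)
Fixpoint window_list (nu : list R) (l : list (R * R)) : list R :=
  match l with
  | [] => []
  | (lam, c) :: l' => newton nu l :: window_list (tl (nu ++ [lam])) l'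
  end.

Fixpoint window_weighted (nu : list R) (l : list (R * R)) : list R :=
  match l with
  | [] => []
  | (lam, c) :: l' =>
      (hd 0 nu - lam) * newton (tl nu) l :: window_weighted (tl (nu ++ [lam])) l'
  end.

Fixpoint below (nu : list R) (l : list (R * R)) : Prop :=
  match l with
  | [] => True
  | (lam, c) :: l' => List.Forall (fun mu => lam < mu) nu /\ below (nu ++ [lam]) l'
  end.

(** Split the factor [o - lam'] of every later entry as [(o - lam) + (lam - lam')]. *)
Lemma newton_step o nu lam c l :
  newton (o :: nu) ((lam, c) :: l) =
  (o - lam) * newton nu ((lam, c) :: l) + newton (nu ++ [lam]) l.
Proof.
simpl. replace (newton (o :: nu) l) with ((o - lam) * newton nu l + newton (nu ++ [lam]) l).
- ring.
- induction l as [|[lam' c'] l IH]; simpl; [ring|]. rewrite nprod_app.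
  simpl in IH. rewrite <- IH. ring.
Qed.

Lemma window_partial_sums l : forall o nu,
  window_list (o :: nu) l = partial_sums (window_weighted (o :: nu) l).
Proof.
assert (H : forall l o nu, lsum (window_weighted (o :: nu) l) = newton (o :: nu) l /\
   window_list (o :: nu) l = partial_sums (window_weighted (o :: nu) l)).
{ intros l0. induction l0 as [|[lam c] l0 IH]; intros o nu; [split; reflexivity|].
  rewrite newton_step.
  assert (E : exists o' nu', nu ++ [lam] = o' :: nu').
  { destruct nu; simpl; eauto. }
  destruct E as [o' [nu' E]].
  cbn [window_list window_weighted partial_sums tl hd app]. rewrite newton_step, E.
  destruct (IH o' nu') as [I1 I2]. cbn [lsum fold_right]. fold (lsum (window_weighted (o' :: nu') l0)).
  rewrite I1, <- I2. split; [ring|]. f_equal. }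
intros. apply H.
Qed.

Lemma below_tl l : forall nu, below nu l -> below (tl nu) l.
Proof.
induction l as [|[lam c] l IH]; intros nu; simpl; auto. intros [H1 H2]. split.
- destruct nu; simpl; auto. now inversion H1.
- destruct nu as [|o nu]; simpl; [exact H2|]. apply (IH _ H2).
Qed.

Lemma window_same_sign l : forall o nu, below (o :: nu) l ->
  List.Forall2 same_sign (window_list nu l) (window_weighted (o :: nu) l).
Proof.
induction l as [|[lam c] l IH]; intros o nu Hb; [constructor|].
assert (E : exists o' nu', nu ++ [lam] = o' :: nu').
{ destruct nu; simpl; eauto. }
destruct E as [o' [nu' E]].
cbn [window_list window_weighted tl hd app]. constructor.
- exists (o - lam). split; [|reflexivity]. destruct Hb as [Hb _]. inversion Hb; lra.
- rewrite E. simpl. apply IH. destruct Hb as [_ Hb]. apply below_tl in Hb.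
  change (tl ((o :: nu) ++ [lam])) with (nu ++ [lam]) in Hb. now rewrite E in Hb.
Qed.

Lemma changes_newton_window l : forall nu, below nu l -> forall t, t <> 0 ->
  (changes t (newton_list nu l) <= changes t (window_list nu l))%Z.
Proof.
induction l as [|[lam c] l IH]; intros nu Hb t Ht; [simpl; lia|].
assert (E : exists o' nu', nu ++ [lam] = o' :: nu').
{ destruct nu; simpl; eauto. }
destruct E as [o' [nu' E]].
assert (K : forall s, s <> 0 -> (changes s (newton_list (nu ++ [lam]) l) <=
    changes s (window_list (tl (nu ++ [lam])) l))%Z).
{ intros s Hs. destruct Hb as [_ Hb].
  apply Z.le_trans with (changes s (window_list (nu ++ [lam]) l)); [now apply IH|].
  rewrite E in *. simpl tl. rewrite window_partial_sums.
  rewrite (changes_scale _ _ (window_same_sign l o' nu' Hb)).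
  now apply changes_partial_sums. }
cbn [newton_list window_list changes].
destruct (Req_dec_T (newton nu ((lam, c) :: l)) 0) as [Z|NZ]; [now apply K|].
specialize (K _ NZ). lia.
Qed.

Lemma window_nil l : window_list [] l = partial_sums (map snd l).
Proof.
assert (H : forall l, newton [] l = lsum (map snd l)).
{ intros l0. induction l0 as [|[lam c] l0 IH]; simpl; auto. rewrite IH.
  unfold lsum. ring. }
induction l as [|[lam c] l IH]; simpl; auto. f_equal; [|exact IH].
rewrite (H l). unfold lsum. ring.
Qed.

(** Start from the empty window, that is from the partial sums of the coefficients, and
    lengthen it step by step. *)
Lemma changes_newton l t : below [] l -> t <> 0 ->
  (changes t (newton_list [] l) <= changes t (map snd l))%Z.
Proof.
intros Hb Ht. apply Z.le_trans with (1 := changes_newton_window l [] Hb t Ht).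
rewrite window_nil. now apply changes_partial_sums.
Qed.

(** * Rolle's theorem with signs at both ends *)

Definition sign_at0 (f : R -> R) (s : R) : Prop :=
  exists d, 0 < d /\ forall h, 0 < h < d -> 0 < s * f h.
Definition sign_at_infty (f : R -> R) (s : R) : Prop :=
  exists H, 0 < H /\ forall h, H < h -> 0 < s * f h.

Lemma sign_at0_mult f g s t : sign_at0 f s -> sign_at0 g t -> 0 < s * t ->
  exists d, 0 < d /\ forall h, 0 < h < d -> 0 < f h * g h.
Proof.
intros [d1 [d10 H1]] [d2 [d20 H2]] St. exists (Rmin d1 d2). split; [now apply Rmin_pos|].
intros h Hh.
assert (h < d1) by (apply Rlt_le_trans with (1 := proj2 Hh); apply Rmin_l).
assert (h < d2) by (apply Rlt_le_trans with (1 := proj2 Hh); apply Rmin_r).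
specialize (H1 h (conj (proj1 Hh) H)). specialize (H2 h (conj (proj1 Hh) H0)).
apply Rnot_le_lt. intros N.
assert (0 < (s * f h) * (t * g h)) by now apply Rmult_lt_0_compat.
replace ((s * f h) * (t * g h)) with ((s * t) * (f h * g h)) in H3 by ring. nra.
Qed.

Lemma sign_at_infty_mult f g s t : sign_at_infty f s -> sign_at_infty g t -> s * t < 0 ->
  exists H, 0 < H /\ forall h, H < h -> f h * g h < 0.
Proof.
intros [d1 [d10 H1]] [d2 [d20 H2]] St. exists (Rmax d1 d2).
split; [apply Rlt_le_trans with d1; [auto|apply Rmax_l]|]. intros h Hh.
assert (d1 < h) by (apply Rle_lt_trans with (2 := Hh); apply Rmax_l).
assert (d2 < h) by (apply Rle_lt_trans with (2 := Hh); apply Rmax_r).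
specialize (H1 h H). specialize (H2 h H0).
apply Rnot_le_lt. intros N.
assert (0 < (s * f h) * (t * g h)) by now apply Rmult_lt_0_compat.
replace ((s * f h) * (t * g h)) with ((s * t) * (f h * g h)) in H3 by ring. nra.
Qed.

(** A function with a bounded number of zeros has none close to [0]. *)
Lemma finite_zeros_sign f B : smooth half_line f -> Zle half_line f B ->
  exists s, s <> 0 /\ sign_at0 f s.
Proof.
intros Sf HB.
assert (N : exists d, 0 < d /\ forall h, 0 < h < d -> f h <> 0).
{ apply NNPP. intros N.
  assert (M : forall d, 0 < d -> exists h, 0 < h < d /\ f h = 0).
  { intros d d0. apply NNPP. intros N'. apply N. exists d. split; auto.
    intros h Hh E. apply N'. now exists h. }
  assert (L : forall n d, 0 < d -> exists l, zeros_of half_line f l /\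
     (forall x, In x (map fst l) -> x < d) /\ list_sum (map snd l) = n).
  { induction n as [|n IH]; intros d d0.
    - exists []. split; [split; [constructor|easy]|]. split; [easy|reflexivity].
    - destruct (M d d0) as [h [[h0 hd] Eh]]. destruct (IH h h0) as [l [[ND Zl] [Hl Sl]]].
      exists ((h, 1%nat) :: l). split; [split|split].
      + simpl. constructor; auto. intros Hin. specialize (Hl _ Hin). lra.
      + intros x m [E|Hin]; [injection E as <- <-|now apply Zl].
        split; [exact h0|]. intros [|j] Hj; [exact Eh|lia].
      + simpl. intros x [<-|Hin]; [exact hd|]. specialize (Hl _ Hin). lra.
      + simpl. now rewrite Sl. }
  destruct (L (S (Z.to_nat B)) 1) as [l [Zl [_ Sl]]]; [lra|].
  specialize (HB l Zl). lia. }
destruct N as [d [d0 Hd]]. exists (f (d / 2)). split; [apply Hd; lra|].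
exists d. split; auto. intros h Hh. apply Rnot_le_lt. intros N.
assert (f (d / 2) <> 0) by (apply Hd; lra). assert (f h <> 0) by (apply Hd; lra).
assert (Neg : f (d / 2) * f h < 0).
{ destruct N as [N|N]; auto. destruct (Rmult_integral _ _ N); contradiction. }
destruct (Rtotal_order (d / 2) h) as [L|[E|L]].
- destruct (IVT_zero half_line half_line_open f (d / 2) h) as [c [Hc [_ Fc]]]; auto;
    unfold half_line; try lra. apply (Hd c); auto; lra.
- subst. nra.
- destruct (IVT_zero half_line half_line_open f h (d / 2)) as [c [Hc [_ Fc]]]; auto;
    unfold half_line; try lra. apply (Hd c); auto; lra.
Qed.

Section SignedRolle.
Variables f f1 w : R -> R.
Hypothesis Sf : smooth half_line f.
Hypothesis Sf1 : smooth half_line f1.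
Hypothesis Sw : smooth half_line w.
Hypothesis w_pos : forall x, half_line x -> 0 < w x.
Hypothesis Df : forall x, half_line x -> is_derive f x (w x * f1 x).

(** If [f] starts by moving away from [0], then it must turn back before its first zero. *)
Lemma sign_left_gain : (exists d, 0 < d /\ forall h, 0 < h < d -> 0 < f h * f1 h) ->
  left_gain half_line f f1.
Proof.
intros [d [d0 Hd]] a Ja Fa. unfold half_line in Ja.
pose (t := Rmin (a / 2) (d / 2)).
assert (Ht : 0 < t <= a / 2) by (unfold t, Rmin; destruct (Rle_dec (a/2) (d/2)); lra).
assert (Htd : t < d) by (unfold t, Rmin; destruct (Rle_dec (a/2) (d/2)); lra).
assert (P : 0 < f t * f1 t) by (apply Hd; lra).
destruct (MVT_weighted half_line half_line_open f f1 w Df t a) as [c [Hc [Jc E]]];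
  unfold half_line; try lra.
assert (W := w_pos c Jc).
destruct (IVT_zero half_line half_line_open f1 t c) as [z [Hz [Jz Fz]]]; auto;
  unfold half_line; try lra.
- rewrite Fa in E. assert (f1 t * (f t + w c * f1 c * (a - t)) = 0) by nra.
  assert (f1 t * f1 c * (w c * (a - t)) < 0) by lra.
  assert (0 < w c * (a - t)) by (apply Rmult_lt_0_compat; lra).
  apply Rnot_le_lt. intros N. assert (0 <= f1 t * f1 c * (w c * (a - t)))
    by (apply Rmult_le_pos; lra). lra.
- exists z. repeat split; auto; lra.
Qed.

Lemma sign_right_gain : (exists H, 0 < H /\ forall h, H < h -> f h * f1 h < 0) ->
  right_gain half_line f f1.
Proof.
intros [d [d0 Hd]] a Ja Fa. unfold half_line in Ja.
pose (t := Rmax a d + 1).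
assert (a < t) by (unfold t; assert (a <= Rmax a d) by apply Rmax_l; lra).
assert (d < t) by (unfold t; assert (d <= Rmax a d) by apply Rmax_r; lra).
assert (P : f t * f1 t < 0) by (apply Hd; lra).
destruct (MVT_weighted half_line half_line_open f f1 w Df a t) as [c [Hc [Jc E]]];
  unfold half_line; try lra.
assert (W := w_pos c Jc).
destruct (IVT_zero half_line half_line_open f1 c t) as [z [Hz [Jz Fz]]]; auto;
  unfold half_line; try lra.
- rewrite Fa in E. assert (f1 t * (f t - w c * f1 c * (t - a)) = 0) by nra.
  assert (f1 c * f1 t * (w c * (t - a)) < 0) by lra.
  assert (0 < w c * (t - a)) by (apply Rmult_lt_0_compat; lra).
  apply Rnot_le_lt. intros N. assert (0 <= f1 c * f1 t * (w c * (t - a)))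
    by (apply Rmult_le_pos; lra). lra.
- exists z. repeat split; auto; lra.
Qed.

(** If both ends give a gain and [f] has no zero, then [f] has opposite monotonicity at the
    two ends, and the derivative vanishes somewhere. *)
Lemma signed_rolle (eL eR : bool) B : Zle half_line f1 B ->
  (eL = true -> exists d, 0 < d /\ forall h, 0 < h < d -> 0 < f h * f1 h) ->
  (eR = true -> exists H, 0 < H /\ forall h, H < h -> f h * f1 h < 0) ->
  Zle half_line f (B + 1 - Z.b2z eL - Z.b2z eR).
Proof.
intros HB HL HR.
apply (rolle_count half_line half_line_open f f1 w); auto.
- intros E. apply sign_left_gain. auto.
- intros E. apply sign_right_gain. auto.
- intros EL ER. assert (GL := sign_left_gain (HL EL)).
  destruct (HL EL) as [d [d0 Hd]]. destruct (HR ER) as [H [H0 HH]].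
  pose (t := Rmin d 1 / 2). pose (t' := Rmax H 1 + 1).
  assert (0 < t < d /\ t < 1).
  { unfold t, Rmin; destruct (Rle_dec d 1); lra. }
  assert (H < t' /\ 1 < t') by (unfold t', Rmax; destruct (Rle_dec H 1); lra).
  assert (P : 0 < f t * f1 t) by (apply Hd; lra).
  assert (Q : f t' * f1 t' < 0) by (apply HH; lra).
  assert (Jt : half_line t) by (unfold half_line; lra).
  assert (Jt' : half_line t') by (unfold half_line; lra).
  destruct (Rlt_le_dec (f t * f t') 0) as [N|N].
  + destruct (IVT_zero half_line half_line_open f t t') as [a [Ha [Ja Fa]]]; auto; [lra|].
    destruct (GL a Ja Fa) as [c [Jc [_ Fc]]]. now exists c.
  + destruct (IVT_zero half_line half_line_open f1 t t') as [a [Ha [Ja Fa]]]; auto; [lra| |].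
    * assert (f t * f1 t * (f t' * f1 t') < 0) by nra.
      replace (f t * f1 t * (f t' * f1 t')) with (f t * f t' * (f1 t * f1 t')) in H3 by ring.
      apply Rnot_le_lt. intros N'. assert (0 <= f t * f t' * (f1 t * f1 t')) by
        (apply Rmult_le_pos; lra). lra.
    * now exists a.
Qed.
End SignedRolle.

(** * Solutions with a logarithmic singularity *)

Definition coord (k : nat) (v : vec) : R :=
  match k with
  | 0%nat => p0 v | 1%nat => q0 v | 2%nat => p1 v
  | 3%nat => q1 v | 4%nat => p2 v | _ => q2 v
  end.
Definition degree_le (k : nat) (v : vec) : Prop :=
  forall i, (k < i <= 5)%nat -> coord i v = 0.

(** The opposite of [vshift legendre]: the factors [fst (eig k) - fst (eig j)] are positive
    when the eigenvalues are killed from the largest one downwards. *)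
Definition kill (k : nat) (v : vec) : vec := vlin (fst (eig k)) v (-1) (legendre v).

Lemma eig_p0 k : 0 < p0 (snd (eig k)).
Proof. destruct k as [|[|[|[|[|k]]]]]; simpl; lra. Qed.

Definition lam (k : nat) : R := fst (eig k).
Definition egv (k : nat) : vec := snd (eig k).
Definition alt (k : nat) : R := (-1) ^ k.

(** Killing an eigenvalue only multiplies the coefficients, so that the combinations of
    eigenvectors met on the way are described by one list of coefficients and the list [nu]
    of the killed eigenvalues. *)
Fixpoint comb (nu : list R) (l : list (nat * R)) : vec :=
  match l with
  | [] => vzero
  | (j, a) :: l' => vlin (nprod nu (lam j) * a) (egv j) 1 (comb nu l')
  end.

Definition nodes (l : list (nat * R)) : list (R * R) :=
  map (fun p => (lam (fst p), snd p * p0 (egv (fst p)))) l.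

Fixpoint descending (k : nat) (l : list (nat * R)) : Prop :=
  match l with
  | [] => True
  | (j, a) :: l' => (j < k)%nat /\ a <> 0 /\ descending j l'
  end.

Lemma lam_increasing j k : (j < k)%nat -> (k <= 5)%nat -> lam j < lam k.
Proof.
intros H1 H2. unfold lam.
destruct k as [|[|[|[|[|[|k]]]]]]; try lia;
destruct j as [|[|[|[|[|j]]]]]; try lia; simpl; lra.
Qed.

Lemma vec_ext v w : (forall i, (i <= 5)%nat -> coord i v = coord i w) -> v = w.
Proof.
intros H. destruct v, w.
assert (H0 := H 0%nat ltac:(lia)). assert (H1 := H 1%nat ltac:(lia)).
assert (H2 := H 2%nat ltac:(lia)). assert (H3 := H 3%nat ltac:(lia)).
assert (H4 := H 4%nat ltac:(lia)). assert (H5 := H 5%nat ltac:(lia)).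
simpl in *. now subst.
Qed.

Lemma coord_vlin i a v b w : coord i (vlin a v b w) = a * coord i v + b * coord i w.
Proof. destruct i as [|[|[|[|[|i]]]]]; reflexivity. Qed.

Lemma legendre_vlin a v b w :
  legendre (vlin a v b w) = vlin a (legendre v) b (legendre w).
Proof. unfold legendre, vlin; simpl. f_equal; ring. Qed.

Lemma kill_comb k nu l : kill k (comb nu l) = comb (nu ++ [lam k]) l.
Proof.
induction l as [|[j a] l IH]; simpl.
- unfold kill, vlin, legendre, vzero; simpl. f_equal; ring.
- rewrite <- IH, nprod_app. unfold kill. rewrite legendre_vlin. unfold egv at 2.
  rewrite eig_spec. fold (egv j). fold (lam j). fold (lam k).
  apply vec_ext. intros i _. rewrite !coord_vlin. ring.
Qed.

Lemma comb_killed nu j a l : In (lam j) nu -> comb nu ((j, a) :: l) = comb nu l.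
Proof.
intros Hin. simpl.
assert (E : nprod nu (lam j) = 0).
{ induction nu as [|x nu IH]; [easy|]. simpl. destruct Hin as [->|Hin]; [ring|].
  rewrite IH by auto. ring. }
rewrite E. apply vec_ext. intros i _. rewrite coord_vlin. ring.
Qed.

Lemma p0_comb nu l : p0 (comb nu l) = newton nu (nodes l).
Proof.
induction l as [|[j a] l IH]; simpl; [reflexivity|]. rewrite IH. ring.
Qed.

Lemma egv_degree j i : (j < i <= 5)%nat -> coord i (egv j) = 0.
Proof.
intros H. unfold egv.
destruct j as [|[|[|[|[|[|j]]]]]]; try lia;
destruct i as [|[|[|[|[|[|i]]]]]]; try lia; reflexivity.
Qed.

Lemma egv_lead j : (j <= 5)%nat -> coord j (egv j) = alt j.
Proof.
intros H. unfold egv, alt. destruct j as [|[|[|[|[|[|j]]]]]]; try lia; simpl; ring.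
Qed.

Lemma comb_degree nu l : forall k, descending (S k) l -> degree_le k (comb nu l).
Proof.
induction l as [|[j a] l IH]; intros k Hd i Hi.
- destruct i as [|[|[|[|[|i]]]]]; reflexivity.
- destruct Hd as [H1 [H2 H3]]. simpl. rewrite coord_vlin.
  rewrite egv_degree by lia. destruct j as [|j].
  + destruct l as [|[j' a'] l]; [|destruct H3; lia].
    simpl. destruct i as [|[|[|[|[|i]]]]]; simpl; ring.
  + rewrite (IH j H3 i) by lia. ring.
Qed.

Lemma comb_lead nu j a l : (j <= 5)%nat -> descending j l ->
  coord j (comb nu ((j, a) :: l)) = nprod nu (lam j) * a * alt j.
Proof.
intros Hj Hd. simpl. rewrite coord_vlin, egv_lead by auto.
destruct j as [|j].
- destruct l as [|[j' a'] l]; [|destruct Hd; lia]. simpl. ring.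
- rewrite (comb_degree nu l j Hd) by lia. ring.
Qed.

Lemma nprod_pos nu x : List.Forall (fun mu => x < mu) nu -> 0 < nprod nu x.
Proof.
induction 1 as [|mu nu H _ IH]; simpl; [lra|]. apply Rmult_lt_0_compat; lra.
Qed.

Lemma alt_neq0 j : alt j <> 0.
Proof. unfold alt. apply pow_nonzero. lra. Qed.

(** The final term stands for the last eigenfunction, which has at most one zero when its
    index is odd and none when it is even. *)
Fixpoint lead_changes (j : nat) (a : R) (l : list (nat * R)) : Z :=
  match l with
  | [] => if Nat.odd j then 1%Z else 0%Z
  | (j', a') :: l' => (change (a * alt j) (a' * alt j') + lead_changes j' a' l')%Z
  end.

Lemma change_scale x y x' y' : 0 < x * x' -> 0 < y * y' -> change x y = change x' y'.
Proof.
intros H1 H2. rewrite (change_same x x' y H1), (change_sym x'), (change_sym x').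
now apply change_same.
Qed.

(** Two eigenfunctions with consecutive indices have leading coefficients of opposite signs
    but the same sign at the origin, so that a sign change is seen at exactly one of the two
    ends; a gap in the indices leaves room for both. *)
Lemma sign_rule l : forall j a, a <> 0 -> descending j l ->
  (lead_changes j a l + changes a (map snd (nodes l)) <= Z.of_nat j)%Z.
Proof.
induction l as [|[j' a'] l IH]; intros j a Ha Hd.
- simpl. destruct j as [|j]; [simpl; lia|]. destruct (Nat.odd (S j)); lia.
- destruct Hd as [Hj [Ha' Hd]]. cbn [lead_changes nodes map changes fst snd].
  assert (Pe : 0 < p0 (egv j')) by apply eig_p0.
  destruct (Req_dec_T (a' * p0 (egv j')) 0) as [E|_].
  { destruct (Rmult_integral _ _ E); [contradiction|lra]. }
  assert (A2 : 0 < a' * a') by nra.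
  rewrite (changes_same _ (a' * p0 (egv j')) a') by nra.
  rewrite (change_scale a (a' * p0 (egv j')) a a') by nra.
  specialize (IH j' a' Ha' Hd). unfold nodes in IH.
  assert (C : (change (a * alt j) (a' * alt j') + change a a' <= Z.of_nat j - Z.of_nat j')%Z); [|lia].
  destruct (Nat.eq_dec j (S j')) as [->|N].
  + assert (S2 : 0 < alt j' * alt j') by (assert (H := alt_neq0 j'); nra).
    assert (E : change (a * alt (S j')) (a' * alt j') = change (- a) a').
    { assert (E : forall x y, change x y = if Rlt_dec (x * y) 0 then 1%Z else 0%Z) by reflexivity.
      rewrite !E. replace (a * alt (S j') * (a' * alt j')) with (- a * a' * (alt j' * alt j'))
        by (unfold alt; simpl; ring).
      destruct (Rlt_dec (- a * a' * (alt j' * alt j')) 0), (Rlt_dec (- a * a') 0); auto; exfalso; nra. }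
    rewrite E. unfold change.
    destruct (Rlt_dec (- a * a') 0), (Rlt_dec (a * a') 0); lia || (exfalso; lra).
  + assert (B1 := change_bounds (a * alt j) (a' * alt j')).
    assert (B2 := change_bounds a a'). lia.
Qed.

(** Near [0] the solution [U] grows like a logarithm, and the Wronskian with a positive
    eigenfunction need not vanish there. The eigenfunctions are those of a second, regular
    solution [X], [Y] of the same system. Instead of the vanishing at [0], the argument keeps
    track of the signs at [0] and at infinity, as in the theorem of Budan and Fourier.
    [W] is a primitive of [U] that tends to infinity. *)
Section Exterior.
Variables U V W X Y : R -> R.
Hypothesis PF : pf_half U V.
Hypothesis U_pos : forall h, 0 < h -> 0 < U h.
Hypothesis V_pos : forall h, 0 < h -> 0 < V h.
Hypothesis V_near0 : exists c C d, 0 < c /\ 0 < d /\ forall h, 0 < h < d -> c <= V h <= C.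
Hypothesis hU_0 : vanishes_at0 half_line (fun h => h * U h).
Hypothesis W_derive : forall h, 0 < h -> is_derive W h (U h).
Hypothesis W_infty : forall A, exists H, 0 < H /\ forall h, H < h -> A <= W h.
Hypothesis UV_infty : forall eps, 0 < eps -> exists H, 0 < H /\ forall h, H < h -> U h <= eps * V h.
Hypothesis VhU_infty : forall eps, 0 < eps ->
  exists H, 0 < H /\ forall h, H < h -> V h <= eps * (h * U h).

Hypothesis PFr : pf_half X Y.
Hypothesis X_pos : forall h, 0 < h -> 0 < X h.
Hypothesis X_low : exists c d, 0 < c /\ 0 < d /\ forall h, 0 < h < d -> c <= X h.
Hypothesis X_bd : bounded_at0 half_line X.
Hypothesis Yh_bd : bounded_at0 half_line (fun h => Y h * / h).

Let HJ := half_line_open.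
Let id_0 : vanishes_at0 half_line (fun h => h).
Proof. apply vanishes_id. intros x Hx; exact Hx. Qed.

Lemma Y_0 : vanishes_at0 half_line Y.
Proof.
apply vanishes_ext with (fun h => h * (Y h * / h)).
- intros h Hh. unfold half_line in Hh. field. lra.
- now apply vanishes_mult.
Qed.

(** The derivative of [U] is below [- k / h] for some [k > 0]: compare with the logarithm. *)
Lemma U_blowup A : exists d, 0 < d /\ forall h, 0 < h < d -> A < U h.
Proof.
destruct V_near0 as [c [C [d [c0 [d0 Hd]]]]].
pose (d1 := Rmin d (1 / 4)).
assert (H1 : 0 < d1 <= 1/4 /\ d1 <= d).
{ unfold d1, Rmin; destruct (Rle_dec d (1/4)); lra. }
(* [U + k ln] decreases up to [d1], so that [U] exceeds [A] once [k ln h] is below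
   [k ln e - Rabs A]. *)
pose (e := d1 / 2).
pose (k := c / 8).
pose (d2 := Rmin e (e * exp (- (Rabs A) / k))).
assert (k0 : 0 < k) by (unfold k; lra).
exists d2. split.
{ unfold d2. apply Rmin_pos; [unfold e; lra|]. apply Rmult_lt_0_compat; [unfold e; lra|apply exp_pos]. }
intros h [h0 hd].
assert (he : h < e) by (apply Rlt_le_trans with (1 := hd); apply Rmin_l).
assert (he' : h < e * exp (- (Rabs A) / k)) by (apply Rlt_le_trans with (1 := hd); apply Rmin_r).
destruct (MVT_cor2 (fun x => U x + k * ln x)
  (fun x => - (4 * x * U x + V x) / (4 * x * (4 * x + 1)) + k * / x) h e he) as [z [E Hz]].
{ intros x Hx. apply is_derive_Reals. apply @is_derive_plus.
  - apply PF; lra.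
  - apply is_derive_scal. apply is_derive_ln. lra. }
assert (z0 : 0 < z < d1) by (unfold e in Hz; lra).
assert (Neg : - (4 * z * U z + V z) / (4 * z * (4 * z + 1)) + k * / z <= 0).
{ assert (Uz := U_pos z (proj1 z0)). destruct (Hd z) as [Vz _]; [lra|].
  replace (- (4 * z * U z + V z) / (4 * z * (4 * z + 1)) + k * / z)
    with ((- (4 * z * U z + V z) + 4 * k * (4 * z + 1)) * / (4 * z * (4 * z + 1))) by (field; lra).
  assert (0 < / (4 * z * (4 * z + 1))) by (apply Rinv_0_lt_compat, Rmult_lt_0_compat; lra).
  assert (0 <= 4 * z * U z) by (apply Rmult_le_pos; lra).
  assert (- (4 * z * U z + V z) + 4 * k * (4 * z + 1) <= 0) by (unfold k; nra).
  nra. }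
assert (Ue := U_pos e ltac:(unfold e; lra)).
assert (L : ln h < ln e + - (Rabs A) / k).
{ rewrite <- (ln_exp (- Rabs A / k)). rewrite <- ln_mult; [|unfold e; lra|apply exp_pos].
  apply ln_increasing; auto. }
assert (K : k * ln h < k * ln e - Rabs A).
{ replace (k * ln e - Rabs A) with (k * (ln e + - (Rabs A) / k)) by (field; lra).
  now apply Rmult_lt_compat_l. }
assert (A <= Rabs A) by apply Rle_abs.
assert ((- (4 * z * U z + V z) / (4 * z * (4 * z + 1)) + k * / z) * (e - h) <= 0) by nra.
lra.
Qed.

Lemma V_bounded : bounded_at0 half_line V.
Proof.
destruct V_near0 as [c [C [d [c0 [d0 Hd]]]]].
exists (Rabs C), d. split; [auto|split; [apply Rabs_pos|]].
intros x Hx Lx. destruct (Hd x) as [H1 H2]; [split; auto|].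
rewrite Rabs_right by lra. apply Rle_trans with (1 := H2). apply Rle_abs.
Qed.

Let BP := bounded_poly2.

Lemma form_sign_at0 v : p0 v <> 0 -> sign_at0 (form U V v) (p0 v).
Proof.
intros Hp.
assert (B : bounded_at0 half_line (fun h => (h * U h) * (p1 v + p2 v * h + 0 * h ^ 2)
   + V h * (q0 v + q1 v * h + q2 v * h ^ 2))).
{ apply bounded_plus; apply bounded_mult; auto using vanishes_bounded, V_bounded. }
destruct B as [C [d [d0 [C0 Hd]]]].
destruct (U_blowup (C / Rabs (p0 v))) as [d' [d'0 Hd']].
exists (Rmin d d'). split; [now apply Rmin_pos|]. intros h [h0 Lh].
assert (L1 : h < d) by (apply Rlt_le_trans with (1 := Lh); apply Rmin_l).
assert (L2 : h < d') by (apply Rlt_le_trans with (1 := Lh); apply Rmin_r).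
specialize (Hd h h0 L1). specialize (Hd' h (conj h0 L2)).
set (r := h * U h * (p1 v + p2 v * h + 0 * h ^ 2) + V h * (q0 v + q1 v * h + q2 v * h ^ 2)) in *.
replace (form U V v h) with (p0 v * U h + r) by (unfold form, r; ring).
assert (pp : 0 < Rabs (p0 v)) by now apply Rabs_pos_lt.
assert (C < Rabs (p0 v) * U h).
{ replace C with (Rabs (p0 v) * (C / Rabs (p0 v))) by (field; lra).
  now apply Rmult_lt_compat_l. }
assert (Rabs r < Rabs (p0 v) * U h) by lra. apply Rabs_def2 in H0.
unfold Rabs in *. destruct (Rcase_abs (p0 v)); nra.
Qed.

Lemma hform_vanishes v : vanishes_at0 half_line (fun h => h * form U V v h).
Proof.
apply vanishes_ext with (fun h => (h * U h) * (p0 v + p1 v * h + p2 v * h ^ 2)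
  + h * (V h * (q0 v + q1 v * h + q2 v * h ^ 2))).
{ intros; unfold form; ring. }
apply vanishes_plus; apply vanishes_mult; auto. apply bounded_mult; auto using V_bounded.
Qed.

Lemma flux_regular_bounded g : bounded_at0 half_line (fun h => flux X Y g h * / h).
Proof.
assert (B : bounded_at0 half_line (fun h =>
  ((4 + 16 * h + 0 * h ^ 2) * (p1 g + 2 * p2 g * h + 0 * h ^ 2)
   + ((- 4 * p0 g - 4 * q0 g) + (- 4 * p1 g - 4 * q1 g) * h + (- 4 * p2 g - 4 * q2 g) * h ^ 2))
   * X h +
  (Y h * / h) * ((0 + 4 * h + 16 * h ^ 2) * (q1 g + 2 * q2 g * h + 0 * h ^ 2)
     + ((- p0 g) + (- p1 g) * h + (- p2 g) * h ^ 2 +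
       (0 + 4 * h + 0 * h ^ 2) * (q0 g + q1 g * h + q2 g * h ^ 2))))).
{ repeat first [assumption|apply BP|apply bounded_plus|apply bounded_mult]. }
destruct B as [C [d [d0 [C0 Hd]]]]. exists C, d. repeat split; auto.
intros x Hx Lx. specialize (Hd x Hx Lx). unfold half_line in Hx.
eapply Rle_trans; [|exact Hd]. right. f_equal. unfold flux. field. lra.
Qed.

Lemma form_regular_bounded g : bounded_at0 half_line (form X Y g).
Proof. apply form_bounded; auto using Y_0. Qed.

Lemma form_flux_vanishes v g : vanishes_at0 half_line (fun h => form U V v h * flux X Y g h).
Proof.
apply vanishes_ext with (fun h => (h * form U V v h) * (flux X Y g h * / h)).
- intros h Hh. unfold half_line in Hh. field. lra.
- apply vanishes_mult; auto using hform_vanishes, flux_regular_bounded.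
Qed.

(** Near the saddle loop the only term of the flux that survives is [- p0 V]. *)
Lemma flux_principal v : vanishes_at0 half_line (fun h => flux U V v h + p0 v * V h).
Proof.
apply vanishes_ext with (fun h =>
  (h * U h) * (4 * (4 * h + 1) * (p1 v + 2 * p2 v * h) - 4 * (p0 v + p1 v * h + p2 v * h ^ 2)
     - 4 * (q0 v + q1 v * h + q2 v * h ^ 2)) +
  h * (V h * (4 * (4 * h + 1) * (q1 v + 2 * q2 v * h) - (p1 v + p2 v * h)
     + 4 * (q0 v + q1 v * h + q2 v * h ^ 2)))).
{ intros h _. unfold flux. ring. }
assert (E : forall (a b c : R) f, (forall h, f h = a + b * h + c * h ^ 2) -> bounded_at0 half_line f).
{ intros a b c f Ef. destruct (BP a b c) as [C [d [d0 [C0 Hd]]]]. exists C, d.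
  repeat split; auto. intros x Hx Lx. rewrite Ef. auto. }
apply vanishes_plus; apply vanishes_mult; auto.
- apply (E (4 * p1 v - 4 * p0 v - 4 * q0 v) (8 * p2 v + 16 * p1 v - 4 * p1 v - 4 * q1 v)
    (32 * p2 v - 4 * p2 v - 4 * q2 v)). intros; ring.
- apply bounded_mult; auto using V_bounded.
  apply (E (4 * q1 v - p1 v + 4 * q0 v) (8 * q2 v + 16 * q1 v - p2 v + 4 * q1 v)
    (32 * q2 v + 4 * q2 v)). intros; ring.
Qed.

Lemma wronskian_sign_at0 v g : 0 < p0 g -> p0 v <> 0 ->
  sign_at0 (flux_wronskian U V X Y v g) (- p0 v).
Proof.
intros Hg Hp.
assert (R0 : vanishes_at0 half_line (fun h => (flux U V v h + p0 v * V h) * form X Y g h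
   + (form U V v h * flux X Y g h) * -1)).
{ apply vanishes_plus; apply vanishes_mult;
    auto using flux_principal, form_regular_bounded, form_flux_vanishes, bounded_const. }
destruct (form_low_near0 X Y X_low X_bd Y_0 g Hg) as [c1 [d1 [c10 [d10 Hd1]]]].
destruct V_near0 as [c2 [C [d2 [c20 [d20 Hd2]]]]].
assert (pp : 0 < Rabs (p0 v)) by now apply Rabs_pos_lt.
assert (cc : 0 < Rabs (p0 v) * (c2 * c1)) by (apply Rmult_lt_0_compat; auto; nra).
destruct (R0 _ cc) as [d3 [d30 Hd3]].
exists (Rmin d1 (Rmin d2 d3)). split; [now repeat apply Rmin_pos|]. intros h [h0 Lh].
assert (L1 : h < d1) by (apply Rlt_le_trans with (1 := Lh); apply Rmin_l).
assert (L' : h < Rmin d2 d3) by (apply Rlt_le_trans with (1 := Lh); apply Rmin_r).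
assert (L2 : h < d2) by (apply Rlt_le_trans with (1 := L'); apply Rmin_l).
assert (L3 : h < d3) by (apply Rlt_le_trans with (1 := L'); apply Rmin_r).
specialize (Hd1 h h0 L1). specialize (Hd2 h (conj h0 L2)). specialize (Hd3 h h0 L3).
set (r := (flux U V v h + p0 v * V h) * form X Y g h + form U V v h * flux X Y g h * -1) in *.
replace (flux_wronskian U V X Y v g h) with (r - p0 v * (V h * form X Y g h))
  by (unfold r, flux_wronskian; ring).
assert (c2 * c1 <= V h * form X Y g h) by (apply Rmult_le_compat; lra).
apply Rabs_def2 in Hd3. unfold Rabs in *. destruct (Rcase_abs (p0 v)); nra.
Qed.

Lemma wronskian_vanishes v g : p0 v = 0 ->
  vanishes_at0 half_line (flux_wronskian U V X Y v g).
Proof.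
intros Hp.
apply vanishes_ext with (fun h => (flux U V v h + p0 v * V h) * form X Y g h
   + (form U V v h * flux X Y g h) * -1).
{ intros h _. unfold flux_wronskian. rewrite Hp. ring. }
apply vanishes_plus; apply vanishes_mult;
    auto using flux_principal, form_regular_bounded, form_flux_vanishes, bounded_const.
Qed.

(** The six functions in the order of their growth at infinity. *)
Definition term (k : nat) (h : R) : R :=
  match k with
  | 0%nat => U h | 1%nat => V h | 2%nat => h * U h
  | 3%nat => h * V h | 4%nat => h ^ 2 * U h | _ => h ^ 2 * V h
  end.

Lemma term_pos k h : 0 < h -> 0 < term k h.
Proof.
intros Hh. specialize (U_pos h Hh). specialize (V_pos h Hh).
destruct k as [|[|[|[|[|k]]]]]; simpl; auto; repeat apply Rmult_lt_0_compat; auto; lra.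
Qed.

Lemma term_small k eps : (k < 5)%nat -> 0 < eps ->
  exists H, 0 < H /\ forall h, H < h -> term k h <= eps * term (S k) h.
Proof.
intros Hk He.
destruct (UV_infty eps He) as [H1 [H10 HH1]]. destruct (VhU_infty eps He) as [H2 [H20 HH2]].
destruct k as [|[|[|[|[|k]]]]]; [..|lia]; simpl.
- now exists H1.
- now exists H2.
- exists H1. split; auto. intros h Hh. specialize (HH1 h Hh). nra.
- exists H2. split; auto. intros h Hh. specialize (HH2 h Hh).
  replace (eps * (h * (h * 1) * U h)) with (h * (eps * (h * U h))) by ring.
  apply Rmult_le_compat_l; lra.
- exists H1. split; auto. intros h Hh. specialize (HH1 h Hh).
  replace (eps * (h * (h * 1) * V h)) with (h * (h * 1) * (eps * V h)) by ring.
  apply Rmult_le_compat_l; [nra|lra].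
Qed.

Fixpoint tsum (k : nat) (v : vec) (h : R) : R :=
  match k with
  | 0%nat => coord 0 v * term 0 h
  | S k' => tsum k' v h + coord (S k') v * term (S k') h
  end.

Lemma tsum_form v h : tsum 5 v h = form U V v h.
Proof. unfold form; simpl. ring. Qed.

Lemma tsum_bound k v : (k <= 5)%nat ->
  exists H, 0 < H /\ forall h, H < h -> Rabs (tsum k v h) <= (Rabs (coord k v) + 1) * term k h.
Proof.
induction k as [|k IH]; intros Hk.
- exists 1. split; [lra|]. intros h Hh. assert (P := term_pos 0 h ltac:(lra)). cbn [tsum].
  rewrite Rabs_mult, (Rabs_right (term 0 h)) by lra. nra.
- destruct IH as [H1 [H10 HH1]]; [lia|].
  assert (Rp := Rabs_pos (coord k v)).
  destruct (term_small k (/ (Rabs (coord k v) + 1))) as [H2 [H20 HH2]];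
    [lia|apply Rinv_0_lt_compat; lra|].
  exists (Rmax H1 H2). split; [apply Rlt_le_trans with H1; auto; apply Rmax_l|].
  intros h Hh.
  assert (L1 : H1 < h) by (apply Rle_lt_trans with (2 := Hh); apply Rmax_l).
  assert (L2 : H2 < h) by (apply Rle_lt_trans with (2 := Hh); apply Rmax_r).
  specialize (HH1 h L1). specialize (HH2 h L2).
  assert (P := term_pos (S k) h ltac:(lra)). cbn [tsum].
  apply Rle_trans with (1 := Rabs_triang _ _).
  rewrite Rabs_mult, (Rabs_right (term (S k) h)) by lra.
  assert ((Rabs (coord k v) + 1) * term k h <= term (S k) h); [|lra].
  replace (term (S k) h) with ((Rabs (coord k v) + 1) * (/ (Rabs (coord k v) + 1) * term (S k) h))
    by (field; lra).
  apply Rmult_le_compat_l; lra.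
Qed.

Lemma term_ge_U k : (k <= 5)%nat -> exists H, 0 < H /\ forall h, H < h -> U h <= term k h.
Proof.
induction k as [|k IH]; intros Hk; [exists 1; split; [lra|intros; simpl; lra]|].
destruct IH as [H1 [H10 HH1]]; [lia|].
destruct (term_small k 1) as [H2 [H20 HH2]]; [lia|lra|].
exists (Rmax H1 H2). split; [apply Rlt_le_trans with H1; auto; apply Rmax_l|].
intros h Hh.
assert (L1 : H1 < h) by (apply Rle_lt_trans with (2 := Hh); apply Rmax_l).
assert (L2 : H2 < h) by (apply Rle_lt_trans with (2 := Hh); apply Rmax_r).
specialize (HH1 h L1). specialize (HH2 h L2). lra.
Qed.

(** The quantitative form is needed to integrate the sign: [U] has the primitive [W], which
    tends to infinity. *)
Lemma tsum_lead k v : (k <= 5)%nat -> coord k v <> 0 ->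
  exists e H, 0 < e /\ 0 < H /\ forall h, H < h -> e * U h <= coord k v * tsum k v h.
Proof.
intros Hk Hc. destruct (term_ge_U k Hk) as [H3 [H30 HH3]].
set (a := coord k v) in *. assert (a2 : 0 < a * a) by nra.
destruct k as [|k].
- exists (a * a), H3. split; [auto|split; [auto|]].
  intros h Hh. cbn [tsum]. fold a. specialize (HH3 h Hh). nra.
- destruct (tsum_bound k v) as [H1 [H10 HH1]]; [lia|].
  assert (Rp := Rabs_pos (coord k v)). assert (Ra := Rabs_pos_lt a Hc).
  set (m := Rabs (coord k v) + 1) in *. assert (m0 : 0 < m) by (unfold m; lra).
  destruct (term_small k (Rabs a / (2 * m))) as [H2 [H20 HH2]];
    [lia|apply Rdiv_lt_0_compat; lra|].
  exists (a * a / 2), (Rmax H3 (Rmax H1 H2)). split; [lra|].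
  split; [apply Rlt_le_trans with H3; auto; apply Rmax_l|].
  intros h Hh.
  assert (L3 : H3 < h) by (apply Rle_lt_trans with (2 := Hh); apply Rmax_l).
  assert (L : Rmax H1 H2 < h) by (apply Rle_lt_trans with (2 := Hh); apply Rmax_r).
  assert (L1 : H1 < h) by (apply Rle_lt_trans with (2 := L); apply Rmax_l).
  assert (L2 : H2 < h) by (apply Rle_lt_trans with (2 := L); apply Rmax_r).
  specialize (HH1 h L1). specialize (HH2 h L2). specialize (HH3 h L3).
  assert (P := term_pos (S k) h ltac:(lra)). cbn [tsum]. fold a.
  assert (B : Rabs (tsum k v h) <= Rabs a / 2 * term (S k) h).
  { apply Rle_trans with (1 := HH1).
    replace (Rabs a / 2 * term (S k) h) with (m * (Rabs a / (2 * m) * term (S k) h)) by (field; lra).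
    apply Rmult_le_compat_l; lra. }
  assert (B2 : Rabs (a * tsum k v h) <= a * a / 2 * term (S k) h).
  { rewrite Rabs_mult. replace (a * a) with (Rabs a * Rabs a)
      by (rewrite <- Rabs_mult; apply Rabs_right; lra). nra. }
  apply Rabs_le_between in B2.
  replace (a * (tsum k v h + a * term (S k) h)) with (a * tsum k v h + a * a * term (S k) h) by ring.
  nra.
Qed.

Lemma form_tsum k v h : (k <= 5)%nat -> degree_le k v -> form U V v h = tsum k v h.
Proof.
intros Hk Hd. rewrite <- tsum_form.
assert (E : forall n, (k + n <= 5)%nat -> tsum (k + n) v h = tsum k v h).
{ induction n as [|n IH]; intros Hn; [now rewrite Nat.add_0_r|].
  rewrite Nat.add_succ_r. cbn [tsum]. rewrite IH by lia. rewrite (Hd (S (k + n))) by lia. ring. }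
replace 5%nat with (k + (5 - k))%nat by lia. apply E. lia.
Qed.

Lemma form_lead k v : (k <= 5)%nat -> degree_le k v -> coord k v <> 0 ->
  exists e H, 0 < e /\ 0 < H /\ forall h, H < h -> e * U h <= coord k v * form U V v h.
Proof.
intros Hk Hd Hc. destruct (tsum_lead k v Hk Hc) as [e [H [e0 [H0 HH]]]].
exists e, H. repeat split; auto. intros h Hh. rewrite (form_tsum k v h Hk Hd). auto.
Qed.

Lemma form_sign_at_infty k v : (k <= 5)%nat -> degree_le k v -> coord k v <> 0 ->
  sign_at_infty (form U V v) (coord k v).
Proof.
intros Hk Hd Hc. destruct (form_lead k v Hk Hd Hc) as [e [H [e0 [H0 HH]]]].
exists H. split; auto. intros h Hh. specialize (HH h Hh).
assert (0 < U h) by (apply U_pos; lra). nra.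
Qed.

Lemma kill_vshift k v h :
  form U V (vshift legendre (fst (eig k)) v) h = - form U V (kill k v) h.
Proof. unfold vshift, kill. rewrite !form_vlin. ring. Qed.

Lemma eig_value_pos k : (1 <= k)%nat -> 0 < fst (eig k).
Proof. intros H. destruct k as [|[|[|[|[|k]]]]]; simpl; lia || lra. Qed.

Let g_pos k h : 0 < h -> 0 < form X Y (snd (eig k)) h.
Proof. apply eig_positive; auto using Y_0. Qed.

Lemma vanishing_increasing_nonneg f f' h : (forall x, 0 < x -> is_derive f x (f' x)) ->
  (forall x, 0 < x <= h -> 0 <= f' x) -> vanishes_at0 half_line f -> 0 < h -> 0 <= f h.
Proof.
intros D P Vf Hh. apply Rnot_lt_le. intros N.
destruct (Vf (- f h)) as [d [d0 Hd]]; [lra|].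
pose (x := Rmin (h / 2) (d / 2)).
assert (Hx : 0 < x <= h / 2) by (unfold x, Rmin; destruct (Rle_dec (h/2) (d/2)); lra).
assert (Hxd : x < d) by (unfold x, Rmin; destruct (Rle_dec (h/2) (d/2)); lra).
specialize (Hd x (proj1 Hx) Hxd).
destruct (MVT_cor2 f f' x h) as [c [E Hc]]; [lra| |].
- intros c Hc. apply is_derive_Reals. apply D. lra.
- assert (0 <= f' c) by (apply P; lra). apply Rabs_def2 in Hd. nra.
Qed.

Lemma eig_increasing k h : (1 <= k)%nat -> 1 < h ->
  form X Y (snd (eig k)) 1 <= form X Y (snd (eig k)) h.
Proof.
intros Hk Hh. set (g := snd (eig k)).
assert (Fp : forall x, 0 < x -> 0 <= flux X Y g x).
{ intros x Hx. apply vanishing_increasing_nonneg with (f' := form X Y (legendre g)); auto.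
  - intros z Hz. now apply flux_derive.
  - intros z Hz. unfold g. rewrite eig_spec, form_vlin.
    assert (A := eig_value_pos k Hk). assert (B := g_pos k z (proj1 Hz)). nra.
  - apply flux_vanishes; auto using Y_0. }
destruct (MVT_cor2 (form X Y g) (fun x => flux X Y g x / (4 * x * (4 * x + 1))) 1 h Hh)
  as [c [E Hc]].
- intros c Hc. apply is_derive_Reals. apply form_derive; auto. lra.
- assert (0 <= flux X Y g c / (4 * c * (4 * c + 1))).
  { apply Rmult_le_pos; [apply Fp; lra|]. apply Rlt_le, Rinv_0_lt_compat. nra. }
  nra.
Qed.

(** The derivative of the Wronskian is at most [- q e U] once multiplied by [b], with
    [q > 0] a lower bound of the eigenfunction; hence the Wronskian tends to infinity at
    least as fast as [W]. *)
Lemma wronskian_sign_at_infty k v b : (1 <= k)%nat ->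
  (exists e H, 0 < e /\ 0 < H /\ forall h, H < h -> e * U h <= b * form U V (kill k v) h) ->
  sign_at_infty (flux_wronskian U V X Y v (snd (eig k))) (- b).
Proof.
intros Hk [e [H [e0 [H0 HH]]]]. set (g := snd (eig k)).
pose (m := Rmax H 1). assert (m1 : 1 <= m) by apply Rmax_r. assert (mH : H <= m) by apply Rmax_l.
set (q := form X Y g 1). assert (q0 : 0 < q) by (apply g_pos; lra).
pose (f := fun h => b * flux_wronskian U V X Y v g h + q * e * W h).
destruct (W_infty ((f (m + 1) + 1) / (q * e))) as [H' [H'0 HH']].
assert (qe : 0 < q * e) by now apply Rmult_lt_0_compat.
exists (Rmax H' (m + 1)). split; [apply Rlt_le_trans with H'; auto; apply Rmax_l|].
intros h Hh.
assert (L1 : H' < h) by (apply Rle_lt_trans with (2 := Hh); apply Rmax_l).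
assert (L2 : m + 1 < h) by (apply Rle_lt_trans with (2 := Hh); apply Rmax_r).
destruct (MVT_cor2 f (fun x => b * (1 * form X Y g x * form U V (vshift legendre (fst (eig k)) v) x)
   + q * e * U x) (m + 1) h L2) as [c [E Hc]].
- intros c Hc. apply is_derive_Reals. unfold f. apply @is_derive_plus; apply is_derive_scal.
  + apply flux_wronskian_derive; auto; [lra|]. apply eig_spec.
  + apply W_derive. lra.
- specialize (HH' h L1). specialize (HH c). rewrite kill_vshift in E.
  assert (G : q <= form X Y g c) by (apply eig_increasing; auto; lra).
  assert (K : e * U c <= b * form U V (kill k v) c) by (apply HH; lra).
  assert (Up := U_pos c ltac:(lra)).
  assert (N : b * (1 * form X Y g c * - form U V (kill k v) c) + q * e * U c <= 0).
  { assert (q * (e * U c) <= form X Y g c * (b * form U V (kill k v) c)).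
    { apply Rmult_le_compat; try lra. apply Rmult_le_pos; lra. }
    lra. }
  assert (f h <= f (m + 1)).
  { assert ((b * (1 * form X Y g c * - form U V (kill k v) c) + q * e * U c) * (h - (m + 1)) <= 0).
    { assert (0 < h - (m + 1)) by lra. nra. }
    lra. }
  assert (f (m + 1) + 1 <= q * e * W h).
  { replace (f (m + 1) + 1) with (q * e * ((f (m + 1) + 1) / (q * e))) by (field; lra).
    apply Rmult_le_compat_l; lra. }
  unfold f in H1 at 1. lra.
Qed.

Lemma vanishing_sign f f' s : (forall x, 0 < x -> is_derive f x (f' x)) ->
  vanishes_at0 half_line f -> sign_at0 f' s -> sign_at0 f s.
Proof.
intros D Vf [d [d0 Hd]]. exists d. split; auto. intros h Hh.
assert (P : forall x, 0 < x <= h -> 0 <= s * f x).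
{ intros x Hx.
  apply (vanishing_increasing_nonneg (fun y => s * f y) (fun y => s * f' y)); [| | |lra].
  - intros y Hy. apply is_derive_scal. auto.
  - intros y Hy. apply Rlt_le, Hd. lra.
  - apply vanishes_ext with (fun y => f y * s); [intros; ring|].
    apply vanishes_mult; auto using bounded_const. }
destruct (MVT_cor2 (fun y => s * f y) (fun y => s * f' y) (h / 2) h) as [c [E Hc]]; [lra| |].
- intros c Hc. apply is_derive_Reals. apply is_derive_scal. apply D. lra.
- assert (0 < s * f' c) by (apply Hd; lra). assert (0 <= s * f (h / 2)) by (apply P; lra). nra.
Qed.

Let SU : smooth half_line U. Proof. exact (proj1 (pf_smooth U V PF)). Qed.
Let SV : smooth half_line V. Proof. exact (proj2 (pf_smooth U V PF)). Qed.
Let SX : smooth half_line X. Proof. exact (proj1 (pf_smooth X Y PFr)). Qed.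
Let SY : smooth half_line Y. Proof. exact (proj2 (pf_smooth X Y PFr)). Qed.
Let SF v : smooth half_line (form U V v).
Proof. apply form_smooth; auto. Qed.
Let SG v : smooth half_line (form X Y v).
Proof. apply form_smooth; auto. Qed.

Lemma ratio_signed_rolle k v (eL eR : bool) B :
  Zle half_line (flux_wronskian U V X Y v (snd (eig k))) B ->
  (eL = true -> exists d, 0 < d /\ forall h, 0 < h < d ->
     0 < form U V v h * flux_wronskian U V X Y v (snd (eig k)) h) ->
  (eR = true -> exists H, 0 < H /\ forall h, H < h ->
     form U V v h * flux_wronskian U V X Y v (snd (eig k)) h < 0) ->
  Zle half_line (form U V v) (B + 1 - Z.b2z eL - Z.b2z eR).
Proof.
intros HB HL HR. set (g := snd (eig k)) in *.
assert (Gp : forall h, half_line h -> 0 < form X Y g h) by (intros h Hh; now apply g_pos).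
assert (Sig : smooth half_line (fun h => / form X Y g h)).
{ apply smooth_inv; auto. intros h Hh. specialize (Gp h Hh). lra. }
apply Zle_mult with (fun h => / form X Y g h); auto.
assert (Gi : forall h, 0 < h -> 0 < / form X Y g h).
{ intros h Hh. apply Rinv_0_lt_compat, Gp, Hh. }
apply signed_rolle with (f1 := flux_wronskian U V X Y v g)
  (w := fun h => / (4 * h * (4 * h + 1)) * / form X Y g h ^ 2); auto.
- now apply smooth_mult.
- now apply flux_wronskian_smooth.
- apply smooth_mult; [exact half_weight_smooth|].
  apply smooth_ext with (fun h => / form X Y g h * / form X Y g h); auto.
  + intros h Hh. specialize (Gp h Hh). field. lra.
  + now apply smooth_mult.
- intros h Hh. apply Rmult_lt_0_compat; [now apply half_weight_pos|].
  apply Rinv_0_lt_compat. apply pow_lt. auto.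
- intros h Hh. apply ratio_derive; auto. specialize (Gp h Hh). lra.
- intros E. destruct (HL E) as [d [d0 Hd]]. exists d. split; auto. intros h Hh.
  specialize (Hd h Hh). specialize (Gi h (proj1 Hh)).
  replace (form U V v h * / form X Y g h * flux_wronskian U V X Y v g h) with
   (form U V v h * flux_wronskian U V X Y v g h * / form X Y g h) by ring.
  now apply Rmult_lt_0_compat.
- intros E. destruct (HR E) as [d [d0 Hd]]. exists d. split; auto. intros h Hh.
  specialize (Hd h Hh). specialize (Gi h ltac:(lra)).
  replace (form U V v h * / form X Y g h * flux_wronskian U V X Y v g h) with
   (form U V v h * flux_wronskian U V X Y v g h * / form X Y g h) by ring. nra.
Qed.

Let sgt (x : R) : bool := if Rlt_dec 0 x then true else false.

Let sgt_change x y : x <> 0 -> y <> 0 -> change x y = (1 - Z.b2z (sgt (x * y)))%Z.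
Proof.
intros Hx Hy. unfold change, sgt.
destruct (Rlt_dec (x * y) 0), (Rlt_dec 0 (x * y)); simpl; auto; exfalso; try lra.
assert (x * y = 0) by lra. destruct (Rmult_integral _ _ H); auto.
Qed.

Lemma Zle_vshift k v B : Zle half_line (form U V (kill k v)) B ->
  Zle half_line (form U V (vshift legendre (fst (eig k)) v)) B.
Proof.
intros HB. apply Zle_mult with (fun _ => -1); auto using smooth_const.
apply Zle_ext with (form U V (kill k v)); auto.
intros h _. rewrite kill_vshift. ring.
Qed.

(** Killing the top eigenvalue of [v]: a change of sign at infinity costs one zero. At [0] it
    depends on [p0 v]. If it is not zero then the Wronskian has the sign of [- p0 v] at [0],
    and a change of sign costs one zero; if it is zero then the Wronskian vanishes at [0],
    and a change of sign gains one. *)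
Lemma exterior_step k v s s1 b b1 B : (1 <= k)%nat ->
  Zle half_line (form U V (kill k v)) B ->
  s <> 0 -> sign_at0 (form U V v) s ->
  s1 <> 0 -> sign_at0 (form U V (kill k v)) s1 ->
  b <> 0 -> sign_at_infty (form U V v) b ->
  b1 <> 0 ->
  (exists e H, 0 < e /\ 0 < H /\ forall h, H < h -> e * U h <= b1 * form U V (kill k v) h) ->
  (p0 v <> 0 -> 0 < s * p0 v) ->
  Zle half_line (form U V v)
    (B + change b b1 + (if Req_dec_T (p0 v) 0 then - change s s1 else change s s1)).
Proof.
intros Hk HB s0 Hs s10 Hs1 b0 Hb b10 Hb1 Hps. set (g := snd (eig k)).
assert (HB' := Zle_vshift k v B HB).
assert (Phi_inf := wronskian_sign_at_infty k v b1 Hk Hb1). fold g in Phi_inf.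
assert (Sv1 : sign_at0 (form U V (vshift legendre (fst (eig k)) v)) (- s1)).
{ destruct Hs1 as [d [d0 Hd]]. exists d. split; auto. intros h Hh. rewrite kill_vshift.
  specialize (Hd h Hh). lra. }
assert (DPhi : forall x, half_line x -> is_derive (flux_wronskian U V X Y v g) x
   (form X Y g x * form U V (vshift legendre (fst (eig k)) v) x)).
{ intros x Hx. evar_last; [apply flux_wronskian_derive; auto; apply eig_spec|ring]. }
assert (HR : sgt (b * b1) = true -> exists H, 0 < H /\ forall h, H < h ->
     form U V v h * flux_wronskian U V X Y v g h < 0).
{ unfold sgt. intros E. apply sign_at_infty_mult with b (- b1); auto.
  destruct (Rlt_dec 0 (b * b1)); [lra|discriminate]. }
destruct (Req_dec_T (p0 v) 0) as [Hp|Hp].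
- assert (VPhi := wronskian_vanishes v g Hp).
  assert (Z2 : Zle half_line (flux_wronskian U V X Y v g) (B + 1 - 1 - 0)).
  { apply (rolle_count half_line HJ (flux_wronskian U V X Y v g)
      (form U V (vshift legendre (fst (eig k)) v)) (form X Y g)) with (eL := true) (eR := false);
      try easy; try now apply SF; try now apply SG.
    - intros x Hx. now apply g_pos.
    - intros _. apply (vanishes_left_gain half_line HJ) with (form X Y g); try easy; try now apply SF.
      intros x Hx. now apply g_pos. }
  assert (SPhi : sign_at0 (flux_wronskian U V X Y v g) (- s1)).
  { apply vanishing_sign with
      (fun x => form X Y g x * form U V (vshift legendre (fst (eig k)) v) x); auto.
    destruct Sv1 as [d [d0 Hd]]. exists d. split; auto. intros h Hh. specialize (Hd h Hh).
    assert (Gh := g_pos k h (proj1 Hh)). fold g in Gh. nra. }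
  assert (Z1 := ratio_signed_rolle k v (sgt (s * - s1)) (sgt (b * b1)) _ Z2).
  apply Zle_weak with (2 := Z1 ltac:(intros E; apply sign_at0_mult with s (- s1); auto;
    unfold sgt in E; destruct (Rlt_dec 0 (s * - s1)); [auto|discriminate]) HR).
  rewrite (sgt_change b b1) by auto.
  assert (E : change s s1 = Z.b2z (sgt (s * - s1))).
  { unfold change, sgt. destruct (Rlt_dec (s * s1) 0), (Rlt_dec 0 (s * - s1)); auto; exfalso; lra. }
  rewrite E. lia.
- specialize (Hps Hp).
  assert (SPhi := wronskian_sign_at0 v g (eig_p0 k) Hp).
  assert (Z2 : Zle half_line (flux_wronskian U V X Y v g) (B + 1 - Z.b2z (sgt (s * s1)) - Z.b2z false)).
  { apply signed_rolle with (f1 := form U V (vshift legendre (fst (eig k)) v)) (w := form X Y g);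
      try easy; try now apply SF; try now apply SG.
    - now apply flux_wronskian_smooth.
    - intros x Hx. now apply g_pos.
    - intros E. apply sign_at0_mult with (- p0 v) (- s1); auto.
      unfold sgt in E. destruct (Rlt_dec 0 (s * s1)); [|discriminate].
      assert (0 < (s * s1) * (s * p0 v)) by now apply Rmult_lt_0_compat.
      assert (S2 : 0 < s * s) by nra. apply Rmult_lt_reg_l with (s * s); auto. lra. }
  assert (Z1 := ratio_signed_rolle k v false (sgt (b * b1)) _ Z2 ltac:(discriminate) HR).
  apply Zle_weak with (2 := Z1).
  rewrite (sgt_change b b1), (sgt_change s s1) by auto.
  change (Z.b2z false) with 0%Z. lia.
Qed.

(** Here the Wronskian is a nonzero constant, so that the quotient by the regular
    eigenfunction is monotone; for an even index it has no zero, by its signs at the two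
    ends. *)
Lemma eigenfunction_bound k v : (k <= 5)%nat -> kill k v = vzero -> degree_le k v ->
  0 < coord k v * alt k * p0 v ->
  Zle half_line (form U V v) (if Nat.odd k then 1 else 0).
Proof.
intros Hk5 Hk Hd Hs.
assert (cs : coord k v <> 0 /\ p0 v <> 0).
{ split; intros E; rewrite E in Hs; lra. }
destruct cs as [Hc Hp]. set (g := egv k).
assert (S0 := wronskian_sign_at0 v g (eig_p0 k) Hp).
assert (DPhi : forall x, 0 < x -> is_derive (flux_wronskian U V X Y v g) x 0).
{ intros x Hx. evar_last; [apply flux_wronskian_derive with (lam := lam k); auto; apply eig_spec|].
  unfold lam. rewrite kill_vshift, Hk. unfold form, vzero; simpl. ring. }
assert (Const : forall x, 0 < x -> 0 < - p0 v * flux_wronskian U V X Y v g x).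
{ destruct S0 as [d [d0 Hd0]]. intros x Hx.
  pose (z := Rmin x d / 2). assert (0 < z < d /\ z < x).
  { unfold z, Rmin; destruct (Rle_dec x d); lra. }
  destruct (MVT_cor2 (flux_wronskian U V X Y v g) (fun _ => 0) z x) as [c [E _]]; [lra| |].
  - intros c Hz. apply is_derive_Reals. apply DPhi. lra.
  - replace (flux_wronskian U V X Y v g x) with (flux_wronskian U V X Y v g z) by lra.
    apply Hd0. lra. }
assert (Z0 : Zle half_line (flux_wronskian U V X Y v g) 0).
{ apply Zle_nozero. intros x Hx E. specialize (Const x Hx). rewrite E in Const. lra. }
assert (Z1 := ratio_signed_rolle k v false
   (negb (Nat.odd k)) 0 Z0 ltac:(discriminate)).
assert (HR : negb (Nat.odd k) = true -> exists H : R, 0 < H /\ forall h : R, H < h ->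
      form U V v h * flux_wronskian U V X Y v (snd (eig k)) h < 0).
{ intros Ev. apply sign_at_infty_mult with (coord k v) (- p0 v).
  - apply form_sign_at_infty; auto.
  - exists 1; split; [lra|]; intros h Hh; apply Const; lra.
  - assert (E1 : alt k = 1).
    { unfold alt. destruct k as [|[|[|[|[|[|k]]]]]]; try discriminate; try lia; simpl; ring. }
    rewrite E1 in Hs. lra. }
apply Zle_weak with (2 := Z1 HR). destruct (Nat.odd k); simpl; lia.
Qed.

(** The changes of sign at [0] are bounded by those of the successive values of [p0], which
    are Newton sums. The unknown sign [s] at [0] of a function with [p0 = 0] is the reason
    for the quantification over [t]. *)
Lemma exterior_induction l : forall j a nu,
  (j <= 5)%nat -> a <> 0 -> descending j l ->
  List.Forall (fun mu => lam j < mu) nu ->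
  exists s (x : Z), s <> 0 /\ sign_at0 (form U V (comb nu ((j, a) :: l))) s /\
    Zle half_line (form U V (comb nu ((j, a) :: l))) (lead_changes j a l + x) /\
    forall t, t <> 0 ->
      (change t s + x <= changes t (newton_list nu (nodes ((j, a) :: l))))%Z.
Proof.
assert (Asg := form_sign_at0).
induction l as [|[j' a'] l IH]; intros j a nu Hj Ha Hd Hnu.
- assert (Np := nprod_pos _ _ Hnu).
  assert (Pe : 0 < p0 (egv j)) by apply eig_p0.
  set (v := comb nu [(j, a)]).
  assert (P0 : p0 v = nprod nu (lam j) * a * p0 (egv j)).
  { unfold v. rewrite p0_comb. simpl. ring. }
  assert (Pn : p0 v <> 0).
  { rewrite P0. repeat apply Rmult_integral_contrapositive_currified; auto; lra. }
  exists (p0 v), 0%Z. split; [auto|split; [auto|split]].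
  + rewrite Z.add_0_r. simpl lead_changes. apply eigenfunction_bound; auto.
    * unfold v. rewrite kill_comb, comb_killed; [reflexivity|]. apply in_or_app. right. now left.
    * apply comb_degree. simpl. auto.
    * unfold v at 1. rewrite comb_lead, P0 by (auto; simpl; auto).
      assert (S2 : 0 < alt j * alt j) by (assert (H := alt_neq0 j); nra).
      replace (nprod nu (lam j) * a * alt j * alt j * (nprod nu (lam j) * a * p0 (egv j)))
        with ((nprod nu (lam j) * nprod nu (lam j)) * (a * a) * (alt j * alt j) * p0 (egv j)) by ring.
      assert (0 < a * a) by nra.
      do 3 (apply Rmult_lt_0_compat; [|assumption]). now apply Rmult_lt_0_compat.
  + intros t Ht. cbn [nodes map newton_list fst snd changes].
    change (newton nu [(lam j, a * p0 (egv j))]) with (newton nu (nodes [(j, a)])).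
    rewrite <- p0_comb. fold v. destruct (Req_dec_T (p0 v) 0); [contradiction|lia].
- assert (Hd0 := Hd). destruct Hd as [Hjj' [Ha' Hd]].
  assert (Hl : lam j' < lam j) by (apply lam_increasing; auto).
  assert (Hnu' : List.Forall (fun mu => lam j' < mu) (nu ++ [lam j])).
  { apply Forall_app. split; [|constructor; auto].
    eapply Forall_impl; [|exact Hnu]. simpl. intros; lra. }
  destruct (IH j' a' (nu ++ [lam j]) ltac:(lia) Ha' Hd Hnu') as [s1 [x1 [s10 [Ss1 [Z1 T1]]]]].
  set (v := comb nu ((j, a) :: (j', a') :: l)).
  assert (Kv : kill j v = comb (nu ++ [lam j]) ((j', a') :: l)).
  { unfold v. rewrite kill_comb, comb_killed; [reflexivity|]. apply in_or_app. right. now left. }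
  rewrite <- Kv in Ss1, Z1.
  assert (Np := nprod_pos _ _ Hnu). assert (Np' := nprod_pos _ _ Hnu').
  set (b := nprod nu (lam j) * a * alt j). set (b1 := nprod (nu ++ [lam j]) (lam j') * a' * alt j').
  assert (b0 : b <> 0).
  { unfold b. repeat apply Rmult_integral_contrapositive_currified; auto using alt_neq0; lra. }
  assert (b10 : b1 <> 0).
  { unfold b1. repeat apply Rmult_integral_contrapositive_currified; auto using alt_neq0; lra. }
  assert (Hb : sign_at_infty (form U V v) b).
  { unfold b. rewrite <- (comb_lead nu j a ((j', a') :: l)) by auto. fold v.
    apply form_sign_at_infty; auto.
    - apply comb_degree. simpl. auto.
    - unfold v. rewrite comb_lead; auto. }
  assert (Hb1 : exists e H, 0 < e /\ 0 < H /\
      forall h, H < h -> e * U h <= b1 * form U V (kill j v) h).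
  { rewrite Kv. unfold b1. rewrite <- (comb_lead (nu ++ [lam j]) j' a' l) by (auto; lia).
    apply form_lead; [lia| |].
    - apply comb_degree. simpl. auto.
    - rewrite comb_lead; auto. lia. }
  assert (Step := fun s (s0 : s <> 0) (Hs : sign_at0 (form U V v) s) =>
    exterior_step j v s s1 b b1 (lead_changes j' a' l + x1)
      ltac:(lia) Z1 s0 Hs s10 Ss1 b0 Hb b10 Hb1).
  assert (Eb : change b b1 = change (a * alt j) (a' * alt j')).
  { apply change_scale; unfold b, b1.
    - assert (0 < (a * alt j) * (a * alt j)).
      { assert (a * alt j <> 0) by (apply Rmult_integral_contrapositive_currified; auto using alt_neq0).
        nra. }
      replace (nprod nu (lam j) * a * alt j * (a * alt j)) with
        (nprod nu (lam j) * ((a * alt j) * (a * alt j))) by ring.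
      now apply Rmult_lt_0_compat.
    - assert (0 < (a' * alt j') * (a' * alt j')).
      { assert (a' * alt j' <> 0) by (apply Rmult_integral_contrapositive_currified; auto using alt_neq0).
        nra. }
      replace (nprod (nu ++ [lam j]) (lam j') * a' * alt j' * (a' * alt j')) with
        (nprod (nu ++ [lam j]) (lam j') * ((a' * alt j') * (a' * alt j'))) by ring.
      now apply Rmult_lt_0_compat. }
  rewrite Eb in Step.
  assert (Pv : newton nu (nodes ((j, a) :: (j', a') :: l)) = p0 v) by (unfold v; now rewrite p0_comb).
  change (nodes ((j, a) :: (j', a') :: l)) with
    ((lam j, a * p0 (egv j)) :: nodes ((j', a') :: l)) in *.
  change (lead_changes j a ((j', a') :: l)) with
    (change (a * alt j) (a' * alt j') + lead_changes j' a' l)%Z.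
  cbn [newton_list changes]. rewrite Pv.
  destruct (Req_dec_T (p0 v) 0) as [Hp|Hp].
  + (* A crude bound on the zeros, so that [form U V v] has a sign near [0]. *)
    assert (Fin : exists B, Zle half_line (form U V v) B).
    { exists (lead_changes j' a' l + x1 + 2)%Z.
      assert (Z2 : Zle half_line (flux_wronskian U V X Y v (egv j)) (lead_changes j' a' l + x1 + 1 - Z.b2z false - Z.b2z false)).
      { apply (rolle_count half_line half_line_open _ (form U V (vshift legendre (lam j) v))
          (form X Y (egv j))); try easy; try apply SF; try apply SG.
        - intros x Hx. apply eig_positive; auto. apply Y_0.
        - intros x Hx. evar_last; [apply flux_wronskian_derive with (lam := lam j); auto; apply eig_spec|].
          ring.
        - apply Zle_vshift. exact Z1. }
      apply Zle_weak with (2 := ratio_signed_rolle j v false false _ Z2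
        ltac:(discriminate) ltac:(discriminate)). simpl. lia. }
    destruct Fin as [B HB]. destruct (finite_zeros_sign _ B (SF v) HB) as [s [s0 Ss]].
    specialize (Step s s0 Ss ltac:(intros; contradiction)).
    exists s, (x1 - change s s1)%Z. split; [auto|split; [auto|split]].
    * apply Zle_weak with (2 := Step). lia.
    * intros t Ht. specialize (T1 t Ht). assert (C := change_triangle t s1 s s10).
      rewrite (change_sym s1 s) in C. lia.
  + assert (PP : p0 v <> 0 -> 0 < p0 v * p0 v) by (intros; nra).
    specialize (Step (p0 v) Hp (Asg v Hp) PP).
    exists (p0 v), (x1 + change (p0 v) s1)%Z. split; [auto|split; [auto|split]].
    * apply Zle_weak with (2 := Step). lia.
    * intros t Ht. specialize (T1 (p0 v) Hp). lia.
Qed.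

Lemma nodes_below l : forall k nu, (k <= 6)%nat -> descending k l ->
  (forall j, (j < k)%nat -> List.Forall (fun mu => lam j < mu) nu) -> below nu (nodes l).
Proof.
induction l as [|[j a] l IH]; intros k nu Hk Hd Hnu; simpl; auto.
destruct Hd as [H1 [H2 H3]]. split; [now apply Hnu|].
apply IH with j; auto; [lia|]. intros i Hi. apply Forall_app. split.
- apply Hnu. lia.
- constructor; auto. apply lam_increasing; lia.
Qed.

(** The signs at infinity and at [0] contribute together at most the largest index. *)
Lemma comb_bound l : descending 6 l -> l <> [] ->
  Zle half_line (form U V (comb [] l)) 5.
Proof.
intros Hd Hl. destruct l as [|[j a] l]; [contradiction|].
assert (Hb := nodes_below _ 6 [] ltac:(lia) Hd ltac:(intros; constructor)).
destruct Hd as [Hj [Ha Hd]].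
destruct (exterior_induction l j a [] ltac:(lia) Ha Hd ltac:(constructor))
  as [s [x [s0 [Ss [Z1 T]]]]].
apply Zle_weak with (2 := Z1).
assert (R := sign_rule l j a Ha Hd).
assert (Pe : 0 < p0 (egv j)) by apply eig_p0.
specialize (T a Ha). assert (T2 := changes_newton _ a Hb Ha).
cbn [nodes map snd fst changes] in T2.
destruct (Req_dec_T (a * p0 (egv j)) 0) as [E|_].
{ destruct (Rmult_integral _ _ E); [contradiction|lra]. }
assert (A2 : 0 < a * a) by nra.
rewrite (changes_same _ (a * p0 (egv j)) a) in T2 by nra.
assert (C0 : change a (a * p0 (egv j)) = 0%Z).
{ unfold change. destruct (Rlt_dec _ _); auto. exfalso. nra. }
assert (Cs := change_bounds a s). unfold nodes in *. cbn [map fst snd] in T. lia.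
Qed.

Lemma vec_comb v : v <> vzero -> exists l, descending 6 l /\ l <> [] /\ comb [] l = v.
Proof.
assert (H : forall k v, (k <= 6)%nat -> (forall i, (k <= i <= 5)%nat -> coord i v = 0) ->
   exists l, descending k l /\ comb [] l = v).
{ induction k as [|k IH]; intros w Hk Hw.
  - exists []. split; [exact I|]. symmetry. apply vec_ext. intros i Hi.
    rewrite Hw by lia. destruct i as [|[|[|[|[|i]]]]]; reflexivity.
  - assert (Se : alt k * alt k = 1).
    { unfold alt. rewrite <- Rpow_mult_distr. replace (-1 * -1) with 1 by ring. apply pow1. }
    destruct (Req_dec (coord k w) 0) as [Z|NZ].
    + destruct (IH w) as [l [H1 H2]]; [lia| |].
      * intros i Hi. destruct (Nat.eq_dec i k) as [->|]; [exact Z|]. apply Hw. lia.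
      * exists l. split; auto. destruct l as [|[j a] l]; simpl in *; auto. intuition lia.
    + (* The leading coefficient [alt k] of [egv k] is its own inverse. *)
      destruct (IH (vlin 1 w (- (coord k w * alt k)) (egv k))) as [l [H1 H2]]; [lia| |].
      * intros i Hi. rewrite coord_vlin. destruct (Nat.eq_dec i k) as [->|].
        -- rewrite egv_lead by lia. replace (1 * coord k w + - (coord k w * alt k) * alt k)
             with (coord k w - coord k w * (alt k * alt k)) by ring. rewrite Se. ring.
        -- rewrite egv_degree by lia. rewrite Hw by lia. ring.
      * exists ((k, coord k w * alt k) :: l). split.
        -- simpl. split; [lia|split; auto].
           apply Rmult_integral_contrapositive_currified; auto using alt_neq0.
        -- simpl. rewrite H2. apply vec_ext. intros i _. rewrite !coord_vlin. ring. }
intros Hv. destruct (H 6%nat v ltac:(lia) ltac:(intros; lia)) as [l [H1 H2]].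
exists l. repeat split; auto. intros ->. apply Hv. now rewrite <- H2.
Qed.

Theorem exterior_bound v : v <> vzero -> Zle half_line (form U V v) 5.
Proof.
intros Hv. destruct (vec_comb v Hv) as [l [H1 [H2 <-]]]. now apply comb_bound.
Qed.

End Exterior.

(** * Integrals along an oval *)

Definition pot (A : annulus) (x : R) : R :=
  match A with
  | GlobalCenter => 1/2 * x^2 + 1/4 * x^4
  | TruncatedPendulum => 1/2 * x^2 - 1/4 * x^4
  | _ => - 1/2 * x^2 + 1/4 * x^4
  end.
Definition dpot (A : annulus) (x : R) : R :=
  match A with
  | GlobalCenter => x + x^3
  | TruncatedPendulum => x - x^3
  | _ => - x + x^3
  end.

Lemma Ham_pot A x y : Ham A x y = 1/2 * y^2 + pot A x.
Proof. destruct A; unfold Ham, pot; field. Qed.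

Lemma Ham_dy A x y : Derive (fun v => Ham A x v) y = y.
Proof.
apply is_derive_unique. apply is_derive_ext with (fun v => 1/2 * v^2 + pot A x).
- intros; now rewrite Ham_pot.
- auto_derive; auto. field.
Qed.

Lemma Ham_dx A x y : Derive (fun u => Ham A u y) x = dpot A x.
Proof.
apply is_derive_unique. destruct A; simpl; auto_derive; auto; field.
Qed.

Lemma pot_continuous A x : continuous (pot A) x.
Proof.
apply (@ex_derive_continuous R_AbsRing R_NormedModule).
destruct A; unfold pot; auto_derive; auto.
Qed.

(** [sqrt] is extended by [0] to the negative numbers. *)
Lemma ext_sqrt_continuous x : continuous sqrt x.
Proof.
apply continuity_pt_filterlim. destruct (Rle_lt_dec 0 x) as [H|H].
- now apply continuity_pt_sqrt.
- apply continuity_pt_ext_loc with (fun _ => 0).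
  + exists (mkposreal (- x) ltac:(lra)). intros z Hz. symmetry. apply sqrt_neg_0.
    unfold ball in Hz; simpl in Hz; unfold AbsRing_ball in Hz; simpl in Hz.
    apply Rabs_def2 in Hz. unfold minus, plus, opp in Hz; simpl in Hz. lra.
  + apply continuity_pt_const. intros a b; reflexivity.
Qed.

Definition branch (A : annulus) (h x : R) : R := sqrt (2 * (h - pot A x)).

Lemma branch_continuous A h x : continuous (branch A h) x.
Proof.
unfold branch. apply (continuous_comp (fun x => 2 * (h - pot A x)) sqrt).
- apply (continuous_scal_r 2 (fun x => h - pot A x)).
  apply (continuous_minus (fun _ => h) (pot A)); [apply continuous_const|apply pot_continuous].
- apply ext_sqrt_continuous.
Qed.

Section ClosedParam.
Variables (H : R -> R -> R) (C : R -> R -> Prop) (x y : R -> R) (T : R).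
Hypothesis CP : closed_param H C x y T.

Let T0 : 0 < T := param_period_pos _ _ _ _ _ CP.

Lemma param_shift_nat n t : x (t + INR n * T) = x t /\ y (t + INR n * T) = y t.
Proof.
induction n as [|n [IH1 IH2]]; [simpl; rewrite Rmult_0_l, Rplus_0_r; auto|].
replace (t + INR (S n) * T) with (t + INR n * T + T) by (rewrite S_INR; ring).
destruct (param_periodic _ _ _ _ _ CP (t + INR n * T)) as [-> ->]. auto.
Qed.

Lemma param_reduce t : exists t', 0 <= t' < T /\ x t' = x t /\ y t' = y t.
Proof.
destruct (archimed (t / T)) as [A1 A2]. set (k := (up (t / T) - 1)%Z).
assert (K : 0 <= t - IZR k * T < T).
{ unfold k. rewrite minus_IZR. assert (E : t = t / T * T) by (field; lra). split; nra. }
exists (t - IZR k * T). split; [exact K|].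
destruct (Z_le_gt_dec 0 k) as [P|N].
- assert (E : IZR k = INR (Z.to_nat k)) by (rewrite INR_IZR_INZ, Z2Nat.id; auto).
  destruct (param_shift_nat (Z.to_nat k) (t - IZR k * T)) as [E1 E2].
  rewrite <- E in E1, E2. replace (t - IZR k * T + IZR k * T) with t in E1, E2 by ring. auto.
- assert (E : IZR (- k) = INR (Z.to_nat (- k))) by (rewrite INR_IZR_INZ, Z2Nat.id; auto; lia).
  destruct (param_shift_nat (Z.to_nat (- k)) t) as [E1 E2].
  rewrite <- E, opp_IZR in E1, E2. replace (t - IZR k * T) with (t + - IZR k * T) by ring. auto.
Qed.

(** Injectivity over one period holds for a period starting at any point, here at a
    turning point. *)
Lemma param_inj_shift t0 s u : 0 <= t0 < T -> t0 <= s < t0 + T -> t0 <= u < t0 + T ->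
  x s = x u -> y s = y u -> s = u.
Proof.
intros Ht Hs Hu Ex Ey.
assert (P : forall t, x (t - T) = x t /\ y (t - T) = y t).
{ intros t. destruct (param_periodic _ _ _ _ _ CP (t - T)) as [E1 E2].
  replace (t - T + T) with t in E1, E2 by ring. auto. }
assert (I := param_inj _ _ _ _ _ CP).
destruct (P s) as [Ps1 Ps2]. destruct (P u) as [Pu1 Pu2].
destruct (Rlt_le_dec s T) as [S1|S1], (Rlt_le_dec u T) as [U1|U1].
- apply I; auto; lra.
- assert (s = u - T) by (apply I; try lra; congruence). lra.
- assert (s - T = u) by (apply I; try lra; congruence). lra.
- assert (s - T = u - T) by (apply I; try lra; congruence). lra.
Qed.

Lemma param_Derive_periodic t : Derive x (t + T) = Derive x t.
Proof.
rewrite <- (Derive_ext (fun s => x (s + T)) x t).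
- symmetry. apply is_derive_unique.
  evar_last; [apply (is_derive_comp x (fun s => s + T))|].
  + apply Derive_correct. apply (param_ex_derive _ _ _ _ _ CP).
  + auto_derive; auto.
  + unfold scal; simpl; unfold mult; simpl. ring.
- intros s. apply (param_periodic _ _ _ _ _ CP).
Qed.

Lemma param_x_continuous t : continuous x t.
Proof. apply (@ex_derive_continuous R_AbsRing R_NormedModule). apply (param_ex_derive _ _ _ _ _ CP). Qed.
Lemma param_y_continuous t : continuous y t.
Proof. apply (@ex_derive_continuous R_AbsRing R_NormedModule). apply (param_ex_derive _ _ _ _ _ CP). Qed.
End ClosedParam.

Lemma positive_after_zero f a b : (forall t, ex_derive f t) -> f a = 0 -> 0 < Derive f a ->
  (forall t, a < t < b -> f t <> 0) -> forall t, a < t < b -> 0 < f t.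
Proof.
intros Ef Fa Da Nz t Ht.
assert (Cf : forall t, continuity_pt f t).
{ intros s. apply continuity_pt_filterlim.
  apply (@ex_derive_continuous R_AbsRing R_NormedModule). apply Ef. }
apply Rnot_le_lt. intros N.
assert (Ft : f t < 0). { specialize (Nz t Ht). lra. }
assert (D : is_derive f a (Derive f a)) by (apply Derive_correct, Ef).
apply is_derive_Reals in D. destruct (D (Derive f a / 2)) as [d Hd]; [lra|].
pose (e := Rmin (t - a) d / 2).
assert (d0 := cond_pos d).
assert (He : 0 < e < d /\ a + e < t).
{ unfold e, Rmin; destruct (Rle_dec (t - a) d); lra. }
specialize (Hd e ltac:(lra) ltac:(rewrite Rabs_right; lra)).
rewrite Fa in Hd. apply Rabs_def2 in Hd.
assert (0 < (f (a + e) - 0) / e) by lra.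
assert (Fe : 0 < f (a + e)).
{ replace (f (a + e)) with ((f (a + e) - 0) / e * e) by (field; lra).
  apply Rmult_lt_0_compat; lra. }
destruct (IVT_between f (a + e) t) as [c [Hc Fc]]; [intros; apply Cf|lra|nra|].
apply (Nz c); auto. lra.
Qed.

Section TurningPoints.
Variables (A : annulus) (h xm xM : R).
Hypothesis oval_xm : oval A h xm 0.
Hypothesis oval_xM : oval A h xM 0.
Hypothesis xm_xM : xm <> xM.
Hypothesis oval_axis : forall x, oval A h x 0 -> x = xm \/ x = xM.
Hypothesis dpot_xm : dpot A xm < 0.
Hypothesis dpot_xM : 0 < dpot A xM.

(** Between two turning points the ordinate keeps its sign, and the orientation determines
    it: the parametrization goes from [xm] to [xM] along the upper branch and comes back
    along the lower one. Both halves contribute the same integral. *)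
Lemma oval_integral_value P f v : (forall x y, P x y = f x * y) ->
  (forall x, continuous f x) -> is_oval_integral A P h v ->
  v = 2 * RInt (fun x => f x * branch A h x) xm xM.
Proof.
intros HP Cf [x [y [T [CP HI]]]].
assert (T0 := param_period_pos _ _ _ _ _ CP).
assert (On : forall t, oval A h (x t) (y t)).
{ intros t. apply (param_image _ _ _ _ _ CP). now exists t. }
assert (Ex : forall t, ex_derive x t) by (intros t; apply (param_ex_derive _ _ _ _ _ CP)).
assert (Ey : forall t, ex_derive y t) by (intros t; apply (param_ex_derive _ _ _ _ _ CP)).
assert (Dy : forall t, y t = 0 -> 0 < - Derive y t * dpot A (x t)).
{ intros t E. assert (O := param_orient _ _ _ _ _ CP t).
  rewrite Ham_dy, Ham_dx, E in O. lra. }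
assert (E0 : exists t0, 0 <= t0 < T /\ x t0 = xm /\ y t0 = 0).
{ destruct (proj1 (param_image _ _ _ _ _ CP xm 0) oval_xm) as [t [E1 E2]].
  destruct (param_reduce _ _ _ _ _ CP t) as [t0 [Ht [E3 E4]]].
  exists t0. repeat split; try lra; congruence. }
destruct E0 as [t0 [Ht0 [x0 y0]]].
assert (E1 : exists t1, t0 < t1 < t0 + T /\ x t1 = xM /\ y t1 = 0).
{ destruct (proj1 (param_image _ _ _ _ _ CP xM 0) oval_xM) as [t [E1 E2]].
  destruct (param_reduce _ _ _ _ _ CP t) as [t1 [Ht [E3 E4]]].
  destruct (Rtotal_order t0 t1) as [L|[L|L]].
  - exists t1. repeat split; try lra; congruence.
  - exfalso. apply xm_xM. congruence.
  - destruct (param_periodic _ _ _ _ _ CP t1) as [P1 P2].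
    exists (t1 + T). repeat split; try lra; congruence. }
destruct E1 as [t1 [Ht1 [x1 y1]]].
assert (N0 : forall t, t0 < t < t0 + T -> t <> t1 -> y t <> 0).
{ intros t Ht Hne E. assert (O := On t). rewrite E in O.
  destruct (oval_axis _ O) as [Em|EM].
  - assert (t = t0); [|lra]. apply (param_inj_shift _ _ _ _ _ CP t0); try lra; congruence.
  - apply Hne. apply (param_inj_shift _ _ _ _ _ CP t0); try lra; congruence. }
assert (Up : forall t, t0 < t < t1 -> 0 < y t).
{ apply positive_after_zero; auto.
  - specialize (Dy t0 y0). rewrite x0 in Dy. nra.
  - intros t Ht. apply N0; lra. }
assert (Dn : forall t, t1 < t < t0 + T -> y t < 0).
{ intros t Ht. assert (0 < - y t); [|lra].
  assert (Eo : forall s, ex_derive (fun t => - y t) s).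
  { intros s. apply (@ex_derive_opp R_AbsRing R_NormedModule). apply Ey. }
  assert (Zo : - y t1 = 0) by lra.
  assert (Do : 0 < Derive (fun t => - y t) t1).
  { rewrite Derive_opp. specialize (Dy t1 y1). rewrite x1 in Dy. nra. }
  apply (positive_after_zero (fun t => - y t) t1 (t0 + T) Eo Zo Do); [|exact Ht].
  intros s Hs. assert (y s <> 0) by (apply N0; lra). lra. }
assert (yT : y (t0 + T) = 0) by (rewrite <- y0; apply (param_periodic _ _ _ _ _ CP)).
assert (xT : x (t0 + T) = xm) by (rewrite <- x0; apply (param_periodic _ _ _ _ _ CP)).
assert (Sq : forall t, 2 * (h - pot A (x t)) = y t * y t).
{ intros t. destruct (On t) as [E _]. rewrite Ham_pot in E. rewrite <- E. field. }
assert (BrU : forall t, t0 <= t <= t1 -> y t = branch A h (x t)).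
{ intros t Ht. unfold branch. rewrite Sq. rewrite sqrt_square; auto.
  destruct (Req_dec t t0) as [->|]; [lra|]. destruct (Req_dec t t1) as [->|]; [lra|].
  apply Rlt_le, Up. lra. }
assert (BrD : forall t, t1 <= t <= t0 + T -> y t = - branch A h (x t)).
{ intros t Ht. unfold branch. rewrite Sq. replace (y t * y t) with ((- y t) * (- y t)) by ring.
  rewrite sqrt_square; [ring|].
  destruct (Req_dec t t1) as [->|]; [lra|]. destruct (Req_dec t (t0 + T)) as [->|]; [lra|].
  assert (y t < 0) by (apply Dn; lra). lra. }
set (phi := fun t => P (x t) (y t) * Derive x t) in HI.
assert (Cx := param_x_continuous _ _ _ _ _ CP).
assert (Cy := param_y_continuous _ _ _ _ _ CP).
assert (Cphi : forall t, continuous phi t).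
{ intros t. apply continuous_ext with (fun t => f (x t) * y t * Derive x t).
  - intros s. unfold phi. now rewrite HP.
  - apply (continuous_mult (fun t => f (x t) * y t) (Derive x)).
    + apply (continuous_mult (fun t => f (x t)) y); auto. apply (continuous_comp x f); auto.
    + exact (proj1 (param_C1 _ _ _ _ _ CP t)). }
assert (Iphi : forall a b, ex_RInt phi a b) by (intros; now apply (@ex_RInt_continuous R_CompleteNormedModule)).
rewrite <- (is_RInt_unique _ _ _ _ HI).
assert (Shift : RInt phi 0 T = RInt phi t0 (t0 + T)).
{ rewrite <- (RInt_Chasles phi 0 t0 T) by auto.
  rewrite <- (RInt_Chasles phi t0 T (t0 + T)) by auto.
  assert (E : RInt phi T (t0 + T) = RInt phi 0 t0).
  { replace T with (1 * 0 + T) at 1 by ring. replace (t0 + T) with (1 * t0 + T) by ring.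
    rewrite <- (RInt_comp_lin phi 1 T 0 t0) by auto.
    apply RInt_ext. intros t _. unfold scal; simpl; unfold mult; simpl.
    rewrite !Rmult_1_l. unfold phi. rewrite (param_Derive_periodic _ _ _ _ _ CP).
    destruct (param_periodic _ _ _ _ _ CP t) as [-> ->]. reflexivity. }
  rewrite E. unfold plus; simpl. ring. }
rewrite Shift, <- (RInt_Chasles phi t0 t1 (t0 + T)) by auto.
set (F := fun z => f z * branch A h z).
assert (CF : forall z, continuous F z).
{ intros z. apply (continuous_mult f (branch A h)); auto using branch_continuous. }
assert (Sub : forall a b, RInt (fun t => scal (Derive x t) (F (x t))) a b = RInt F (x a) (x b)).
{ intros a b. apply (RInt_comp F x (Derive x) a b); [intros; apply CF|]. intros t _. split; [now apply Derive_correct|].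
  exact (proj1 (param_C1 _ _ _ _ _ CP t)). }
assert (S1 : RInt phi t0 t1 = RInt F xm xM).
{ rewrite <- x0, <- x1, <- Sub. apply RInt_ext. intros t Ht.
  rewrite Rmin_left, Rmax_right in Ht by lra. unfold phi, F. rewrite HP.
  rewrite (BrU t) by lra. unfold scal; simpl; unfold mult; simpl. ring. }
assert (S2 : RInt phi t1 (t0 + T) = RInt F xm xM).
{ rewrite <- (opp_RInt_swap F) by (now apply (@ex_RInt_continuous R_CompleteNormedModule)).
  rewrite <- x1 at 1. rewrite <- xT, <- Sub.
  rewrite <- RInt_opp.
  - apply RInt_ext. intros t Ht.
    rewrite Rmin_left, Rmax_right in Ht by lra. unfold phi, F. rewrite HP.
    rewrite (BrD t) by lra. unfold scal, opp; simpl; unfold mult; simpl. ring.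
  - apply (@ex_RInt_continuous R_CompleteNormedModule). intros t _.
    apply (continuous_mult (Derive x) (fun t => F (x t))).
    + exact (proj1 (param_C1 _ _ _ _ _ CP t)).
    + apply (continuous_comp x F); auto. }
rewrite S1, S2. change (RInt F xm xM + RInt F xm xM = 2 * RInt F xm xM). ring.
Qed.
End TurningPoints.

(** * Integrals depending on a parameter *)

Lemma continuous_RInt_ex (f : R -> R) a b : (forall x, continuous f x) -> ex_RInt f a b.
Proof. intros H. apply (@ex_RInt_continuous R_CompleteNormedModule). intros; apply H. Qed.

Lemma param_derive (w q e psi dpsi : R -> R) (al be x : R) :
  (forall t, continuous w t) -> (forall t, continuous q t) -> (forall t, continuous e t) ->
  (forall y, 0 < y -> is_derive psi y (dpsi y)) -> (forall y, 0 < y -> continuous dpsi y) ->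
  locally x (fun u => forall t, 0 < e t + u * q t) ->
  is_derive (fun u => RInt (fun t => w t * psi (e t + u * q t)) al be) x
    (RInt (fun t => w t * q t * dpsi (e t + x * q t)) al be).
Proof.
intros Cw Cq Ce Dpsi Cdpsi Pos.
assert (D : forall u t, 0 < e t + u * q t ->
  is_derive (fun z => w t * psi (e t + z * q t)) u (w t * q t * dpsi (e t + u * q t))).
{ intros u t Ht.
  evar_last; [apply is_derive_scal; apply (is_derive_comp psi (fun z => e t + z * q t))|].
  - now apply Dpsi.
  - auto_derive; auto.
  - unfold scal; simpl; unfold mult; simpl. ring. }
assert (Px : forall t, 0 < e t + x * q t) by (apply (locally_singleton _ _ Pos)).
rewrite (RInt_ext _ (fun t => Derive (fun z => w t * psi (e t + z * q t)) x)).
2: { intros t _. symmetry. apply is_derive_unique. now apply D. }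
apply is_derive_RInt_param.
- generalize Pos. apply filter_imp. intros u Hu t _. eexists. apply D. apply Hu.
- intros t _.
  apply continuity_2d_pt_ext_loc with (fun u v => w v * q v * dpsi (e v + u * q v)).
  + destruct Pos as [d Hd]. exists d. intros u v Hu _. symmetry.
    apply is_derive_unique. apply D. now apply Hd.
  + apply continuity_2d_pt_filterlim.
    change (continuous (fun z : R * R => w (snd z) * q (snd z) * dpsi (e (snd z) + fst z * q (snd z))) (x, t)).
    assert (S : forall f : R -> R, (forall y, continuous f y) ->
      continuous (fun z : R * R => f (snd z)) (x, t)).
    { intros f Cf. apply (continuous_comp snd f); [apply continuous_snd|apply Cf]. }
    apply (continuous_mult (fun z : R * R => w (snd z) * q (snd z))).
    * apply (continuous_mult (fun z : R * R => w (snd z))); auto.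
    * apply (continuous_comp (fun z : R * R => e (snd z) + fst z * q (snd z)) dpsi).
      -- apply (continuous_plus (fun z : R * R => e (snd z))); auto.
         apply (continuous_mult (fun z : R * R => fst z)); auto. apply continuous_fst.
      -- apply Cdpsi. apply Px.
- generalize Pos. apply filter_imp. intros u Hu. apply continuous_RInt_ex. intros t.
  apply (continuous_mult w); auto. apply (continuous_comp (fun t => e t + u * q t) psi).
  + apply (continuous_plus e); auto. apply (continuous_mult (fun _ => u)); auto. apply continuous_const.
  + apply (@ex_derive_continuous R_AbsRing R_NormedModule). eexists. apply Dpsi. apply Hu.
Qed.

Lemma sqrt_is_derive y : 0 < y -> is_derive sqrt y (/ (2 * sqrt y)).
Proof. intros H. apply is_derive_Reals. now apply derivable_pt_lim_sqrt. Qed.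

Lemma inv_sqrt_continuous y : 0 < y -> continuous (fun y => / sqrt y) y.
Proof.
intros H. apply (continuous_comp sqrt Rinv).
- apply ext_sqrt_continuous.
- apply continuous_Rinv. assert (0 < sqrt y) by now apply sqrt_lt_R0. lra.
Qed.

Lemma dsqrt_continuous y : 0 < y -> continuous (fun y => / (2 * sqrt y)) y.
Proof.
intros H. apply (continuous_comp (fun y => 2 * sqrt y) Rinv).
- apply (continuous_scal_r 2 sqrt). apply ext_sqrt_continuous.
- apply continuous_Rinv. assert (0 < sqrt y) by now apply sqrt_lt_R0. lra.
Qed.

Lemma RInt_lin3 (f1 f2 f3 g : R -> R) c1 c2 c3 a b :
  (forall x, continuous f1 x) -> (forall x, continuous f2 x) -> (forall x, continuous f3 x) ->
  (forall x, g x = c1 * f1 x + c2 * f2 x + c3 * f3 x) ->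
  RInt g a b = c1 * RInt f1 a b + c2 * RInt f2 a b + c3 * RInt f3 a b.
Proof.
intros H1 H2 H3 Hg. apply is_RInt_unique.
apply is_RInt_ext with (fun x => c1 * f1 x + c2 * f2 x + c3 * f3 x); [intros; auto|].
apply @is_RInt_plus; [apply @is_RInt_plus|]; apply @is_RInt_scal; apply @RInt_correct;
  now apply continuous_RInt_ex.
Qed.

Lemma RInt_exact (G g : R -> R) a b : (forall x, is_derive G x (g x)) ->
  (forall x, continuous g x) -> G a = G b -> RInt g a b = 0.
Proof.
intros D C E. apply is_RInt_unique.
replace 0 with (minus (G b) (G a)) by (rewrite E; apply Rminus_diag).
apply @is_RInt_derive; auto.
Qed.

Lemma RInt_bounds (f : R -> R) a b m M : a <= b -> (forall x, continuous f x) ->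
  (forall x, m <= f x <= M) -> m * (b - a) <= RInt f a b <= M * (b - a).
Proof.
intros L C H. assert (E := continuous_RInt_ex f a b C).
assert (K : forall c, RInt (fun _ : R => c) a b = c * (b - a)).
{ intros c. rewrite RInt_const. unfold scal; simpl; unfold mult; simpl. ring. }
rewrite <- (K m), <- (K M). split; apply RInt_le; auto.
- apply ex_RInt_const.
- intros x _. apply H.
- apply ex_RInt_const.
- intros x _. apply H.
Qed.

(** * Half-period moments *)

(** After a trigonometric substitution all the integrals are taken over half a period and
    contain the square root of a radicand that is affine in the parameter [p]. *)
Definition moment (a : R) (q w : R -> R) (p : R) : R :=
  RInt (fun t => w t * sqrt (a + p * q t)) (- (PI / 2)) (PI / 2).
Definition imoment (a : R) (q w : R -> R) (p : R) : R :=
  RInt (fun t => w t * / sqrt (a + p * q t)) (- (PI / 2)) (PI / 2).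

Lemma half_period : - (PI / 2) <= PI / 2.
Proof. assert (H := PI_RGT_0). lra. Qed.

Section Moments.
Variables (a : R) (q : R -> R) (p : R).
Hypothesis q_continuous : forall t, continuous q t.
Hypothesis E_pos : forall t, 0 < a + p * q t.

Lemma radicand_continuous t : continuous (fun t => a + p * q t) t.
Proof.
apply (continuous_plus (fun _ => a)); [apply continuous_const|].
apply (continuous_mult (fun _ => p)); auto. apply continuous_const.
Qed.

Lemma moment_integrand_continuous w : (forall t, continuous w t) ->
  forall t, continuous (fun t => w t * sqrt (a + p * q t)) t.
Proof.
intros C t. apply (continuous_mult w); auto.
apply (continuous_comp (fun t => a + p * q t) sqrt).
- apply radicand_continuous.
- apply ext_sqrt_continuous.
Qed.

Lemma imoment_integrand_continuous w : (forall t, continuous w t) ->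
  forall t, continuous (fun t => w t * / sqrt (a + p * q t)) t.
Proof.
intros C t. apply (continuous_mult w); auto.
apply (continuous_comp (fun t => a + p * q t) (fun y => / sqrt y)).
- apply radicand_continuous.
- now apply inv_sqrt_continuous.
Qed.

Lemma moment_imoment (w : R -> R) :
  moment a q w p = imoment a q (fun t => w t * (a + p * q t)) p.
Proof.
unfold moment, imoment. apply RInt_ext. intros t _.
assert (0 < sqrt (a + p * q t)) by now apply sqrt_lt_R0.
assert (S : sqrt (a + p * q t) * sqrt (a + p * q t) = a + p * q t)
  by (apply sqrt_sqrt; now apply Rlt_le).
change (w t * sqrt (a + p * q t) = w t * (a + p * q t) * / sqrt (a + p * q t)).
rewrite <- S at 2. field. lra.
Qed.

Lemma imoment_lin (w1 w2 w3 w : R -> R) (c1 c2 c3 : R) : (forall t, continuous w1 t) ->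
  (forall t, continuous w2 t) -> (forall t, continuous w3 t) ->
  (forall t, w t = c1 * w1 t + c2 * w2 t + c3 * w3 t) ->
  imoment a q w p = c1 * imoment a q w1 p + c2 * imoment a q w2 p + c3 * imoment a q w3 p.
Proof.
intros C1 C2 C3 Hw. apply RInt_lin3; try (now apply imoment_integrand_continuous).
intros t. rewrite Hw. ring.
Qed.

(** The integrand is the derivative of [g sqrt (a + p q)]. All the relations between the
    integrals come from such exact derivatives. *)
Lemma imoment_exact (g dg dq w : R -> R) : (forall t, is_derive g t (dg t)) ->
  (forall t, is_derive q t (dq t)) -> (forall t, continuous w t) ->
  g (- (PI / 2)) = 0 -> g (PI / 2) = 0 ->
  (forall t, w t = dg t * (a + p * q t) + g t * (p * dq t) / 2) ->
  imoment a q w p = 0.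
Proof.
intros Dg Dq Cw G1 G2 Hw. unfold imoment.
apply (RInt_exact (fun t => g t * sqrt (a + p * q t))).
- intros t. assert (0 < sqrt (a + p * q t)) by now apply sqrt_lt_R0.
  assert (S : sqrt (a + p * q t) * sqrt (a + p * q t) = a + p * q t)
    by (apply sqrt_sqrt; now apply Rlt_le).
  evar_last.
  + apply (is_derive_mult g (fun t => sqrt (a + p * q t))); [apply Dg| |intros; apply Rmult_comm].
    apply (is_derive_comp sqrt (fun t => a + p * q t)); [now apply sqrt_is_derive|].
    apply (is_derive_plus (fun _ => a)); [apply @is_derive_const|].
    apply (is_derive_scal q). apply Dq.
  + unfold plus, mult, scal, zero; simpl. unfold mult; simpl. rewrite Hw.
    rewrite <- S at 3. field. lra.
- now apply imoment_integrand_continuous.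
- now rewrite G1, G2, !Rmult_0_l.
Qed.

Lemma moment_derive (w : R -> R) : (forall t, continuous w t) ->
  locally p (fun u => forall t, 0 < a + u * q t) ->
  is_derive (moment a q w) p (imoment a q (fun t => w t * q t / 2) p).
Proof.
intros Cw L. evar_last.
- apply (param_derive w q (fun _ => a) sqrt (fun y => / (2 * sqrt y))); auto.
  + intros; apply continuous_const.
  + intros; now apply sqrt_is_derive.
  + intros; now apply dsqrt_continuous.
- unfold imoment. apply RInt_ext. intros t _.
  assert (0 < sqrt (a + p * q t)) by now apply sqrt_lt_R0.
  change (w t * q t * / (2 * sqrt (a + p * q t)) = w t * q t / 2 * / sqrt (a + p * q t)).
  field. lra.
Qed.
End Moments.

Ltac trig_continuous := intros ?t; apply (@ex_derive_continuous R_AbsRing R_NormedModule);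
  auto_derive; auto.
Lemma cos_sqr t : cos t * cos t = 1 - sin t * sin t.
Proof. generalize (sin2_cos2 t). unfold Rsqr. lra. Qed.

(** * Moments along the ovals around the origin *)

(** The substitution [x = sqrt p sin t] in the potential [a x^2 / 2 + b x^4 / 4] with the
    turning points [x^2 = p] gives the radicand [a + p * qsym t]. The functions [SI0], [SI2]
    are the integrals of [y dx], [x^2 y dx], and [SK0], [SK1] those of [dx / y],
    [x^2 dx / y]. *)
Section Symmetric.
Variables (a b : R).
Hypothesis a2 : a * a = 1.
Hypothesis b2 : b * b = 1.

Definition qsym (t : R) : R := b * (1 + sin t * sin t) / 2.
Definition dqsym (t : R) : R := b * sin t * cos t.

Definition SI0 (p : R) : R := 2 * p * moment a qsym (fun t => cos t * cos t) p.
Definition SI2 (p : R) : R :=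
  2 * p * p * moment a qsym (fun t => sin t * sin t * (cos t * cos t)) p.
Definition SK0 (p : R) : R := 2 * imoment a qsym (fun _ => 1) p.
Definition SK1 (p : R) : R := 2 * p * imoment a qsym (fun t => sin t * sin t) p.

Lemma qsym_derive t : is_derive qsym t (dqsym t).
Proof. unfold qsym, dqsym. auto_derive; auto. field. Qed.
Lemma qsym_continuous t : continuous qsym t.
Proof. revert t. unfold qsym. trig_continuous. Qed.

Variable p : R.
Hypothesis E_near : locally p (fun u => forall t, 0 < a + u * qsym t).
Let E_pos : forall t, 0 < a + p * qsym t := locally_singleton _ _ E_near.
Let h := a * p / 2 + b * p * p / 4.
Let iM w := imoment a qsym w p.
Let E t := a + p * qsym t.

(** A multiple of [d (x y)]. *)
Lemma exact1 : iM (fun t => (1 - 2 * (sin t * sin t)) * E t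
  + (p * b) * (sin t * sin t) * (1 - sin t * sin t) / 2) = 0.
Proof.
unfold iM. apply (imoment_exact a qsym p qsym_continuous E_pos (fun t => sin t * cos t)
  (fun t => cos t * cos t - sin t * sin t) dqsym).
- intros t. auto_derive; auto. ring.
- apply qsym_derive.
- unfold E, qsym. trig_continuous.
- rewrite cos_neg, cos_PI2. ring.
- rewrite cos_PI2. ring.
- intros t. unfold E, dqsym, qsym. field [(cos_sqr t)].
Qed.

(** A multiple of [d (x^3 y)]. *)
Lemma exact3 : iM (fun t => sin t * sin t * (3 - 4 * (sin t * sin t)) * E t
  + (p * b) * (sin t * sin t) * (sin t * sin t) * (1 - sin t * sin t) / 2) = 0.
Proof.
unfold iM. apply (imoment_exact a qsym p qsym_continuous E_pos (fun t => sin t * sin t * sin t * cos t)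
  (fun t => sin t * sin t * (3 * (cos t * cos t) - sin t * sin t)) dqsym).
- intros t. auto_derive; auto. ring.
- apply qsym_derive.
- unfold E, qsym. trig_continuous.
- rewrite cos_neg, cos_PI2. ring.
- rewrite cos_PI2. ring.
- intros t. unfold E, dqsym, qsym. field [(cos_sqr t)].
Qed.

Lemma SI0_relation : 3 * SI0 p = 4 * h * SK0 p - a * SK1 p.
Proof.
unfold SI0, SK0, SK1. rewrite (moment_imoment a qsym p E_pos). fold E.
assert (X := exact1). unfold iM in X.
rewrite (imoment_lin a qsym p qsym_continuous E_pos
  (fun t => cos t * cos t * E t) (fun _ => 1) (fun t => sin t * sin t)
  _ 3 (- (a * 2 + b * p)) a) in X; try (unfold E, qsym; trig_continuous).
- unfold h. unfold E in X |- *.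
  match type of X with _ * ?x + _ * ?y + _ * ?z = _ =>
    transitivity (2 * p * (3 * x + - (a * 2 + b * p) * y + a * z)
      + 2 * p * (2 * a + b * p) * y - 2 * a * p * z); [ring|rewrite X; field] end.
- intros t. unfold E, qsym. field [(cos_sqr t)].
Qed.

Lemma SI2_relation : 5 * SI2 p = (4 * h + b) * SK1 p - a * b * SI0 p.
Proof.
unfold SI0, SI2, SK1. rewrite !(moment_imoment a qsym p E_pos). fold E.
pose (w := fun t => 5 * p * (sin t * sin t * (cos t * cos t) * E t)
  + a * b * (cos t * cos t * E t) - (p * (2 * a + b * p) + b) * (sin t * sin t)).
assert (X : iM w = 5 * p * iM (fun t => sin t * sin t * (cos t * cos t) * E t)
  + a * b * iM (fun t => cos t * cos t * E t)
  + - (p * (2 * a + b * p) + b) * iM (fun t => sin t * sin t)).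
{ unfold iM. apply (imoment_lin a qsym p qsym_continuous E_pos); unfold E, qsym; try trig_continuous.
  intros t. unfold w, E, qsym. ring. }
assert (Y : iM w = p * 0 + a * b * 0 + 0 * 0).
{ rewrite <- exact3 at 1. rewrite <- exact1 at 1. rewrite <- exact1 at 2.
  unfold iM. apply (imoment_lin a qsym p qsym_continuous E_pos); unfold E, qsym; try trig_continuous.
  intros t. unfold w, E, qsym. field [a2 b2 (cos_sqr t)]. }
rewrite X in Y. unfold iM, E in Y |- *.
match type of Y with _ * ?x + _ * ?y + _ * ?z = _ =>
  transitivity (2 * p * ((5 * p * x + a * b * y + - (p * (2 * a + b * p) + b) * z)
    - a * b * y + (p * (2 * a + b * p) + b) * z)); [ring|] end.
rewrite Y. unfold h. field.
Qed.

(** The factor is the derivative of the energy with respect to [p]. Differentiation under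
    the integral sign gives [SK0] up to a multiple of [d (x y)], because the points of
    the oval move also horizontally. *)
Lemma SI0_derive : is_derive SI0 p ((a + b * p) / 2 * SK0 p).
Proof.
unfold SI0. evar_last.
- apply (is_derive_mult (fun p => 2 * p) (moment a qsym (fun t => cos t * cos t)));
    [| |intros; apply Rmult_comm].
  + auto_derive; auto.
  + apply (moment_derive a qsym p qsym_continuous E_pos); [trig_continuous|exact E_near].
- unfold plus, mult; simpl. rewrite (moment_imoment a qsym p E_pos). fold E.
  assert (X := exact1). unfold iM in X.
  rewrite (imoment_lin a qsym p qsym_continuous E_pos
    (fun t => cos t * cos t * E t) (fun t => cos t * cos t * qsym t / 2) (fun _ => 1)
    _ 2 (2 * p) (- (a + b * p))) in X; try (unfold E, qsym; trig_continuous).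
  + unfold SK0. unfold E in X |- *.
    match type of X with _ * ?x + _ * ?y + _ * ?z = _ =>
      transitivity ((2 * x + 2 * p * y + - (a + b * p) * z) + (a + b * p) * z);
      [ring|rewrite X; field] end.
  + intros t. unfold E, qsym. field [(cos_sqr t)].
Qed.

Lemma SI2_derive : is_derive SI2 p ((a + b * p) / 2 * SK1 p).
Proof.
unfold SI2. evar_last.
- apply (is_derive_mult (fun p => 2 * p * p)
    (moment a qsym (fun t => sin t * sin t * (cos t * cos t)))); [| |intros; apply Rmult_comm].
  + auto_derive; auto.
  + apply (moment_derive a qsym p qsym_continuous E_pos); [trig_continuous|exact E_near].
- unfold plus, mult; simpl. rewrite (moment_imoment a qsym p E_pos). fold E.
  assert (X := exact3). unfold iM in X.
  rewrite (imoment_lin a qsym p qsym_continuous E_pos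
    (fun t => sin t * sin t * (cos t * cos t) * E t)
    (fun t => sin t * sin t * (cos t * cos t) * qsym t / 2) (fun t => sin t * sin t)
    _ 4 (2 * p) (- (a + b * p))) in X; try (unfold E, qsym; trig_continuous).
  + unfold SK1. unfold E in X |- *.
    match type of X with _ * ?x + _ * ?y + _ * ?z = _ =>
      transitivity (p * (4 * x + 2 * p * y + - (a + b * p) * z) + p * (a + b * p) * z);
      [ring|rewrite X; field] end.
  + intros t. unfold E, qsym. field [(cos_sqr t)].
Qed.
End Symmetric.

(** * Moments along the ovals around a lateral center *)

(** The substitution [x^2 = 1 + u sg sin t], with [sg = 1] on the right oval and [sg = -1]
    on the left one; the energy is [(u^2 - 1) / 4]. *)
Section Lateral.
Variable sg : R.
Hypothesis sg2 : sg * sg = 1.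

Definition qlat (t : R) : R := sg * sin t.
Definition dqlat (t : R) : R := sg * cos t.

Definition NI0 (u : R) : R := sqrt 2 * u * moment 1 qlat qlat u.
Definition NI2 (u : R) : R := sqrt 2 / 2 * u * u * moment 1 qlat (fun t => cos t * cos t) u.
Definition NK0 (u : R) : R := sqrt 2 * imoment 1 qlat (fun _ => 1) u.
Definition NK1 (u : R) : R := sqrt 2 * moment 1 qlat (fun _ => 1) u.

Lemma qlat_derive t : is_derive qlat t (dqlat t).
Proof. unfold qlat, dqlat. auto_derive; auto. ring. Qed.
Lemma qlat_continuous t : continuous qlat t.
Proof. revert t. unfold qlat. trig_continuous. Qed.
Lemma qlat_bound t : -1 <= qlat t <= 1.
Proof.
unfold qlat. assert (B := SIN_bound t). assert (S : (sg - 1) * (sg + 1) = 0) by lra.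
apply Rmult_integral in S. destruct S; [replace sg with 1 by lra|replace sg with (-1) by lra]; lra.
Qed.

Variable u : R.
Hypothesis u_lt_1 : 0 < u < 1.
Let E_pos t : 0 < 1 + u * qlat t.
Proof. assert (B := qlat_bound t). nra. Qed.
Let E_near : locally u (fun v => forall t, 0 < 1 + v * qlat t).
Proof.
apply (locally_interval _ u 0 1); try (simpl; lra). intros v V0 V1 t. simpl in V0, V1.
assert (B := qlat_bound t). nra.
Qed.
Let iM w := imoment 1 qlat w u.
Let E t := 1 + u * qlat t.

(** A multiple of [d (x cos t)], which is proportional to [d (x y)]. *)
Lemma exactA : iM (fun t => - qlat t * E t + u * (cos t * cos t) / 2) = 0.
Proof.
unfold iM. apply (imoment_exact 1 qlat u qlat_continuous E_pos (fun t => sg * cos t)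
  (fun t => - sg * sin t) dqlat).
- intros t. auto_derive; auto. ring.
- apply qlat_derive.
- unfold E, qlat. trig_continuous.
- rewrite cos_neg, cos_PI2. ring.
- rewrite cos_PI2. ring.
- intros t. unfold E, dqlat, qlat. field [sg2].
Qed.

Lemma exactB : iM (fun t => (1 - 2 * (sin t * sin t)) * E t
  + u * qlat t * (1 - sin t * sin t) / 2) = 0.
Proof.
unfold iM. apply (imoment_exact 1 qlat u qlat_continuous E_pos (fun t => sin t * cos t)
  (fun t => cos t * cos t - sin t * sin t) dqlat).
- intros t. auto_derive; auto. ring.
- apply qlat_derive.
- unfold E, qlat. trig_continuous.
- rewrite cos_neg, cos_PI2. ring.
- rewrite cos_PI2. ring.
- intros t. unfold E, dqlat, qlat. field [(cos_sqr t)].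
Qed.

(** Integration by parts: [NI0] is minus the integral of [x dy], which is simpler to
    differentiate. *)
Lemma NI0_parts : NI0 u = sqrt 2 / 2 * u * u * iM (fun t => cos t * cos t).
Proof.
unfold NI0. rewrite (moment_imoment 1 qlat u E_pos). fold E.
assert (X := exactA). unfold iM in X |- *.
rewrite (imoment_lin 1 qlat u qlat_continuous E_pos
  (fun t => qlat t * E t) (fun t => cos t * cos t) (fun _ => 0) _ (-1) (u / 2) 0) in X;
  try (unfold E, qlat; trig_continuous).
- fold qlat. unfold E in X.
  match type of X with _ * ?x + _ * ?y + _ * ?z = _ =>
    transitivity (- sqrt 2 * u * (-1 * x + u / 2 * y + 0 * z) + sqrt 2 / 2 * u * u * y);
    [field|rewrite X; ring] end.
- intros t. field.
Qed.

Lemma NI0_relation : 3 * NI0 u = (u * u - 1) * NK0 u + NK1 u.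
Proof.
unfold NI0, NK0, NK1. rewrite !(moment_imoment 1 qlat u E_pos). fold E.
assert (X2 : 3 * u * imoment 1 qlat (fun t => qlat t * E t) u
  + - (u * u - 1) * imoment 1 qlat (fun t => 1) u + (-1) * imoment 1 qlat (fun t => 1 * E t) u
   = - 2 * u * iM (fun t => - qlat t * E t + u * (cos t * cos t) / 2)
    + 0 * iM (fun _ => 0) + 0 * iM (fun _ => 0)).
{ unfold iM. pose (w := fun t => 3 * u * (qlat t * E t) - (u * u - 1) - E t).
  rewrite <- (imoment_lin 1 qlat u qlat_continuous E_pos _ _ _ w);
    try (unfold E, qlat; trig_continuous).
  - apply (imoment_lin 1 qlat u qlat_continuous E_pos); try (unfold E, qlat; trig_continuous).
    intros t. unfold w, E, qlat. field [sg2 (cos_sqr t)].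
  - intros t. unfold w. ring. }
rewrite exactA in X2. unfold E in X2 |- *.
match type of X2 with _ * ?x + _ * ?y + _ * ?z = _ =>
  transitivity (sqrt 2 * (3 * u * x + - (u * u - 1) * y + (-1) * z)
    + (u * u - 1) * (sqrt 2 * y) + sqrt 2 * z); [ring|] end.
rewrite X2. ring.
Qed.

Lemma NI2_relation : 5 * NI2 u = u * u * NK1 u + NI0 u.
Proof.
unfold NI0, NI2, NK1. rewrite !(moment_imoment 1 qlat u E_pos). fold E.
assert (X2 : 5 / 2 * u * imoment 1 qlat (fun t => cos t * cos t * E t) u
  + - u * imoment 1 qlat (fun t => 1 * E t) u + (-1) * imoment 1 qlat (fun t => qlat t * E t) u
   = u * iM (fun t => (1 - 2 * (sin t * sin t)) * E t + u * qlat t * (1 - sin t * sin t) / 2)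
    + 1 * iM (fun t => - qlat t * E t + u * (cos t * cos t) / 2) + 0 * iM (fun _ => 0)).
{ unfold iM. pose (w := fun t => 5 / 2 * u * (cos t * cos t * E t) - u * E t - qlat t * E t).
  rewrite <- (imoment_lin 1 qlat u qlat_continuous E_pos _ _ _ w);
    try (unfold E, qlat; trig_continuous).
  - apply (imoment_lin 1 qlat u qlat_continuous E_pos); try (unfold E, qlat; trig_continuous).
    intros t. unfold w, E, qlat. field [sg2 (cos_sqr t)].
  - intros t. unfold w. ring. }
rewrite exactA, exactB in X2.
unfold E in X2 |- *.
match type of X2 with _ * ?x + _ * ?y + _ * ?z = _ =>
  transitivity (sqrt 2 * u * (5 / 2 * u * x + - u * y + (-1) * z)
    + u * u * (sqrt 2 * y) + sqrt 2 * u * z); [field|] end.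
rewrite X2. ring.
Qed.

Lemma NI0_derive : is_derive NI0 u (u / 2 * NK0 u).
Proof.
unfold NI0. evar_last.
- apply (is_derive_mult (fun u => sqrt 2 * u) (moment 1 qlat qlat)); [| |intros; apply Rmult_comm].
  + auto_derive; auto.
  + apply (moment_derive 1 qlat u qlat_continuous E_pos); [apply qlat_continuous|exact E_near].
- unfold plus, mult; simpl. rewrite (moment_imoment 1 qlat u E_pos). fold E.
  assert (X := exactA). unfold iM in X.
  rewrite (imoment_lin 1 qlat u qlat_continuous E_pos
    (fun t => qlat t * E t) (fun t => qlat t * qlat t / 2) (fun _ => 1)
    _ (-1) (- u) (u / 2)) in X; try (unfold E, qlat; trig_continuous).
  + unfold NK0. unfold E in X |- *.
    match type of X with _ * ?x + _ * ?y + _ * ?z = _ =>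
      transitivity (- sqrt 2 * (- 1 * x + - u * y + u / 2 * z) + sqrt 2 * u / 2 * z);
      [field|rewrite X; field] end.
  + intros t. unfold qlat. field [sg2 (cos_sqr t)].
Qed.

Lemma NI2_derive : is_derive NI2 u (u / 2 * NK1 u).
Proof.
unfold NI2. evar_last.
- apply (is_derive_mult (fun u => sqrt 2 / 2 * u * u) (moment 1 qlat (fun t => cos t * cos t)));
    [| |intros; apply Rmult_comm].
  + auto_derive; auto.
  + apply (moment_derive 1 qlat u qlat_continuous E_pos); [trig_continuous|exact E_near].
- unfold plus, mult; simpl. rewrite (moment_imoment 1 qlat u E_pos). fold E.
  assert (X := exactB). unfold iM in X.
  rewrite (imoment_lin 1 qlat u qlat_continuous E_pos
    (fun t => cos t * cos t * E t) (fun t => cos t * cos t * qlat t / 2) (fun t => 1 * E t)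
    _ 2 u (- 1)) in X; try (unfold E, qlat; trig_continuous).
  + unfold NK1. rewrite (moment_imoment 1 qlat u E_pos). unfold E in X |- *.
    match type of X with _ * ?x + _ * ?y + _ * ?z = _ =>
      transitivity (sqrt 2 / 2 * u * (2 * x + u * y + - 1 * z) + sqrt 2 * u / 2 * z);
      [field|rewrite X; field] end.
  + intros t. unfold E, qlat. field [sg2 (cos_sqr t)].
Qed.
End Lateral.

(** * From the ovals to the moments *)

Lemma RInt_substitution (F g dg : R -> R) a b : (forall x, continuous F x) ->
  (forall t, is_derive g t (dg t)) -> (forall t, continuous dg t) ->
  RInt F (g a) (g b) = RInt (fun t => dg t * F (g t)) a b.
Proof.
intros CF Dg Cdg. symmetry.
apply (RInt_comp F g dg a b); intros; auto.
Qed.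

(* The integration lemmas leave equations in the carrier of a normed module, which [ring]
   and [field] do not recognise as real numbers. *)
Ltac as_real := match goal with |- @eq _ ?x ?y => change (@eq R x y) end.

Lemma half_period_cos t : - (PI / 2) < t < PI / 2 -> 0 < cos t.
Proof. intros H. apply cos_gt_0; lra. Qed.

Section SymmetricOval.
Variables (A : annulus) (a b p h : R).
Hypothesis potE : forall x, pot A x = a / 2 * x ^ 2 + b / 4 * x ^ 4.
Hypothesis dpotE : forall x, dpot A x = a * x + b * x ^ 3.
Hypothesis p_pos : 0 < p.
Hypothesis hE : h = a * p / 2 + b * p * p / 4.
Hypothesis E_near : locally p (fun u => forall t, 0 < a + u * qsym b t).
Hypothesis slope : 0 < a + b * p.
Hypothesis in_region : region A (- sqrt p) /\ region A (sqrt p).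
Hypothesis second_factor : forall x, region A x -> 2 * a + b * (x ^ 2 + p) <> 0.
Let E_pos t : 0 < a + p * qsym b t := locally_singleton _ _ E_near t.

Lemma sym_oval_RInt f : (forall x, continuous f x) ->
  RInt (fun x => f x * branch A h x) (- sqrt p) (sqrt p) =
  RInt (fun t => f (sqrt p * sin t) * (p * (cos t * cos t)) * sqrt (a + p * qsym b t))
    (- (PI / 2)) (PI / 2).
Proof.
intros Cf. assert (S : sqrt p * sqrt p = p) by (apply sqrt_sqrt; lra).
replace (- sqrt p) with (sqrt p * sin (- (PI / 2))) by (rewrite sin_neg, sin_PI2; ring).
replace (sqrt p) with (sqrt p * sin (PI / 2)) at 2 by (rewrite sin_PI2; ring).
rewrite (RInt_substitution (fun x => f x * branch A h x) (fun t => sqrt p * sin t)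
  (fun t => sqrt p * cos t)).
- apply RInt_ext. intros t. rewrite Rmin_left, Rmax_right by apply half_period.
  intros Ht. as_real. assert (C := half_period_cos t Ht).
  assert (B : branch A h (sqrt p * sin t) = sqrt p * cos t * sqrt (a + p * qsym b t)).
  { unfold branch. rewrite <- (sqrt_square (sqrt p * cos t)) at 1.
    2: { apply Rmult_le_pos; [apply sqrt_pos|lra]. }
    rewrite <- sqrt_mult_alt.
    2: { replace (sqrt p * cos t * (sqrt p * cos t)) with (p * (cos t * cos t)).
      - apply Rmult_le_pos; [lra|]. apply Rmult_le_pos; lra.
      - transitivity (sqrt p * sqrt p * (cos t * cos t)); [now rewrite S|ring]. }
    f_equal. rewrite potE, hE. unfold qsym. field [S (cos_sqr t)]. }
  rewrite B. transitivity (f (sqrt p * sin t) * (sqrt p * sqrt p * (cos t * cos t)) * sqrt (a + p * qsym b t)).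
  + ring.
  + now rewrite S.
- intros x. apply (continuous_mult f (branch A h)); auto using branch_continuous.
- intros t. auto_derive; auto. ring.
- trig_continuous.
Qed.

Lemma sym_oval_value P f v : (forall x y, P x y = f x * y) -> (forall x, continuous f x) ->
  is_oval_integral A P h v ->
  v = 2 * RInt (fun t => f (sqrt p * sin t) * (p * (cos t * cos t)) * sqrt (a + p * qsym b t))
    (- (PI / 2)) (PI / 2).
Proof.
intros HP Cf HI. assert (S : sqrt p * sqrt p = p) by (apply sqrt_sqrt; lra).
assert (S0 : 0 < sqrt p) by now apply sqrt_lt_R0.
rewrite <- sym_oval_RInt by auto.
assert (O : forall x, x * x = p -> region A x -> oval A h x 0).
{ intros x X Rx. split; auto. rewrite Ham_pot, potE, hE. field [X]. }
apply (oval_integral_value A h (- sqrt p) (sqrt p)) with P; auto.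
- apply O; [|apply in_region]. transitivity (sqrt p * sqrt p); [ring|exact S].
- apply O; [|apply in_region]. exact S.
- lra.
- intros x [X Rx]. rewrite Ham_pot, potE, hE in X.
  (* [4 (pot x - h)] has the factor [x^2 - p]; the other factor has no zero in the region. *)
  assert (F : (x - - sqrt p) * (x - sqrt p) * (2 * a + b * (x ^ 2 + p)) = 0).
  { transitivity ((x ^ 2 - sqrt p * sqrt p) * (2 * a + b * (x ^ 2 + p))); [ring|rewrite S; nra]. }
  assert (N := second_factor x Rx).
  apply Rmult_integral in F. destruct F as [F|F]; [|tauto].
  apply Rmult_integral in F. destruct F; [left|right]; lra.
- rewrite dpotE. replace (a * - sqrt p + b * (- sqrt p) ^ 3)
    with (- (sqrt p * (a + b * p))); [nra|]. ring [S].
- rewrite dpotE. replace (a * sqrt p + b * sqrt p ^ 3)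
    with (sqrt p * (a + b * p)); [nra|]. ring [S].
Qed.

Lemma sym_oval_I0 v : is_oval_integral A (fun x y => y) h v -> v = SI0 a b p.
Proof.
intros H. rewrite (sym_oval_value (fun x y => y) (fun _ => 1) v); auto.
- unfold SI0, moment. rewrite Rmult_assoc. f_equal.
  rewrite <- (RInt_scal (V := R_CompleteNormedModule)).
  + apply RInt_ext. intros t _. change (1 * (p * (cos t * cos t)) * sqrt (a + p * qsym b t) =
      p * (cos t * cos t * sqrt (a + p * qsym b t))). ring.
  + apply continuous_RInt_ex. apply (moment_integrand_continuous a (qsym b) p (qsym_continuous b)). trig_continuous.
- intros; ring.
- intros; apply continuous_const.
Qed.

Lemma sym_oval_I2 v : is_oval_integral A (fun x y => x ^ 2 * y) h v -> v = SI2 a b p.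
Proof.
intros H. rewrite (sym_oval_value (fun x y => x ^ 2 * y) (fun x => x ^ 2) v); auto.
- unfold SI2, moment. rewrite !Rmult_assoc. f_equal. rewrite <- Rmult_assoc.
  rewrite <- (RInt_scal (V := R_CompleteNormedModule)).
  + apply RInt_ext. intros t _.
    assert (S : sqrt p * sqrt p = p) by (apply sqrt_sqrt; lra).
    change ((sqrt p * sin t) ^ 2 * (p * (cos t * cos t)) * sqrt (a + p * qsym b t) =
      p * p * (sin t * sin t * (cos t * cos t) * sqrt (a + p * qsym b t))). ring [S].
  + apply continuous_RInt_ex. apply (moment_integrand_continuous a (qsym b) p (qsym_continuous b)). trig_continuous.
- trig_continuous.
Qed.

Lemma sym_oval_values v0 v2 : is_oval_integral A (fun x y => y) h v0 ->
  is_oval_integral A (fun x y => x ^ 2 * y) h v2 -> v0 = SI0 a b p /\ v2 = SI2 a b p.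
Proof. intros H0 H2. split; [now apply sym_oval_I0|now apply sym_oval_I2]. Qed.
End SymmetricOval.

Section LateralOval.
Variables (A : annulus) (sg u h : R).
Hypothesis sg_side : (A = EightInteriorRight /\ sg = 1) \/ (A = EightInteriorLeft /\ sg = -1).
Hypothesis u_lt_1 : 0 < u < 1.
Hypothesis hE : h = (u * u - 1) / 4.

Let sg2 : sg * sg = 1.
Proof. destruct sg_side as [[_ ->]|[_ ->]]; ring. Qed.
Let E_pos t : 0 < 1 + u * qlat sg t.
Proof. assert (B := qlat_bound sg sg2 t). nra. Qed.
Let X t := sg * sqrt (1 + u * qlat sg t).

Lemma lat_oval_RInt f : (forall x, continuous f x) ->
  RInt (fun x => f x * branch A h x) (X (- (PI / 2))) (X (PI / 2)) =
  RInt (fun t => f (X t) * (sqrt 2 / 4 * (u * u) * (cos t * cos t)) * / sqrt (1 + u * qlat sg t))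
    (- (PI / 2)) (PI / 2).
Proof.
intros Cf. assert (T : sqrt 2 * sqrt 2 = 2) by (apply sqrt_sqrt; lra).
assert (T0 : 0 < sqrt 2) by (apply sqrt_lt_R0; lra).
rewrite (RInt_substitution (fun x => f x * branch A h x) X
  (fun t => u * cos t / 2 * / sqrt (1 + u * qlat sg t))).
- apply RInt_ext. intros t. rewrite Rmin_left, Rmax_right by apply half_period.
  intros Ht. as_real. assert (C := half_period_cos t Ht).
  assert (S : sqrt (1 + u * qlat sg t) * sqrt (1 + u * qlat sg t) = 1 + u * qlat sg t)
    by (apply sqrt_sqrt; apply Rlt_le, E_pos).
  assert (S0 : 0 < sqrt (1 + u * qlat sg t)) by apply sqrt_lt_R0, E_pos.
  assert (B : branch A h (X t) = sqrt 2 / 2 * u * cos t).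
  { unfold branch. rewrite <- (sqrt_square (sqrt 2 / 2 * u * cos t)).
    2: { apply Rlt_le. repeat apply Rmult_lt_0_compat; lra. }
    f_equal. transitivity (2 * (h + 1 / 2 * X t ^ 2 - 1 / 4 * X t ^ 4)).
    { destruct sg_side as [[-> _]|[-> _]]; unfold pot; field. }
    assert (X2 : X t * X t = 1 + u * qlat sg t) by (unfold X; ring [S sg2]).
    replace (X t ^ 4) with ((X t * X t) * (X t * X t)) by ring.
    replace (X t ^ 2) with (X t * X t) by ring. rewrite X2, hE. unfold qlat.
    field [T sg2 (cos_sqr t)]. }
  rewrite B. field. lra.
- intros x. apply (continuous_mult f (branch A h)); auto using branch_continuous.
- intros t. assert (S0 : 0 < sqrt (1 + u * qlat sg t)) by apply sqrt_lt_R0, E_pos.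
  evar_last.
  + unfold X. apply is_derive_scal. apply (is_derive_comp sqrt (fun t => 1 + u * qlat sg t)).
    * apply sqrt_is_derive, E_pos.
    * apply (is_derive_plus (fun _ => 1)); [apply @is_derive_const|].
      apply is_derive_scal. apply qlat_derive.
  + unfold plus, scal, zero; simpl. unfold mult, dqlat; simpl. field [sg2]. lra.
- apply (imoment_integrand_continuous 1 (qlat sg) u (qlat_continuous sg) E_pos). trig_continuous.
Qed.

Lemma lat_oval_value P f v : (forall x y, P x y = f x * y) -> (forall x, continuous f x) ->
  is_oval_integral A P h v ->
  v = 2 * RInt (fun t => f (X t) * (sqrt 2 / 4 * (u * u) * (cos t * cos t))
    * / sqrt (1 + u * qlat sg t)) (- (PI / 2)) (PI / 2).
Proof.
intros HP Cf HI. rewrite <- lat_oval_RInt by auto.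
assert (Xm : X (- (PI / 2)) = sg * sqrt (1 - u * sg))
  by (unfold X, qlat; rewrite sin_neg, sin_PI2; do 2 f_equal; ring).
assert (XM : X (PI / 2) = sg * sqrt (1 + u * sg))
  by (unfold X, qlat; rewrite sin_PI2; do 2 f_equal; ring).
assert (Sm : sqrt (1 - u) * sqrt (1 - u) = 1 - u) by (apply sqrt_sqrt; lra).
assert (SM : sqrt (1 + u) * sqrt (1 + u) = 1 + u) by (apply sqrt_sqrt; lra).
assert (Sm0 : 0 < sqrt (1 - u)) by (apply sqrt_lt_R0; lra).
assert (SM0 : 0 < sqrt (1 + u)) by (apply sqrt_lt_R0; lra).
assert (L : sqrt (1 - u) < sqrt (1 + u)) by (apply sqrt_lt_1; lra).
set (m := sqrt (1 - u)) in *. set (M := sqrt (1 + u)) in *.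
apply (oval_integral_value A h (X (- (PI / 2))) (X (PI / 2))) with P; auto; rewrite ?Xm, ?XM.
- destruct sg_side as [[-> ->]|[-> ->]].
  + replace (1 - u * 1) with (1 - u) by ring. fold m.
    split; [|simpl; lra]. rewrite hE. unfold Ham. field [Sm].
  + replace (1 - u * -1) with (1 + u) by ring. fold M.
    split; [|simpl; lra]. rewrite hE. unfold Ham. field [SM].
- destruct sg_side as [[-> ->]|[-> ->]].
  + replace (1 + u * 1) with (1 + u) by ring. fold M.
    split; [|simpl; lra]. rewrite hE. unfold Ham. field [SM].
  + replace (1 + u * -1) with (1 - u) by ring. fold m.
    split; [|simpl; lra]. rewrite hE. unfold Ham. field [Sm].
- destruct sg_side as [[-> ->]|[-> ->]].
  + replace (1 - u * 1) with (1 - u) by ring. replace (1 + u * 1) with (1 + u) by ring. fold m M. lra.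
  + replace (1 - u * -1) with (1 + u) by ring. replace (1 + u * -1) with (1 - u) by ring. fold m M. lra.
- intros x [Hx Rx].
  assert (F : (x - m) * (x + m) * ((x - M) * (x + M)) = 0).
  { transitivity ((x ^ 2 - m * m) * (x ^ 2 - M * M)); [ring|]. rewrite Sm, SM.
    rewrite hE in Hx. assert (Hx2 : - 1/2 * x^2 + 1/4 * x^4 = (u*u-1)/4) by (destruct sg_side as [[-> _]|[-> _]]; unfold Ham in Hx; lra). nra. }
  destruct sg_side as [[-> ->]|[-> ->]]; simpl in Rx.
  + replace (1 - u * 1) with (1 - u) by ring. replace (1 + u * 1) with (1 + u) by ring. fold m M.
    apply Rmult_integral in F. destruct F as [F|F]; apply Rmult_integral in F;
      destruct F as [F|F]; try lra; first [left; lra|right; lra].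
  + replace (1 - u * -1) with (1 + u) by ring. replace (1 + u * -1) with (1 - u) by ring. fold m M.
    apply Rmult_integral in F. destruct F as [F|F]; apply Rmult_integral in F;
      destruct F as [F|F]; try lra; first [left; lra|right; lra].
- destruct sg_side as [[-> ->]|[-> ->]]; unfold dpot.
  + replace (1 - u * 1) with (1 - u) by ring. fold m.
    replace (- (1 * m) + (1 * m) ^ 3) with (- (m * u)); [nra|]. ring [Sm].
  + replace (1 - u * -1) with (1 + u) by ring. fold M.
    replace (- (-1 * M) + (-1 * M) ^ 3) with (- (M * u)); [nra|]. ring [SM].
- destruct sg_side as [[-> ->]|[-> ->]]; unfold dpot.
  + replace (1 + u * 1) with (1 + u) by ring. fold M.
    replace (- (1 * M) + (1 * M) ^ 3) with (M * u); [nra|]. ring [SM].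
  + replace (1 + u * -1) with (1 - u) by ring. fold m.
    replace (- (-1 * m) + (-1 * m) ^ 3) with (m * u); [nra|]. ring [Sm].
Qed.

Lemma lat_oval_I0 v : is_oval_integral A (fun x y => y) h v -> v = NI0 sg u.
Proof.
intros H. rewrite (lat_oval_value (fun x y => y) (fun _ => 1) v); auto.
- rewrite (NI0_parts sg sg2 u u_lt_1). unfold imoment.
  transitivity (2 * (sqrt 2 / 4 * (u * u) * RInt (fun t => cos t * cos t * / sqrt (1 + u * qlat sg t))
    (- (PI / 2)) (PI / 2))); [f_equal|field].
  rewrite <- (RInt_scal (V := R_CompleteNormedModule)).
  + apply RInt_ext. intros t _.
    change (1 * (sqrt 2 / 4 * (u * u) * (cos t * cos t)) * / sqrt (1 + u * qlat sg t) =
      sqrt 2 / 4 * (u * u) * (cos t * cos t * / sqrt (1 + u * qlat sg t))). ring.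
  + apply continuous_RInt_ex.
    apply (imoment_integrand_continuous 1 (qlat sg) u (qlat_continuous sg) E_pos). trig_continuous.
- intros; ring.
- intros; apply continuous_const.
Qed.

Lemma lat_oval_I2 v : is_oval_integral A (fun x y => x ^ 2 * y) h v -> v = NI2 sg u.
Proof.
intros H. rewrite (lat_oval_value (fun x y => x ^ 2 * y) (fun x => x ^ 2) v); auto.
- unfold NI2, moment.
  transitivity (2 * (sqrt 2 / 4 * (u * u) * RInt (fun t => cos t * cos t * sqrt (1 + u * qlat sg t))
    (- (PI / 2)) (PI / 2))); [f_equal|field].
  rewrite <- (RInt_scal (V := R_CompleteNormedModule)).
  + apply RInt_ext. intros t _.
    assert (S : sqrt (1 + u * qlat sg t) * sqrt (1 + u * qlat sg t) = 1 + u * qlat sg t)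
      by (apply sqrt_sqrt; apply Rlt_le, E_pos).
    assert (S0 : 0 < sqrt (1 + u * qlat sg t)) by apply sqrt_lt_R0, E_pos.
    unfold X. change ((sg * sqrt (1 + u * qlat sg t)) ^ 2 * (sqrt 2 / 4 * (u * u) * (cos t * cos t)) * / sqrt (1 + u * qlat sg t) =
      sqrt 2 / 4 * (u * u) * (cos t * cos t * sqrt (1 + u * qlat sg t))).
    field [sg2]. lra.
  + apply continuous_RInt_ex.
    apply (moment_integrand_continuous 1 (qlat sg) u (qlat_continuous sg)). trig_continuous.
- trig_continuous.
Qed.

Lemma lat_oval_values v0 v2 : is_oval_integral A (fun x y => y) h v0 ->
  is_oval_integral A (fun x y => x ^ 2 * y) h v2 -> v0 = NI0 sg u /\ v2 = NI2 sg u.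
Proof. intros H0 H2. split; [now apply lat_oval_I0|now apply lat_oval_I2]. Qed.
End LateralOval.

(** * From the derivatives back to the Abelian integrals *)

(** The derivative of [form I0 I2 v] is [form U V (vdiff ep v)]: the derivatives of the
    polynomial factors bring [I0] and [I2] back, which the two relations express through
    [U] and [V] with coefficients of degree one. *)
Definition vdiff (ep : R) (v : vec) : vec :=
  Vec (p0 v) (q0 v + ep / 3 * p1 v + 4 / 15 * ep * q1 v)
      (7 / 3 * p1 v + 4 / 15 * q1 v) (9 / 5 * q1 v + 2 / 3 * ep * p2 v + 8 / 15 * ep * q2 v)
      (11 / 3 * p2 v + 8 / 15 * q2 v) (13 / 5 * q2 v).

(** The triangular shape of [vdiff] shows that it is injective. *)
Lemma vdiff_nonzero ep v : v <> vzero -> vdiff ep v <> vzero.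
Proof.
intros H E. apply H. destruct v as [a0 b0 a1 b1 a2 b2]. unfold vdiff, vzero in *; simpl in *.
injection E; intros E6 E5 E4 E3 E2 E1.
assert (b2 = 0) by lra. subst b2. assert (a2 = 0) by lra. subst a2.
assert (b1 = 0) by lra. subst b1. assert (a1 = 0) by lra. subst a1. f_equal; lra.
Qed.

Section Primitives.
Variable J : R -> Prop.
Hypothesis HJ : open_interval J.
Variables (ep : R) (I0 I2 U V : R -> R).
Hypothesis I0_derive : forall h, J h -> is_derive I0 h (U h).
Hypothesis I2_derive : forall h, J h -> is_derive I2 h (V h).
Hypothesis I0_relation : forall h, J h -> 3 * I0 h = 4 * h * U h + ep * V h.
Hypothesis I2_relation : forall h, J h -> 5 * I2 h = (4 * h + ep) * V h + I0 h.

Lemma form_primitive_derive v h : J h ->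
  is_derive (form I0 I2 v) h (form U V (vdiff ep v) h).
Proof.
intros Jh. unfold form. evar_last.
- apply @is_derive_plus; apply @is_derive_mult;
    [|now apply I0_derive|intros; apply Rmult_comm| |now apply I2_derive|intros; apply Rmult_comm];
    auto_derive; auto.
- assert (R0 := I0_relation h Jh). assert (R2 := I2_relation h Jh).
  assert (E0 : I0 h = (4 * h * U h + ep * V h) / 3) by lra.
  assert (E2 : I2 h = ((4 * h + ep) * V h + I0 h) / 5) by lra.
  unfold vdiff, plus, mult; simpl. rewrite E2, E0. field.
Qed.

(** Both relations can be differentiated: they express [U] and [V] through the
    differentiable functions [I0] and [I2]. *)
Lemma relations_derive h : J h -> 4 * h <> 0 -> 4 * h + ep <> 0 ->
  is_derive U h ((- U h - ep * (V h - U h) / (4 * h + ep)) / (4 * h)) /\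
  is_derive V h ((V h - U h) / (4 * h + ep)).
Proof.
intros Jh N0 N1. assert (D0 := I0_derive h Jh). assert (D2 := I2_derive h Jh).
assert (L : locally h (fun x => J x /\ (4 * x <> 0 /\ 4 * x + ep <> 0))).
{ apply filter_and; [apply HJ; auto|].
  assert (C : forall c, 4 * h + c <> 0 -> locally h (fun x => 4 * x + c <> 0)).
  { intros c Hc. assert (C : continuous (fun x => 4 * x + c) h).
    { apply (@ex_derive_continuous R_AbsRing R_NormedModule). auto_derive; auto. }
    apply (C (fun y => y <> 0)). apply (open_neq 0 (4 * h + c) Hc). }
  apply filter_and; [|now apply C]. generalize (C 0). rewrite Rplus_0_r. intros C0.
  generalize (C0 N0). apply filter_imp. intros x Hx. now rewrite Rplus_0_r in Hx. }
assert (DV : is_derive V h ((V h - U h) / (4 * h + ep))).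
{ apply is_derive_ext_loc with (fun x => (5 * I2 x - I0 x) * / (4 * x + ep)).
  - generalize L. apply filter_imp. intros x [Jx [_ Nx]]. rewrite (I2_relation x Jx).
    as_real. field. auto.
  - evar_last.
    + apply @is_derive_mult; [| |intros; apply Rmult_comm].
      * apply @is_derive_minus; [apply is_derive_scal, D2|exact D0].
      * apply (is_derive_inv (fun x => 4 * x + ep) h 4); [auto_derive; auto; ring|exact N1].
    + assert (R2 := I2_relation h Jh). assert (E2 : I2 h = ((4 * h + ep) * V h + I0 h) / 5) by lra.
      unfold plus, mult, minus, opp, scal; simpl.
      unfold plus, mult, minus, opp; simpl. rewrite E2. field. auto. }
split; [|exact DV].
apply is_derive_ext_loc with (fun x => (3 * I0 x - ep * V x) * / (4 * x)).
- generalize L. apply filter_imp. intros x [Jx [Nx _]]. rewrite (I0_relation x Jx).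
  as_real. field. lra.
- evar_last.
  + apply @is_derive_mult; [| |intros; apply Rmult_comm].
    * apply @is_derive_minus; [apply is_derive_scal, D0|apply is_derive_scal, DV].
    * apply (is_derive_inv (fun x => 4 * x) h 4); [auto_derive; auto; ring|exact N0].
  + assert (R0 := I0_relation h Jh). assert (E0 : I0 h = (4 * h * U h + ep * V h) / 3) by lra.
    unfold plus, mult, minus, opp, scal; simpl.
    unfold plus, mult, minus, opp; simpl. rewrite E0. field. split; auto; lra.
Qed.

Hypothesis U_smooth : smooth J U.
Hypothesis V_smooth : smooth J V.
Hypothesis derivative_bound : forall v, v <> vzero -> Zle J (form U V v) 5.

Lemma primitive_smooth v : smooth J (form I0 I2 v).
Proof.
assert (S0 : smooth J I0).
{ apply smooth_ext with (fun h => (4 * h * U h + ep * V h) * / 3); auto.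
  - intros h Jh. rewrite <- I0_relation by auto. field.
  - smooth_tac. }
apply form_smooth; auto.
apply smooth_ext with (fun h => ((4 * h + ep) * V h + I0 h) * / 5); auto.
- intros h Jh. rewrite <- I2_relation by auto. field.
- smooth_tac.
Qed.

Let count v eL :
  v <> vzero -> (eL = true -> left_gain J (form I0 I2 v) (form U V (vdiff ep v))) ->
  Zle J (form I0 I2 v) (5 + 1 - Z.b2z eL - Z.b2z false).
Proof.
intros Nv HL. apply (rolle_count J HJ _ (form U V (vdiff ep v)) (fun _ => 1)); auto; try easy.
- now apply form_smooth.
- now apply smooth_const.
- intros; lra.
- intros h Jh. rewrite Rmult_1_l. now apply form_primitive_derive.
- apply derivative_bound. now apply vdiff_nonzero.
Qed.

(** Rolle's theorem loses one zero. *)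
Lemma primitive_bound v : v <> vzero -> Zle J (form I0 I2 v) 6.
Proof. intros Nv. now apply (count v false Nv). Qed.

(** At a center all the integrals vanish, and Rolle's theorem loses nothing. *)
Lemma center_bound v : (forall x, J x -> 0 < x) -> (forall x y, J x -> 0 < y <= x -> J y) ->
  bounded_at0 J U -> vanishes_at0 J V -> v <> vzero -> Zle J (form I0 I2 v) 5.
Proof.
intros Jp Jd BU VV Nv. apply (count v true Nv). intros _.
apply vanishes_left_gain with (fun _ => 1); auto.
- now apply form_smooth.
- intros; lra.
- intros h Jh. rewrite Rmult_1_l. now apply form_primitive_derive.
- assert (Vid := vanishes_id J Jp). assert (Bid := vanishes_bounded J _ Vid).
  assert (Blin : forall c, bounded_at0 J (fun h => 4 * h + c)).
  { intros c. apply bounded_plus; [|apply bounded_const].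
    apply bounded_mult; [apply bounded_const|exact Bid]. }
  assert (V0 : vanishes_at0 J I0).
  { apply vanishes_ext with (fun h => (h * U h) * (4 / 3) + V h * (ep / 3)).
    - intros h Jh. assert (R0 := I0_relation h Jh). lra.
    - apply vanishes_plus; apply vanishes_mult; auto using bounded_const.
      apply vanishes_mult; auto. }
  assert (V2 : vanishes_at0 J I2).
  { apply vanishes_ext with (fun h => V h * (/ 5 * (4 * h + ep)) + I0 h * (/ 5)).
    - intros h Jh. assert (R2 := I2_relation h Jh). lra.
    - apply vanishes_plus; apply vanishes_mult; auto using bounded_const.
      apply bounded_mult; auto using bounded_const. }
  assert (Bpoly : forall a b c, bounded_at0 J (fun h => a + b * h + c * h ^ 2)).
  { intros a b c. apply bounded_plus; [apply bounded_plus|]; auto using bounded_const.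
    - apply bounded_mult; auto using bounded_const.
    - apply bounded_mult; [apply bounded_const|].
      apply (bounded_mult J (fun h => h) (fun h => h * 1)); auto.
      apply bounded_mult; auto using bounded_const. }
  apply vanishes_ext with (fun h =>
    I0 h * (p0 v + p1 v * h + p2 v * h ^ 2) + I2 h * (q0 v + q1 v * h + q2 v * h ^ 2)).
  + intros h _. unfold form. ring.
  + apply vanishes_plus; apply vanishes_mult; auto.
Qed.
End Primitives.

Lemma pf_half_of_relations (I0 I2 U V : R -> R) :
  (forall h, half_line h -> is_derive I0 h (U h)) ->
  (forall h, half_line h -> is_derive I2 h (V h)) ->
  (forall h, half_line h -> 3 * I0 h = 4 * h * U h + 1 * V h) ->
  (forall h, half_line h -> 5 * I2 h = (4 * h + 1) * V h + I0 h) -> pf_half U V.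
Proof.
intros D0 D2 R0 R2 h Hh.
destruct (relations_derive half_line half_line_open 1 I0 I2 U V D0 D2 R0 R2 h Hh) as [DU DV]; try lra.
split; auto. evar_last; [exact DU|field; lra].
Qed.

Lemma pf_quarter_of_relations (I0 I2 U V : R -> R) :
  (forall h, quarter h -> is_derive I0 h (U h)) ->
  (forall h, quarter h -> is_derive I2 h (V h)) ->
  (forall h, quarter h -> 3 * I0 h = 4 * h * U h + (-1) * V h) ->
  (forall h, quarter h -> 5 * I2 h = (4 * h + (-1)) * V h + I0 h) -> pf_quarter U V.
Proof.
intros D0 D2 R0 R2 h Hh. assert (0 < h < 1 / 4) by exact Hh.
destruct (relations_derive quarter quarter_open (-1) I0 I2 U V D0 D2 R0 R2 h Hh) as [DU DV]; try lra.
split; [evar_last; [exact DU|field; lra]|evar_last; [exact DV|field; lra]].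
Qed.

(** The coefficients with respect to the powers of [1 - 4 t]. *)
Definition vflip (v : vec) : vec :=
  Vec (p0 v + p1 v / 4 + p2 v / 16) (q0 v + q1 v / 4 + q2 v / 16)
    (- (p1 v / 4 + p2 v / 8)) (- (q1 v / 4 + q2 v / 8)) (p2 v / 16) (q2 v / 16).

Lemma vflip_nonzero v : v <> vzero -> vflip v <> vzero.
Proof.
intros H E. apply H. destruct v as [a0 b0 a1 b1 a2 b2]. unfold vflip, vzero in *; simpl in *.
injection E; intros E6 E5 E4 E3 E2 E1. f_equal; lra.
Qed.

Lemma sform_vflip U V v t : sform U V (vflip v) t = form U V v t.
Proof. unfold sform, form, vflip; simpl. field. Qed.

(** On the half line [U > 0] is the lowest eigenfunction of the chain. *)
Theorem half_line_center_bound (I0 I2 U V : R -> R) :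
  (forall h, half_line h -> is_derive I0 h (U h)) ->
  (forall h, half_line h -> is_derive I2 h (V h)) ->
  (forall h, half_line h -> 3 * I0 h = 4 * h * U h + 1 * V h) ->
  (forall h, half_line h -> 5 * I2 h = (4 * h + 1) * V h + I0 h) ->
  (forall h, 0 < h -> 0 < U h) ->
  (exists c d, 0 < c /\ 0 < d /\ (forall h, 0 < h < d -> c <= U h)) ->
  bounded_at0 half_line U -> vanishes_at0 half_line V ->
  forall v, v <> vzero -> at_most_zeros half_line (form I0 I2 v) 5.
Proof.
intros D0 D2 R0 R2 Up Ul Ub V0 v Nv.
assert (PF := pf_half_of_relations I0 I2 U V D0 D2 R0 R2).
destruct (pf_smooth U V PF) as [SU SV]. assert (HJ := half_line_open).
assert (S := primitive_smooth half_line HJ 1 I0 I2 U V R0 R2 SU SV v).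
apply (Zle_at_most half_line _ 5 S).
apply (center_bound half_line HJ 1 I0 I2 U V); auto.
- intros w Nw. apply regular_half_line_bound; auto.
- unfold half_line. intros; lra.
Qed.

Theorem quarter_center_bound (I0 I2 U V : R -> R) :
  (forall h, quarter h -> is_derive I0 h (U h)) ->
  (forall h, quarter h -> is_derive I2 h (V h)) ->
  (forall h, quarter h -> 3 * I0 h = 4 * h * U h + (-1) * V h) ->
  (forall h, quarter h -> 5 * I2 h = (4 * h + (-1)) * V h + I0 h) ->
  (forall t, quarter t -> V t < U t) ->
  (exists c d, 0 < c /\ 0 < d /\ (forall t, quarter t -> t < d -> c <= U t)) ->
  bounded_at0 quarter U -> vanishes_at0 quarter V ->
  forall v, v <> vzero -> at_most_zeros quarter (form I0 I2 v) 5.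
Proof.
intros D0 D2 R0 R2 Up Ul Ub V0 v Nv.
assert (PF := pf_quarter_of_relations I0 I2 U V D0 D2 R0 R2).
destruct (pf_quarter_smooth U V PF) as [SU SV]. assert (HJ := quarter_open).
assert (S := primitive_smooth quarter HJ (-1) I0 I2 U V R0 R2 SU SV v).
apply (Zle_at_most quarter _ 5 S).
apply (center_bound quarter HJ (-1) I0 I2 U V); auto.
- intros w Nw. apply Zle_ext with (sform U V (vflip w)); auto.
  + intros; apply sform_vflip.
  + apply regular_quarter_bound; auto using vflip_nonzero.
- intros x [X _]; auto.
- unfold quarter. intros; lra.
Qed.

(** * Spans *)

Lemma span_form J I0 I2 f : span_I0_I2 J I0 I2 f ->
  exists v, forall h, J h -> f h = form I0 I2 v h.
Proof.
intros [a [b E]]. exists (Vec (a 0%nat) (b 0%nat) (a 1%nat) (b 1%nat) (a 2%nat) (b 2%nat)).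
intros h Jh. rewrite (E h Jh). unfold form; simpl. ring.
Qed.

Lemma form_vzero I0 I2 h : form I0 I2 vzero h = 0.
Proof. unfold form, vzero; simpl. ring. Qed.

(** A nonzero function of the span comes from a nonzero vector of coefficients. *)
Lemma span_at_most J I0 I2 N : open_interval J ->
  (forall v, v <> vzero -> at_most_zeros J (form I0 I2 v) N) ->
  forall f, span_I0_I2 J I0 I2 f -> not_identically_zero J f -> at_most_zeros J f N.
Proof.
intros HJ B f Sf [h [Jh Nh]]. destruct (span_form J I0 I2 f Sf) as [v E].
apply at_most_ext with (form I0 I2 v); auto.
- intros; symmetry; auto.
- apply B. intros ->. apply Nh. rewrite (E h Jh). apply form_vzero.
Qed.

Definition span_basis (I0 I2 : R -> R) (i : nat) (h : R) : R :=
  match i with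
  | 0%nat => I0 h | 1%nat => h * I0 h | 2%nat => h ^ 2 * I0 h
  | 3%nat => I2 h | 4%nat => h * I2 h | _ => h ^ 2 * I2 h
  end.

(** The bound on zeros also gives the dimension: a linear relation would be a nonzero vector
    whose form has a zero of every order. *)
Lemma span_chebyshev J I0 I2 : open_interval J -> (exists h, J h) ->
  (forall v, v <> vzero -> at_most_zeros J (form I0 I2 v) 5) ->
  chebyshev J (span_I0_I2 J I0 I2) 6.
Proof.
intros HJ [h0 J0] B. split; [|now apply span_at_most].
exists (span_basis I0 I2). split; [|split].
- intros i Hi. exists (fun k => if Nat.eqb k i then 1 else 0), (fun k => if Nat.eqb (k + 3) i then 1 else 0).
  intros h _. do 6 (destruct i as [|i]; [simpl; ring|]). lia.
- intros c Hc.
  pose (v := Vec (c 0%nat) (c 3%nat) (c 1%nat) (c 4%nat) (c 2%nat) (c 5%nat)).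
  assert (Z : forall h, J h -> form I0 I2 v h = 0).
  { intros h Jh. rewrite <- (Hc h Jh). unfold lincomb, form, v; simpl. ring. }
  assert (Ev : v = vzero).
  { apply NNPP. intros Nv. specialize (B v Nv ((h0, 6%nat) :: nil)).
    assert (H : (6 <= 5)%nat); [|lia]. apply B.
    - simpl. constructor; [easy|constructor].
    - intros x m [E|[]]. injection E as <- <-. split; auto. intros j _.
      (* a function that vanishes near a point has there a zero of every order *)
      apply is_derive_n_ext_loc with (fun _ => 0).
      + generalize (proj1 HJ h0 J0). apply filter_imp. intros h Jh. symmetry. auto.
      + destruct j; [reflexivity|]. apply (is_derive_n_const j 0). }
  unfold v, vzero in Ev. injection Ev. intros.
  do 6 (destruct i as [|i]; [assumption|]). lia.
- intros f [a [b E]].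
  exists (fun i => match i with 0 => a 0 | 1 => a 1 | 2 => a 2 | 3 => b 0 | 4 => b 1 | _ => b 2 end)%nat.
  intros h Jh. rewrite (E h Jh). unfold lincomb; simpl. ring.
Qed.

Lemma at_most_zeros_translate (J K : R -> Prop) f c N : (forall x, J x -> K (x - c)) ->
  at_most_zeros K (fun t => f (t + c)) N -> at_most_zeros J f N.
Proof.
intros JK H l ND Hl.
specialize (H (map (fun p => (fst p - c, snd p)) l)).
replace (map snd l) with (map snd (map (fun p => (fst p - c, snd p)) l))
  by (rewrite map_map; reflexivity).
apply H.
- rewrite map_map. simpl. rewrite <- (map_map fst (fun x => x - c)).
  apply NoDup_map_NoDup_ForallPairs; auto. intros x y _ _ E. lra.
- intros x m Hin. apply in_map_iff in Hin. destruct Hin as [[y n] [E Hy]]. simpl in E.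
  injection E as <- <-. destruct (Hl y n Hy) as [Jy Oy]. split; auto.
  intros j Hj. apply is_derive_n_comp_trans. replace (y - c + c) with y by ring. now apply Oy.
Qed.

(** * Sizes of the moments *)

Lemma imoment_le a q p (w1 w2 : R -> R) : (forall t, continuous q t) -> (forall t, 0 < a + p * q t) ->
  (forall t, continuous w1 t) -> (forall t, continuous w2 t) ->
  (forall t, w1 t <= w2 t) -> imoment a q w1 p <= imoment a q w2 p.
Proof.
intros Cq E0 C1 C2 H. unfold imoment. apply RInt_le.
- apply half_period.
- apply continuous_RInt_ex. now apply imoment_integrand_continuous.
- apply continuous_RInt_ex. now apply imoment_integrand_continuous.
- intros t _. apply Rmult_le_compat_r; auto. apply Rlt_le, Rinv_0_lt_compat, sqrt_lt_R0, E0.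
Qed.

Lemma imoment_scal a q p (w : R -> R) c : (forall t, continuous q t) ->
  (forall t, 0 < a + p * q t) -> (forall t, continuous w t) ->
  imoment a q (fun t => c * w t) p = c * imoment a q w p.
Proof.
intros Cq E0 C. rewrite (imoment_lin a q p Cq E0 w w w (fun t => c * w t) c 0 0); auto.
- ring.
- intros t. ring.
Qed.

Lemma imoment_one_bounds a q p m M : (forall t, continuous q t) -> 0 < m ->
  (forall t, m <= a + p * q t <= M) ->
  PI / sqrt M <= imoment a q (fun _ => 1) p <= PI / sqrt m.
Proof.
intros Cq m0 B. assert (E0 : forall t, 0 < a + p * q t) by (intros t; specialize (B t); lra).
assert (M0 : 0 < M) by (specialize (B 0); lra).
assert (H := RInt_bounds (fun t => 1 * / sqrt (a + p * q t)) (- (PI / 2)) (PI / 2)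
  (/ sqrt M) (/ sqrt m) half_period).
replace (PI / sqrt M) with (/ sqrt M * (PI / 2 - - (PI / 2)))
  by (field; apply Rgt_not_eq, sqrt_lt_R0; lra).
replace (PI / sqrt m) with (/ sqrt m * (PI / 2 - - (PI / 2)))
  by (field; apply Rgt_not_eq, sqrt_lt_R0; lra).
apply H.
- apply imoment_integrand_continuous; auto. intros; apply continuous_const.
- intros t. rewrite Rmult_1_l. specialize (B t).
  assert (0 < sqrt (a + p * q t)) by apply sqrt_lt_R0, E0.
  split; apply Rinv_le_contravar; auto; try apply sqrt_lt_R0; auto; apply sqrt_le_1_alt; lra.
Qed.

Lemma sin_sqr_bounds t : 0 <= sin t * sin t <= 1.
Proof. assert (H := SIN_bound t). nra. Qed.

Lemma RInt_sin_sqr : RInt (fun t => sin t * sin t) (- (PI / 2)) (PI / 2) = PI / 2.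
Proof.
apply is_RInt_unique.
replace (PI / 2) with (minus ((PI / 2 - sin (PI / 2) * cos (PI / 2)) / 2)
  ((- (PI / 2) - sin (- (PI / 2)) * cos (- (PI / 2))) / 2)) at 3.
- apply (is_RInt_derive (fun t => (t - sin t * cos t) / 2)).
  + intros t _. auto_derive; auto. field [(cos_sqr t)].
  + intros t _. revert t. trig_continuous.
- rewrite cos_neg, cos_PI2. unfold minus, plus, opp; simpl. field.
Qed.

Section SymmetricSizes.
Variables (a b p : R).
Hypothesis p_pos : 0 < p.
Hypothesis E_pos : forall t, 0 < a + p * qsym b t.

Lemma SK1_le : SK1 a b p <= p * SK0 a b p.
Proof.
unfold SK0, SK1.
assert (H : imoment a (qsym b) (fun t => sin t * sin t) p <= imoment a (qsym b) (fun _ => 1) p).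
{ apply imoment_le; auto using qsym_continuous; try trig_continuous. intros t. apply sin_sqr_bounds. }
nra.
Qed.

Lemma SK1_nonneg : 0 <= SK1 a b p.
Proof.
unfold SK1.
assert (H : imoment a (qsym b) (fun t => 0 * 1) p <= imoment a (qsym b) (fun t => sin t * sin t) p).
{ apply imoment_le; auto using qsym_continuous; try trig_continuous.
  intros t. assert (B := sin_sqr_bounds t). lra. }
rewrite (imoment_scal a (qsym b) p (fun _ => 1) 0) in H; auto using qsym_continuous; [|trig_continuous].
apply Rmult_le_pos; lra.
Qed.

Lemma SK0_bounds m M : 0 < m -> (forall t, m <= a + p * qsym b t <= M) ->
  2 * PI / sqrt M <= SK0 a b p <= 2 * PI / sqrt m.
Proof.
intros m0 B. unfold SK0.
assert (H := imoment_one_bounds a (qsym b) p m M (qsym_continuous b) m0 B).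
unfold Rdiv in *. lra.
Qed.
End SymmetricSizes.

(** Here [p] is a function of the energy, inverse to [a p / 2 + b p^2 / 4]. *)
Section Energy.
Variables (a b : R) (J : R -> Prop) (p dp : R -> R).
Hypothesis a2 : a * a = 1.
Hypothesis b2 : b * b = 1.
Hypothesis p_energy : forall h, J h -> h = a * p h / 2 + b * p h * p h / 4.
Hypothesis p_derive : forall h, J h -> is_derive p h (dp h).
Hypothesis dp_slope : forall h, J h -> dp h * ((a + b * p h) / 2) = 1.
Hypothesis E_near : forall h, J h -> locally (p h) (fun u => forall t, 0 < a + u * qsym b t).

Lemma energy_SI0_derive h : J h -> is_derive (fun h => SI0 a b (p h)) h (SK0 a b (p h)).
Proof.
intros Jh. evar_last.
- apply (is_derive_comp (SI0 a b) p); [apply SI0_derive|]; auto.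
- change (dp h * ((a + b * p h) / 2 * SK0 a b (p h)) = SK0 a b (p h)).
  rewrite <- Rmult_assoc, dp_slope; auto. ring.
Qed.

Lemma energy_SI2_derive h : J h -> is_derive (fun h => SI2 a b (p h)) h (SK1 a b (p h)).
Proof.
intros Jh. evar_last.
- apply (is_derive_comp (SI2 a b) p); [apply SI2_derive|]; auto.
- change (dp h * ((a + b * p h) / 2 * SK1 a b (p h)) = SK1 a b (p h)).
  rewrite <- Rmult_assoc, dp_slope; auto. ring.
Qed.

Lemma energy_SI0 h : J h -> 3 * SI0 a b (p h) = 4 * h * SK0 a b (p h) - a * SK1 a b (p h).
Proof. intros Jh. rewrite (p_energy h Jh) at 2. apply SI0_relation; auto. Qed.

Lemma energy_SI2 h : J h -> 5 * SI2 a b (p h) = (4 * h + b) * SK1 a b (p h) - a * b * SI0 a b (p h).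
Proof. intros Jh. rewrite (p_energy h Jh) at 2. apply SI2_relation; auto. Qed.
End Energy.

(** * The global center *)

Definition gp (h : R) : R := sqrt (1 + 4 * h) - 1.

Lemma gp_sqr h : 0 < h -> 0 < gp h /\ (gp h + 1) * (gp h + 1) = 1 + 4 * h.
Proof.
intros H. unfold gp. assert (S : sqrt (1 + 4 * h) * sqrt (1 + 4 * h) = 1 + 4 * h) by (apply sqrt_sqrt; lra).
assert (0 <= sqrt (1 + 4 * h)) by apply sqrt_pos. split; nra.
Qed.

Lemma radicand_near a b p lo hi : lo < p < hi ->
  (forall u t, lo < u < hi -> 0 < a + u * qsym b t) ->
  locally p (fun u => forall t, 0 < a + u * qsym b t).
Proof.
intros Hp H. apply (locally_interval _ p lo hi); simpl; try lra.
intros u L1 L2 t. apply H. simpl in *. lra.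
Qed.

Lemma gp_near h : 0 < h -> locally (gp h) (fun u => forall t, 0 < 1 + u * qsym 1 t).
Proof.
intros H. destruct (gp_sqr h H) as [P _]. apply radicand_near with 0 (gp h + 1); try lra.
intros u t Hu. unfold qsym. assert (B := sin_sqr_bounds t). nra.
Qed.
Lemma gp_derive h : 0 < h -> is_derive gp h (2 / (gp h + 1)).
Proof.
intros H. destruct (gp_sqr h H) as [P _]. unfold gp at 1. auto_derive; [lra|].
unfold gp in *. field. lra.
Qed.

Lemma gp_energy h : 0 < h -> h = 1 * gp h / 2 + 1 * gp h * gp h / 4.
Proof. intros H. destruct (gp_sqr h H) as [P E]. lra. Qed.
Lemma gp_slope h : 0 < h -> 2 / (gp h + 1) * ((1 + 1 * gp h) / 2) = 1.
Proof. intros H. destruct (gp_sqr h H) as [P E]. field. lra. Qed.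

Definition gX (h : R) : R := SK0 1 1 (gp h).
(** The sign of the second integral is changed, so that the system becomes the one of the
    eight loop. *)
Definition gY (h : R) : R := - SK1 1 1 (gp h).
Definition gI0 (h : R) : R := SI0 1 1 (gp h).
Definition gI2 (h : R) : R := - SI2 1 1 (gp h).

Lemma g_relations :
  (forall h, half_line h -> is_derive gI0 h (gX h)) /\
  (forall h, half_line h -> is_derive gI2 h (gY h)) /\
  (forall h, half_line h -> 3 * gI0 h = 4 * h * gX h + 1 * gY h) /\
  (forall h, half_line h -> 5 * gI2 h = (4 * h + 1) * gY h + gI0 h).
Proof.
assert (o : 1 * 1 = 1) by ring.
assert (A0 := energy_SI0 1 1 half_line gp gp_energy gp_near).
assert (A2 := energy_SI2 1 1 half_line gp o o gp_energy gp_near).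
split; [|split; [|split]]; intros h Hh.
- apply (energy_SI0_derive 1 1 half_line gp _ gp_derive gp_slope gp_near h Hh).
- apply (is_derive_opp (fun h => SI2 1 1 (gp h))).
  apply (energy_SI2_derive 1 1 half_line gp _ gp_derive gp_slope gp_near h Hh).
- specialize (A0 h Hh). unfold gI0, gX, gY. lra.
- specialize (A2 h Hh). unfold gI0, gI2, gY. lra.
Qed.

Lemma bounded_by (J : R -> Prop) f C d : 0 < d -> 0 <= C ->
  (forall x, J x -> x < d -> - C <= f x <= C) -> bounded_at0 J f.
Proof.
intros d0 C0 H. exists C, d. repeat split; auto. intros x Jx Hx. apply Rabs_le. auto.
Qed.

Lemma vanishes_by (J : R -> Prop) f C d : (forall x, J x -> 0 < x) -> 0 < d -> 0 <= C ->
  (forall x, J x -> x < d -> - (C * x) <= f x <= C * x) -> vanishes_at0 J f.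
Proof.
intros Jp d0 C0 H. apply vanishes_ext with (fun x => x * (f x * / x)).
- intros x Jx. specialize (Jp x Jx). field. lra.
- apply vanishes_mult; [now apply vanishes_id|].
  apply bounded_by with C d; auto. intros x Jx Hx. specialize (H x Jx Hx).
  assert (x0 := Jp x Jx). assert (0 < / x) by now apply Rinv_0_lt_compat.
  assert (E : f x = f x * / x * x) by (field; lra).
  split; apply Rmult_le_reg_r with x; auto; lra.
Qed.

Lemma gE_pos h t : 0 < h -> 0 < 1 + gp h * qsym 1 t.
Proof. intros H. apply (locally_singleton _ _ (gp_near h H)). Qed.

Lemma gX_bounds h : 0 < h -> 2 * PI / sqrt (1 + gp h) <= gX h <= 2 * PI.
Proof.
intros H. destruct (gp_sqr h H) as [P _].
replace (2 * PI) with (2 * PI / sqrt 1) at 2 by (rewrite sqrt_1; field).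
unfold gX. apply (SK0_bounds 1 1 (gp h)); [lra|]. intros t. unfold qsym.
assert (B := sin_sqr_bounds t). nra.
Qed.

Lemma gX_pos h : 0 < h -> 0 < gX h.
Proof.
intros H. destruct (gX_bounds h H) as [B _]. destruct (gp_sqr h H) as [P _].
apply Rlt_le_trans with (2 := B). apply Rdiv_lt_0_compat; [assert (X := PI_RGT_0); lra|].
apply sqrt_lt_R0. lra.
Qed.

Lemma gX_low : exists c d, 0 < c /\ 0 < d /\ forall h, 0 < h < d -> c <= gX h.
Proof.
assert (X := PI_RGT_0). assert (S : 0 < sqrt 2) by (apply sqrt_lt_R0; lra).
exists (2 * PI / sqrt 2), (1 / 2). split; [apply Rdiv_lt_0_compat; lra|]. split; [lra|].
intros h [H1 H2]. destruct (gp_sqr h H1) as [P E]. destruct (gX_bounds h H1) as [B _].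
apply Rle_trans with (2 := B). unfold Rdiv. apply Rmult_le_compat_l; [lra|].
apply Rinv_le_contravar; [apply sqrt_lt_R0; lra|]. apply sqrt_le_1_alt. nra.
Qed.

Lemma gX_bd : bounded_at0 half_line gX.
Proof.
assert (X := PI_RGT_0). apply bounded_by with (2 * PI) 1; try lra.
intros h Hh _. assert (P := gX_pos h Hh). destruct (gX_bounds h Hh) as [_ B]. lra.
Qed.

Lemma gY_bounds h : 0 < h -> - (2 * h * gX h) <= gY h <= 0.
Proof.
intros H. destruct (gp_sqr h H) as [P E].
assert (G := SK1_le 1 1 (gp h) P (fun t => gE_pos h t H)).
assert (N := SK1_nonneg 1 1 (gp h) P (fun t => gE_pos h t H)).
assert (X := gX_pos h H). unfold gY. fold (gX h) in G.
assert (gp h * gX h <= 2 * h * gX h) by (apply Rmult_le_compat_r; nra). lra.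
Qed.

Lemma gY_vanishes : vanishes_at0 half_line gY.
Proof.
assert (X := PI_RGT_0). apply vanishes_by with (4 * PI) 1; try lra; auto.
intros h Hh _. destruct (gX_bounds h Hh) as [_ B]. assert (Y := gY_bounds h Hh).
assert (h * gX h <= h * (2 * PI)) by (apply Rmult_le_compat_l; auto; apply Rlt_le, Hh).
assert (0 < h) by exact Hh. split; nra.
Qed.

Lemma gY_over : bounded_at0 half_line (fun h => gY h * / h).
Proof.
assert (X := PI_RGT_0). apply bounded_by with (4 * PI) 1; try lra.
intros h Hh _. destruct (gX_bounds h Hh) as [_ B]. assert (Y := gY_bounds h Hh).
assert (h0 : 0 < h) by exact Hh. assert (I := Rinv_0_lt_compat h h0).
assert (E : gY h * / h * h = gY h) by (field; lra).
split; apply Rmult_le_reg_r with h; auto; rewrite E; nra.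
Qed.

Theorem global_center_bound v : v <> vzero -> at_most_zeros half_line (form gI0 gI2 v) 5.
Proof.
destruct g_relations as [D0 [D2 [R0 R2]]].
apply (half_line_center_bound gI0 gI2 gX gY); auto using gX_pos, gX_low, gX_bd, gY_vanishes.
Qed.

(** * The truncated pendulum *)

Definition tp (h : R) : R := 1 - sqrt (1 - 4 * h).

Lemma tp_sqr h : quarter h -> 0 < tp h < 1 /\ (1 - tp h) * (1 - tp h) = 1 - 4 * h.
Proof.
intros [H1 H2]. unfold tp.
assert (S : sqrt (1 - 4 * h) * sqrt (1 - 4 * h) = 1 - 4 * h) by (apply sqrt_sqrt; lra).
assert (0 < sqrt (1 - 4 * h)) by (apply sqrt_lt_R0; lra). split; [split|]; nra.
Qed.
Lemma tp_near h : quarter h -> locally (tp h) (fun u => forall t, 0 < 1 + u * qsym (-1) t).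
Proof.
intros H. destruct (tp_sqr h H) as [P _]. apply radicand_near with 0 1; try lra.
intros u t Hu. unfold qsym. assert (B := sin_sqr_bounds t). nra.
Qed.
Lemma tp_derive h : quarter h -> is_derive tp h (2 / (1 - tp h)).
Proof.
intros H. destruct (tp_sqr h H) as [P _]. unfold tp at 1. destruct H. auto_derive; [lra|].
unfold tp in *. replace (1 + - (4 * h)) with (1 - 4 * h) by ring. field. lra.
Qed.
Lemma tp_energy h : quarter h -> h = 1 * tp h / 2 + (-1) * tp h * tp h / 4.
Proof. intros H. destruct (tp_sqr h H) as [P E]. lra. Qed.
Lemma tp_slope h : quarter h -> 2 / (1 - tp h) * ((1 + (-1) * tp h) / 2) = 1.
Proof. intros H. destruct (tp_sqr h H) as [P E]. field. lra. Qed.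

Definition tU (h : R) : R := SK0 1 (-1) (tp h).
Definition tV (h : R) : R := SK1 1 (-1) (tp h).
Definition tI0 (h : R) : R := SI0 1 (-1) (tp h).
Definition tI2 (h : R) : R := SI2 1 (-1) (tp h).

Lemma tU_bounds h : quarter h -> 2 * PI <= tU h <= 2 * PI / sqrt (1 - tp h).
Proof.
intros H. destruct (tp_sqr h H) as [P _].
replace (2 * PI) with (2 * PI / sqrt 1) at 1 by (rewrite sqrt_1; field).
unfold tU. apply (SK0_bounds 1 (-1) (tp h)); [lra|]. intros t. unfold qsym.
assert (B := sin_sqr_bounds t). nra.
Qed.

Lemma tV_bounds h : quarter h -> 0 <= tV h <= tp h * tU h.
Proof.
intros H. destruct (tp_sqr h H) as [P _].
assert (E := fun t => locally_singleton _ _ (tp_near h H) t). split.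
- now apply SK1_nonneg.
- now apply SK1_le.
Qed.

Lemma tU_upper h : quarter h -> h < 1 / 8 -> tU h <= 4 * PI.
Proof.
intros H L. destruct (tp_sqr h H) as [P E]. destruct (tU_bounds h H) as [_ B].
assert (X := PI_RGT_0). apply Rle_trans with (1 := B).
assert (S : 1 / 2 <= sqrt (1 - tp h)).
{ rewrite <- (sqrt_square (1 / 2)) by lra. apply sqrt_le_1_alt. nra. }
apply Rmult_le_reg_r with (sqrt (1 - tp h)); [lra|].
replace (2 * PI / sqrt (1 - tp h) * sqrt (1 - tp h)) with (2 * PI) by (field; lra). nra.
Qed.

Theorem pendulum_bound v : v <> vzero -> at_most_zeros quarter (form tI0 tI2 v) 5.
Proof.
assert (X := PI_RGT_0). assert (o : 1 * 1 = 1) by ring. assert (o' : (-1) * (-1) = 1) by ring.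
assert (A0 := energy_SI0 1 (-1) quarter tp tp_energy tp_near).
assert (A2 := energy_SI2 1 (-1) quarter tp o o' tp_energy tp_near).
apply (quarter_center_bound tI0 tI2 tU tV).
- intros h Hh. apply (energy_SI0_derive 1 (-1) quarter tp _ tp_derive tp_slope tp_near h Hh).
- intros h Hh. apply (energy_SI2_derive 1 (-1) quarter tp _ tp_derive tp_slope tp_near h Hh).
- intros h Hh. specialize (A0 h Hh). unfold tI0, tU, tV. lra.
- intros h Hh. specialize (A2 h Hh). unfold tI0, tI2, tV. lra.
- intros h Hh. assert (B := tV_bounds h Hh). assert (C := tU_bounds h Hh).
  destruct (tp_sqr h Hh) as [P _]. nra.
- exists (2 * PI), 1. repeat split; try lra. intros h Hh _. apply (tU_bounds h Hh).
- apply bounded_by with (4 * PI) (1 / 8); try lra. intros h Hh L.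
  assert (B := tU_upper h Hh L). assert (C := tU_bounds h Hh). lra.
- apply vanishes_by with (16 * PI) (1 / 8); try lra.
  + intros h [Hh _]; auto.
  + intros h Hh L. assert (B := tU_upper h Hh L). assert (C := tV_bounds h Hh).
    assert (D := tU_bounds h Hh). destruct (tp_sqr h Hh) as [P E]. destruct Hh as [H1 H2].
    assert (tp h <= 4 * h) by nra.
    assert (tp h * tU h <= 4 * h * (4 * PI)) by (apply Rmult_le_compat; lra).
    assert (0 <= 16 * PI * h) by nra. lra.
Qed.

(** * The interior of the eight loop *)

Definition lu (t : R) : R := 2 * sqrt t.

Lemma lu_sqr t : quarter t -> 0 < lu t < 1 /\ lu t * lu t = 4 * t.
Proof.
intros [H1 H2]. unfold lu. assert (S : sqrt t * sqrt t = t) by (apply sqrt_sqrt; lra).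
assert (0 < sqrt t) by (apply sqrt_lt_R0; lra). split; [split|]; nra.
Qed.
Lemma lu_derive t : quarter t -> is_derive lu t (2 / lu t).
Proof.
intros H. destruct (lu_sqr t H) as [P E]. destruct H. unfold lu at 1. auto_derive; [lra|].
unfold lu in *. field. lra.
Qed.
Lemma lu_vanishes : vanishes_at0 quarter lu.
Proof.
intros e He. exists (e * e / 4). split; [nra|]. intros t Ht L. destruct (lu_sqr t Ht) as [P E].
rewrite Rabs_right by lra. nra.
Qed.

Section Lateral.
Variable sg : R.
Hypothesis sg2 : sg * sg = 1.

Definition lU (t : R) : R := NK0 sg (lu t).
Definition lV (t : R) : R := NK0 sg (lu t) - NK1 sg (lu t).
Definition lI0 (t : R) : R := NI0 sg (lu t).
(** In the energy counted from the center, [t = h + 1/4], the functions [NI0], [NI0 - NI2]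
    satisfy the same relations as the two integrals of the pendulum. *)
Definition lJ2 (t : R) : R := NI0 sg (lu t) - NI2 sg (lu t).

Lemma l_chain (F dF : R -> R) t : quarter t -> is_derive F (lu t) (lu t / 2 * dF (lu t)) ->
  is_derive (fun t => F (lu t)) t (dF (lu t)).
Proof.
intros Ht D. destruct (lu_sqr t Ht) as [P _]. evar_last.
- apply (is_derive_comp F lu); [exact D|now apply lu_derive].
- change (2 / lu t * (lu t / 2 * dF (lu t)) = dF (lu t)). field. lra.
Qed.

Lemma lU_bounds t : quarter t ->
  sqrt 2 * (PI / sqrt (1 + lu t)) <= lU t <= sqrt 2 * (PI / sqrt (1 - lu t)).
Proof.
intros H. destruct (lu_sqr t H) as [P _].
assert (B := imoment_one_bounds 1 (qlat sg) (lu t) (1 - lu t) (1 + lu t) (qlat_continuous sg)).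
assert (S := sqrt_pos 2). unfold lU, NK0. split; apply Rmult_le_compat_l; auto; apply B; try lra;
  intros s; assert (Q := qlat_bound sg sg2 s); nra.
Qed.

Lemma lU_pos t : quarter t -> 0 < lU t.
Proof.
intros H. destruct (lU_bounds t H) as [B _]. destruct (lu_sqr t H) as [P _].
apply Rlt_le_trans with (2 := B). apply Rmult_lt_0_compat; [apply sqrt_lt_R0; lra|].
apply Rdiv_lt_0_compat; [apply PI_RGT_0|apply sqrt_lt_R0; lra].
Qed.

Lemma lV_bounds t : quarter t -> - (lu t * lU t) <= lV t <= lu t * lU t.
Proof.
intros H. destruct (lu_sqr t H) as [P _].
assert (E : forall s, 0 < 1 + lu t * qlat sg s)
  by (intros s; assert (Q := qlat_bound sg sg2 s); nra).
assert (C := qlat_continuous sg). assert (S := sqrt_pos 2).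
unfold lV, lU, NK1, NK0. rewrite (moment_imoment 1 (qlat sg) (lu t) E).
assert (L : forall c, imoment 1 (qlat sg) (fun _ => c * 1) (lu t) = c * imoment 1 (qlat sg) (fun _ => 1) (lu t)).
{ intros c. apply (imoment_scal 1 (qlat sg) (lu t) (fun _ => 1) c C E). trig_continuous. }
assert (B1 : imoment 1 (qlat sg) (fun _ => (1 - lu t) * 1) (lu t)
  <= imoment 1 (qlat sg) (fun s => 1 * (1 + lu t * qlat sg s)) (lu t)).
{ apply imoment_le; auto; try (unfold qlat; trig_continuous).
  intros s; assert (Q := qlat_bound sg sg2 s); nra. }
assert (B2 : imoment 1 (qlat sg) (fun s => 1 * (1 + lu t * qlat sg s)) (lu t)
  <= imoment 1 (qlat sg) (fun _ => (1 + lu t) * 1) (lu t)).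
{ apply imoment_le; auto; try (unfold qlat; trig_continuous).
  intros s; assert (Q := qlat_bound sg sg2 s); nra. }
rewrite L in B1, B2. split; nra.
Qed.

Lemma lU_upper t : quarter t -> t < 1 / 16 -> lU t <= 4 * PI.
Proof.
intros H L. destruct (lu_sqr t H) as [P E]. destruct (lU_bounds t H) as [_ B].
assert (X := PI_RGT_0). apply Rle_trans with (1 := B).
assert (S : 1 / 2 <= sqrt (1 - lu t)).
{ rewrite <- (sqrt_square (1 / 2)) by lra. apply sqrt_le_1_alt. nra. }
assert (T : sqrt 2 * sqrt 2 = 2) by (apply sqrt_sqrt; lra). assert (T0 := sqrt_pos 2).
assert (PI / sqrt (1 - lu t) <= 2 * PI).
{ apply Rmult_le_reg_r with (sqrt (1 - lu t)); [lra|].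
  replace (PI / sqrt (1 - lu t) * sqrt (1 - lu t)) with PI by (field; lra). nra. }
assert (sqrt 2 <= 2) by nra.
replace (4 * PI) with (2 * (2 * PI)) by ring. apply Rmult_le_compat; auto.
apply Rlt_le, Rdiv_lt_0_compat; lra.
Qed.

Theorem lateral_bound v : v <> vzero -> at_most_zeros quarter (form lI0 lJ2 v) 5.
Proof.
assert (X := PI_RGT_0).
apply (quarter_center_bound lI0 lJ2 lU lV).
- intros t Ht. destruct (lu_sqr t Ht) as [P E].
  apply (l_chain (NI0 sg) (NK0 sg)); auto. now apply NI0_derive.
- intros t Ht. destruct (lu_sqr t Ht) as [P E].
  apply (is_derive_minus (fun t => NI0 sg (lu t)) (fun t => NI2 sg (lu t))).
  + apply (l_chain (NI0 sg) (NK0 sg)); auto. now apply NI0_derive.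
  + apply (l_chain (NI2 sg) (NK1 sg)); auto. now apply NI2_derive.
- intros t Ht. destruct (lu_sqr t Ht) as [P E].
  assert (R0 := NI0_relation sg sg2 (lu t) P). rewrite E in R0. unfold lI0, lU, lV. lra.
- intros t Ht. destruct (lu_sqr t Ht) as [P E].
  assert (R0 := NI0_relation sg sg2 (lu t) P). assert (R2 := NI2_relation sg sg2 (lu t) P).
  rewrite E in R0, R2. unfold lI0, lJ2, lV. lra.
- intros t Ht. assert (B := lV_bounds t Ht). assert (C := lU_pos t Ht).
  destruct (lu_sqr t Ht) as [P _]. nra.
- assert (S : 0 < sqrt 2) by (apply sqrt_lt_R0; lra).
  exists (sqrt 2 * (PI / sqrt 2)), 1. split; [|split; [lra|]].
  + apply Rmult_lt_0_compat; auto. apply Rdiv_lt_0_compat; auto.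
  + intros t Ht _. destruct (lU_bounds t Ht) as [B _]. destruct (lu_sqr t Ht) as [P _].
    apply Rle_trans with (2 := B). apply Rmult_le_compat_l; [lra|].
    unfold Rdiv. apply Rmult_le_compat_l; [lra|].
    apply Rinv_le_contravar; [apply sqrt_lt_R0; lra|]. apply sqrt_le_1_alt. lra.
- apply bounded_by with (4 * PI) (1 / 16); try lra. intros t Ht L.
  assert (B := lU_upper t Ht L). assert (C := lU_pos t Ht). lra.
- apply vanishes_ext with (fun t => lu t * (lV t * / lu t)).
  + intros t Ht. destruct (lu_sqr t Ht) as [P E]. field. lra.
  + apply vanishes_mult; [apply lu_vanishes|].
    apply bounded_by with (4 * PI) (1 / 16); try lra. intros t Ht L.
    assert (B := lU_upper t Ht L). assert (C := lV_bounds t Ht).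
    assert (D := lU_pos t Ht). destruct (lu_sqr t Ht) as [P _].
    assert (F : lV t * / lu t * lu t = lV t) by (field; lra).
    split; apply Rmult_le_reg_r with (lu t); try lra; rewrite F; nra.
Qed.

(** Translating the energy and replacing [NI2] by [NI0 - NI2] maps forms to forms. *)
Lemma lateral_bound_energy I0 I2 J : (forall h, J h <-> -1 / 4 < h < 0) ->
  (forall h, J h -> I0 h = NI0 sg (lu (h + 1 / 4))) ->
  (forall h, J h -> I2 h = NI2 sg (lu (h + 1 / 4))) ->
  forall v, v <> vzero -> at_most_zeros J (form I0 I2 v) 5.
Proof.
intros HJ E0 E2 v Nv. apply (at_most_zeros_translate J quarter _ (- 1 / 4)).
{ intros x Jx. apply HJ in Jx. unfold quarter. lra. }
destruct v as [a0 b0 a1 b1 a2 b2].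
pose (A0 := a0 - a1 / 4 + a2 / 16). pose (B0 := b0 - b1 / 4 + b2 / 16).
pose (A1 := a1 - a2 / 2). pose (B1 := b1 - b2 / 2).
pose (w := Vec (A0 + B0) (- B0) (A1 + B1) (- B1) (a2 + b2) (- b2)).
apply at_most_ext with (form lI0 lJ2 w); [apply quarter_open| |].
- intros t Ht. assert (Jt : J (t + - 1 / 4)) by (apply HJ; destruct Ht; lra).
  assert (Et : t + - 1 / 4 + 1 / 4 = t) by field.
  unfold form. rewrite (E0 _ Jt), (E2 _ Jt), Et. unfold w, lI0, lJ2, A0, A1, B0, B1; simpl. field.
- apply lateral_bound. intros E. apply Nv. unfold w, vzero in *. injection E.
  intros. unfold A0, A1, B0, B1 in *. f_equal; lra.
Qed.
End Lateral.

(** * The exterior of the eight loop *)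

Definition xp (h : R) : R := 1 + sqrt (1 + 4 * h).

Lemma xp_sqr h : 0 < h -> 2 < xp h /\ (xp h - 1) * (xp h - 1) = 1 + 4 * h.
Proof.
intros H. unfold xp. assert (S : sqrt (1 + 4 * h) * sqrt (1 + 4 * h) = 1 + 4 * h) by (apply sqrt_sqrt; lra).
assert (0 <= sqrt (1 + 4 * h)) by apply sqrt_pos. split; nra.
Qed.
Lemma xp_near h : 0 < h -> locally (xp h) (fun u => forall t, 0 < -1 + u * qsym 1 t).
Proof.
intros H. destruct (xp_sqr h H) as [P _]. apply radicand_near with 2 (xp h + 1); try lra.
intros u t Hu. unfold qsym. assert (B := sin_sqr_bounds t). nra.
Qed.
Lemma xp_derive h : 0 < h -> is_derive xp h (2 / (xp h - 1)).
Proof.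
intros H. destruct (xp_sqr h H) as [P _]. unfold xp at 1. auto_derive; [lra|].
unfold xp in *. field. lra.
Qed.
Lemma xp_energy h : 0 < h -> h = (-1) * xp h / 2 + 1 * xp h * xp h / 4.
Proof. intros H. destruct (xp_sqr h H) as [P E]. lra. Qed.
Lemma xp_slope h : 0 < h -> 2 / (xp h - 1) * ((-1 + 1 * xp h) / 2) = 1.
Proof. intros H. destruct (xp_sqr h H) as [P E]. field. lra. Qed.

Definition xU (h : R) : R := SK0 (-1) 1 (xp h).
Definition xV (h : R) : R := SK1 (-1) 1 (xp h).
Definition xI0 (h : R) : R := SI0 (-1) 1 (xp h).
Definition xI2 (h : R) : R := SI2 (-1) 1 (xp h).

Lemma x_relations :
  (forall h, half_line h -> is_derive xI0 h (xU h)) /\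
  (forall h, half_line h -> is_derive xI2 h (xV h)) /\
  (forall h, half_line h -> 3 * xI0 h = 4 * h * xU h + 1 * xV h) /\
  (forall h, half_line h -> 5 * xI2 h = (4 * h + 1) * xV h + xI0 h).
Proof.
assert (o : 1 * 1 = 1) by ring. assert (o' : (-1) * (-1) = 1) by ring.
assert (A0 := energy_SI0 (-1) 1 half_line xp xp_energy xp_near).
assert (A2 := energy_SI2 (-1) 1 half_line xp o' o xp_energy xp_near).
split; [|split; [|split]]; intros h Hh.
- apply (energy_SI0_derive (-1) 1 half_line xp _ xp_derive xp_slope xp_near h Hh).
- apply (energy_SI2_derive (-1) 1 half_line xp _ xp_derive xp_slope xp_near h Hh).
- specialize (A0 h Hh). unfold xI0, xU, xV. lra.
- specialize (A2 h Hh). unfold xI0, xI2, xV. lra.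
Qed.

Lemma xE_bounds h t : 0 < h -> xp h / 2 - 1 <= -1 + xp h * qsym 1 t <= xp h.
Proof.
intros H. destruct (xp_sqr h H) as [P _]. unfold qsym. assert (B := sin_sqr_bounds t). nra.
Qed.

Lemma xU_bounds h : 0 < h -> 2 * PI / sqrt (xp h) <= xU h <= 2 * PI / sqrt (xp h / 2 - 1).
Proof.
intros H. destruct (xp_sqr h H) as [P _]. unfold xU.
apply (SK0_bounds (-1) 1 (xp h)); [lra|]. intros t. now apply xE_bounds.
Qed.

Lemma xU_pos h : 0 < h -> 0 < xU h.
Proof.
intros H. destruct (xp_sqr h H) as [P _]. destruct (xU_bounds h H) as [B _].
apply Rlt_le_trans with (2 := B). assert (X := PI_RGT_0).
apply Rdiv_lt_0_compat; [lra|apply sqrt_lt_R0; lra].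
Qed.

(** The square of [x] stays below twice the radicand, so that the integral for [xV]
    is not singular at the saddle loop. *)
Lemma xV_bounds h : 0 < h -> sqrt (xp h) * PI <= xV h <= 4 * sqrt (xp h) * PI.
Proof.
intros H. destruct (xp_sqr h H) as [P _].
assert (E0 : forall t, 0 < -1 + xp h * qsym 1 t).
{ intros t. assert (B := xE_bounds h t H). lra. }
assert (S : sqrt (xp h) * sqrt (xp h) = xp h) by (apply sqrt_sqrt; lra).
assert (S0 : 0 < sqrt (xp h)) by (apply sqrt_lt_R0; lra).
assert (C : forall t, continuous (fun t => sin t * sin t * / sqrt (-1 + xp h * qsym 1 t)) t).
{ apply imoment_integrand_continuous; auto using qsym_continuous. trig_continuous. }
assert (B : forall t, / sqrt (xp h) * (sin t * sin t) <= sin t * sin t * / sqrt (-1 + xp h * qsym 1 t)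
  <= 2 * / sqrt (xp h)).
{ intros t. assert (Bt := xE_bounds h t H). assert (D := sin_sqr_bounds t).
  assert (T0 : 0 < sqrt (-1 + xp h * qsym 1 t)) by apply sqrt_lt_R0, E0.
  assert (T : sqrt (-1 + xp h * qsym 1 t) * sqrt (-1 + xp h * qsym 1 t) = -1 + xp h * qsym 1 t)
    by (apply sqrt_sqrt, Rlt_le, E0).
  assert (L : sqrt (-1 + xp h * qsym 1 t) <= sqrt (xp h)) by (apply sqrt_le_1_alt; lra).
  split.
  - rewrite (Rmult_comm (/ _)). apply Rmult_le_compat_l; [lra|]. apply Rinv_le_contravar; auto.
  - apply Rmult_le_reg_r with (sqrt (-1 + xp h * qsym 1 t)); auto.
    replace (sin t * sin t * / sqrt (-1 + xp h * qsym 1 t) * sqrt (-1 + xp h * qsym 1 t))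
      with (sin t * sin t) by (field; lra).
    apply Rmult_le_reg_r with (sqrt (xp h)); auto.
    replace (2 * / sqrt (xp h) * sqrt (-1 + xp h * qsym 1 t) * sqrt (xp h))
      with (2 * sqrt (-1 + xp h * qsym 1 t)) by (field; lra).
    apply Rsqr_incr_0_var; [|lra]. unfold Rsqr.
    replace (sin t * sin t * sqrt (xp h) * (sin t * sin t * sqrt (xp h)))
      with ((sin t * sin t) * (sin t * sin t) * (sqrt (xp h) * sqrt (xp h))) by ring.
    replace (2 * sqrt (-1 + xp h * qsym 1 t) * (2 * sqrt (-1 + xp h * qsym 1 t)))
      with (4 * (sqrt (-1 + xp h * qsym 1 t) * sqrt (-1 + xp h * qsym 1 t))) by ring.
    rewrite S, T. unfold qsym. set (y := sin t * sin t) in *.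
    assert (0 <= y * (2 - y) * xp h) by (apply Rmult_le_pos; [apply Rmult_le_pos|]; lra). lra. }
assert (X := PI_RGT_0).
assert (Lo : / sqrt (xp h) * (PI / 2) <= imoment (-1) (qsym 1) (fun t => sin t * sin t) (xp h)).
{ rewrite <- RInt_sin_sqr.
  rewrite <- (RInt_scal (V := R_CompleteNormedModule)).
  2: { apply continuous_RInt_ex. trig_continuous. }
  apply RInt_le; [apply half_period| | |].
  - apply continuous_RInt_ex. intros t.
    apply (continuous_scal_r (/ sqrt (xp h)) (fun t => sin t * sin t)). revert t. trig_continuous.
  - now apply continuous_RInt_ex.
  - intros t _. apply B. }
assert (Hi : imoment (-1) (qsym 1) (fun t => sin t * sin t) (xp h) <= 2 * / sqrt (xp h) * PI).
{ assert (Hb := RInt_bounds _ (- (PI / 2)) (PI / 2) 0 (2 * / sqrt (xp h)) half_period C).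
  replace (PI / 2 - - (PI / 2)) with PI in Hb by field. apply Hb. intros t. split; [|apply B].
  apply Rmult_le_pos; [apply sin_sqr_bounds|]. apply Rlt_le, Rinv_0_lt_compat, sqrt_lt_R0, E0. }
unfold xV, SK1.
replace (sqrt (xp h) * PI) with (2 * xp h * (/ sqrt (xp h) * (PI / 2))).
2: { rewrite <- S at 1. field. lra. }
replace (4 * sqrt (xp h) * PI) with (2 * xp h * (2 * / sqrt (xp h) * PI)).
2: { rewrite <- S at 1. field. lra. }
split; apply Rmult_le_compat_l; auto; lra.
Qed.

(** [xp h / 2 - 1] is the minimum of the radicand; it tends to [0] at the saddle loop. *)
Lemma xp_half h : 0 < h -> 0 < xp h / 2 - 1 /\ h = (xp h / 2 - 1) * (xp h / 2).
Proof. intros H. destruct (xp_sqr h H) as [P E]. split; [lra|]. nra. Qed.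

Lemma x_hU_vanishes : vanishes_at0 half_line (fun h => h * xU h).
Proof.
assert (X := PI_RGT_0). assert (J0 : forall x, half_line x -> 0 < x) by auto.
intros eps He. (* [h U <= 2 PI (m + 1) sqrt m] with the minimum [m] of the radicand, and [m <= h]. *)
pose (c := eps / (8 * PI)).
assert (c0 : 0 < c) by (apply Rdiv_lt_0_compat; lra).
exists (Rmin 1 (c * c)). split; [apply Rmin_pos; nra|]. intros h Hh L.
assert (L1 := Rlt_le_trans _ _ _ L (Rmin_l _ _)). assert (L2 := Rlt_le_trans _ _ _ L (Rmin_r _ _)).
assert (h0 := J0 h Hh). destruct (xp_half h h0) as [m0 E]. destruct (xU_bounds h h0) as [_ B].
assert (U0 := xU_pos h h0). rewrite Rabs_right by nra.
set (m := xp h / 2 - 1) in *. assert (E' : h = m * (m + 1)) by (rewrite E at 1; unfold m; field).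
assert (S : sqrt m * sqrt m = m) by (apply sqrt_sqrt; lra).
assert (S0 : 0 < sqrt m) by now apply sqrt_lt_R0.
assert (h * xU h <= h * (2 * PI / sqrt m)) by (apply Rmult_le_compat_l; lra).
assert (F : h * (2 * PI / sqrt m) = 2 * PI * (m + 1) * sqrt m).
{ rewrite E'. rewrite <- S at 1. field. lra. }
assert (m <= h) by nra.
assert (sqrt m < c) by (apply Rnot_le_lt; intros N; nra).
assert (Q : 8 * PI * c = eps) by (unfold c; field; lra).
assert (Ps : 0 < PI * sqrt m) by now apply Rmult_lt_0_compat.
assert (0 <= (1 - m) * (PI * sqrt m)) by (apply Rmult_le_pos; lra).
assert (PI * sqrt m < PI * c) by (apply Rmult_lt_compat_l; lra). nra.
Qed.

Lemma xI0_infty A : exists H, 0 < H /\ forall h, H < h -> A <= xI0 h.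
Proof.
(* [3 I0 >= V >= sqrt p * PI], and [p > A^2] as soon as [h > A^4]. *)
exists (A * A * (A * A) + 1). split; [nra|]. intros h Hh.
assert (h0 : 0 < h) by nra. destruct x_relations as [_ [_ [R0 _]]]. specialize (R0 h h0).
assert (U0 := xU_pos h h0). destruct (xV_bounds h h0) as [B _].
assert (hU : 0 < h * xU h) by nra.
destruct (xp_sqr h h0) as [P E].
assert (K : A * A <= xp h) by nra.
assert (S : sqrt (xp h) * sqrt (xp h) = xp h) by (apply sqrt_sqrt; lra).
assert (S0 : 0 < sqrt (xp h)) by (apply sqrt_lt_R0; lra).
assert (A <= sqrt (xp h)) by nra.
assert (P3 : 3 < PI) by (assert (Q := PI2_3_2); lra). nra.
Qed.

Lemma xU_small eps : 0 < eps -> exists H, 0 < H /\ forall h, H < h -> xU h <= eps * xV h.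
Proof.
(* [U / V <= 2 / sqrt (m p)] and [m p = 2 h]. *)
intros He. assert (X := PI_RGT_0). exists (2 / (eps * eps)).
assert (e2 : 0 < eps * eps) by nra. assert (H0 : 0 < 2 / (eps * eps)) by (apply Rdiv_lt_0_compat; lra).
split; auto. intros h Hh. assert (h0 : 0 < h) by lra.
destruct (xp_half h h0) as [m0 E]. destruct (xU_bounds h h0) as [_ BU].
destruct (xV_bounds h h0) as [BV _]. set (m := xp h / 2 - 1) in *.
assert (p0 : 0 < xp h) by (unfold m in m0; lra).
assert (S : sqrt m * sqrt m = m) by (apply sqrt_sqrt; lra).
assert (S0 : 0 < sqrt m) by now apply sqrt_lt_R0.
assert (T : sqrt (xp h) * sqrt (xp h) = xp h) by (apply sqrt_sqrt; lra).
assert (T0 : 0 < sqrt (xp h)) by now apply sqrt_lt_R0.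
assert (eh : 2 < eps * eps * h).
{ replace 2 with (2 / (eps * eps) * (eps * eps)) by (field; lra). nra. }
assert (K : 2 <= eps * (sqrt m * sqrt (xp h))).
{ assert (W : (sqrt m * sqrt (xp h)) * (sqrt m * sqrt (xp h)) = 2 * h).
  { transitivity ((sqrt m * sqrt m) * (sqrt (xp h) * sqrt (xp h))); [ring|]. rewrite S, T. lra. }
  assert (W0 : 0 < sqrt m * sqrt (xp h)) by nra. set (w := sqrt m * sqrt (xp h)) in *.
  assert (4 <= (eps * w) * (eps * w)).
  { replace (eps * w * (eps * w)) with (eps * eps * (w * w)) by ring. rewrite W. lra. }
  assert (0 < eps * w) by nra. nra. }
apply Rle_trans with (1 := BU). apply Rle_trans with (eps * (sqrt (xp h) * PI)); [|nra].
apply Rmult_le_reg_r with (sqrt m); auto.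
replace (2 * PI / sqrt m * sqrt m) with (2 * PI) by (field; lra). nra.
Qed.

Lemma xV_small eps : 0 < eps -> exists H, 0 < H /\ forall h, H < h -> xV h <= eps * (h * xU h).
Proof.
(* [V <= p U] and [p / h = 2 / m]. *)
intros He. pose (M := 2 / eps). assert (M0 : 0 < M) by (apply Rdiv_lt_0_compat; lra).
exists (M * (M + 1)). split; [nra|]. intros h Hh. assert (h0 : 0 < h) by nra.
destruct (xp_half h h0) as [m0 E]. assert (U0 := xU_pos h h0).
assert (p0 : 0 < xp h) by lra.
assert (B := SK1_le (-1) 1 (xp h) p0 (fun t => locally_singleton _ _ (xp_near h h0) t)).
fold (xU h) (xV h) in B.
assert (K : M <= xp h / 2 - 1) by nra.
assert (EM : eps * M = 2) by (unfold M; field; lra).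
assert (xp h <= eps * h).
{ assert (2 <= eps * (xp h / 2 - 1)) by nra.
  assert (F : eps * h = eps * (xp h / 2 - 1) * (xp h / 2)) by (rewrite Rmult_assoc, <- E; reflexivity).
  rewrite F. nra. }
apply Rle_trans with (1 := B). rewrite <- Rmult_assoc. apply Rmult_le_compat_r; lra.
Qed.

(** The global center provides the regular solution of the same system. *)
Theorem eight_exterior_bound v : v <> vzero -> at_most_zeros half_line (form xI0 xI2 v) 6.
Proof.
assert (X := PI_RGT_0). intros Nv. destruct x_relations as [D0 [D2 [R0 R2]]].
assert (PF := pf_half_of_relations xI0 xI2 xU xV D0 D2 R0 R2).
destruct (pf_smooth xU xV PF) as [SU SV]. assert (HJ := half_line_open).
destruct g_relations as [G0 [G2 [GR0 GR2]]].
assert (S := primitive_smooth half_line HJ 1 xI0 xI2 xU xV R0 R2 SU SV v).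
apply (Zle_at_most half_line _ 6 S).
apply (primitive_bound half_line HJ 1 xI0 xI2 xU xV); auto.
intros w Nw. apply (exterior_bound xU xV xI0 gX gY); auto using xU_pos, x_hU_vanishes, xI0_infty,
  xU_small, xV_small, gX_pos, gX_low, gX_bd, gY_over.
- intros h h0. destruct (xV_bounds h h0) as [B _]. destruct (xp_sqr h h0) as [P _].
  assert (0 < sqrt (xp h)) by (apply sqrt_lt_R0; lra). nra.
- exists PI, (4 * 4 * PI), 1. split; [lra|]. split; [lra|]. intros h [h0 h1].
  destruct (xV_bounds h h0) as [B C]. destruct (xp_sqr h h0) as [P E].
  assert (1 <= sqrt (xp h)) by (rewrite <- sqrt_1 at 1; apply sqrt_le_1_alt; lra).
  assert (sqrt (xp h) <= 4).
  { rewrite <- (sqrt_square 4) by lra. apply sqrt_le_1_alt. nra. }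
  split; nra.
- apply (pf_half_of_relations gI0 gI2); auto.
Qed.

(** * The annuli *)

Lemma span_at_most_transfer A I0 I2 F0 F2 N : open_interval (interval A) ->
  (forall h, interval A h -> I0 h = F0 h /\ I2 h = F2 h) ->
  (forall v, v <> vzero -> at_most_zeros (interval A) (form F0 F2 v) N) ->
  forall v, v <> vzero -> at_most_zeros (interval A) (form I0 I2 v) N.
Proof.
intros HJ E B v Nv. apply at_most_ext with (form F0 F2 v); auto.
intros h Jh. destruct (E h Jh) as [E0 E2]. unfold form. now rewrite E0, E2.
Qed.

Lemma global_center_values (I0 I2 : R -> R) :
  (forall h, half_line h -> is_oval_integral GlobalCenter (fun x y => y) h (I0 h)) ->
  (forall h, half_line h -> is_oval_integral GlobalCenter (fun x y => x ^ 2 * y) h (I2 h)) ->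
  forall h, half_line h -> I0 h = gI0 h /\ I2 h = - gI2 h.
Proof.
intros H0 H2 h Hh. destruct (gp_sqr h Hh) as [P _].
unfold gI0, gI2. rewrite Ropp_involutive.
apply (sym_oval_values GlobalCenter 1 1 (gp h) h); auto using gp_near, gp_energy.
- intros; unfold dpot; field.
- lra.
- split; exact I.
- intros x _. nra.
Qed.

Lemma pendulum_values (I0 I2 : R -> R) :
  (forall h, quarter h -> is_oval_integral TruncatedPendulum (fun x y => y) h (I0 h)) ->
  (forall h, quarter h -> is_oval_integral TruncatedPendulum (fun x y => x ^ 2 * y) h (I2 h)) ->
  forall h, quarter h -> I0 h = tI0 h /\ I2 h = tI2 h.
Proof.
intros H0 H2 h Hh. destruct (tp_sqr h Hh) as [P _].
assert (S : sqrt (tp h) * sqrt (tp h) = tp h) by (apply sqrt_sqrt; lra).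
assert (S0 : 0 < sqrt (tp h)) by (apply sqrt_lt_R0; lra).
apply (sym_oval_values TruncatedPendulum 1 (-1) (tp h) h); auto using tp_near, tp_energy.
- intros; unfold pot; field.
- intros; unfold dpot; field.
- lra.
- lra.
- simpl. split; split; nra.
- simpl. intros x Hx. nra.
Qed.

Lemma exterior_values (I0 I2 : R -> R) :
  (forall h, half_line h -> is_oval_integral EightExterior (fun x y => y) h (I0 h)) ->
  (forall h, half_line h -> is_oval_integral EightExterior (fun x y => x ^ 2 * y) h (I2 h)) ->
  forall h, half_line h -> I0 h = xI0 h /\ I2 h = xI2 h.
Proof.
intros H0 H2 h Hh. destruct (xp_sqr h Hh) as [P _].
apply (sym_oval_values EightExterior (-1) 1 (xp h) h); auto using xp_near, xp_energy.
- intros; unfold dpot; field.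
- lra.
- lra.
- split; exact I.
- intros x _. nra.
Qed.

Lemma interval_open A : open_interval (interval A).
Proof.
assert (L : open_interval (fun h => -1 / 4 < h < 0)).
{ split; [|intros; lra]. intros x Hx.
  apply (locally_interval _ x (-1 / 4) 0); simpl; [lra|lra|]. intros y H1 H2. split; auto. }
destruct A; [exact half_line_open|exact quarter_open|exact L|exact L|exact half_line_open].
Qed.

Lemma global_center_span v : v <> vzero ->
  at_most_zeros half_line (form gI0 (fun h => - gI2 h) v) 5.
Proof.
intros Nv. pose (w := Vec (p0 v) (- q0 v) (p1 v) (- q1 v) (p2 v) (- q2 v)).
apply at_most_ext with (form gI0 gI2 w); [exact half_line_open| |].
- intros h _. unfold form, w; simpl. ring.
- apply global_center_bound. intros E. apply Nv. destruct v as [a0 b0 a1 b1 a2 b2].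
  unfold w, vzero in *; simpl in E. injection E. intros. f_equal; lra.
Qed.

Lemma lateral_span A sg (I0 I2 : R -> R) :
  (A = EightInteriorRight /\ sg = 1) \/ (A = EightInteriorLeft /\ sg = -1) ->
  (forall h, interval A h -> is_oval_integral A (fun x y => y) h (I0 h)) ->
  (forall h, interval A h -> is_oval_integral A (fun x y => x ^ 2 * y) h (I2 h)) ->
  forall v, v <> vzero -> at_most_zeros (interval A) (form I0 I2 v) 5.
Proof.
intros HA H0 H2.
assert (sg2 : sg * sg = 1) by (destruct HA as [[_ ->]|[_ ->]]; ring).
assert (IA : forall h, interval A h <-> -1 / 4 < h < 0)
  by (destruct HA as [[-> _]|[-> _]]; simpl; tauto).
assert (E : forall h, interval A h -> I0 h = NI0 sg (lu (h + 1 / 4)) /\ I2 h = NI2 sg (lu (h + 1 / 4))).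
{ intros h Jh. assert (Jh' := proj1 (IA h) Jh).
  destruct (lu_sqr (h + 1 / 4)) as [P Q]; [unfold quarter; lra|].
  apply (lat_oval_values A sg (lu (h + 1 / 4)) h); auto. lra. }
apply (lateral_bound_energy sg sg2 I0 I2 (interval A) IA).
- intros h Jh. now apply E.
- intros h Jh. now apply E.
Qed.

Theorem theorem6 :
  forall (A : annulus) (I0 I2 : R -> R),
    (forall h, interval A h -> is_oval_integral A (fun x y => y) h (I0 h)) ->
    (forall h, interval A h -> is_oval_integral A (fun x y => x ^ 2 * y) h (I2 h)) ->
    (A <> EightExterior ->
       chebyshev (interval A) (span_I0_I2 (interval A) I0 I2) 6) /\
    (A = EightExterior ->
       forall f, span_I0_I2 (interval A) I0 I2 f ->
         not_identically_zero (interval A) f ->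
         at_most_zeros (interval A) f 6).
Proof.
intros A I0 I2 H0 H2. assert (HJ := interval_open A). split.
- intros NA. apply span_chebyshev; auto.
  + destruct A; simpl; [exists 1|exists (1 / 8)|exists (-1 / 8)|exists (-1 / 8)|exists 1]; lra.
  + destruct A; [| | | |easy].
    * apply (span_at_most_transfer GlobalCenter I0 I2 gI0 (fun h => - gI2 h)); auto.
      -- now apply global_center_values.
      -- apply global_center_span.
    * apply (span_at_most_transfer TruncatedPendulum I0 I2 tI0 tI2); auto.
      -- now apply pendulum_values.
      -- apply pendulum_bound.
    * now apply (lateral_span EightInteriorLeft (-1)); auto.
    * now apply (lateral_span EightInteriorRight 1); auto.
- intros ->. apply span_at_most; auto.
  apply (span_at_most_transfer EightExterior I0 I2 xI0 xI2); auto.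
  + now apply exterior_values.
  + apply eight_exterior_bound.
Qed.
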